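(* Every term is observationally equivalent to a linear combination of traces: for every term $P$ there exist finitely many traces $T_1,\dots,T_n$ and $k_1,\dots,k_n\in\mathbb K$ with $P\simeq k_1\cdot\{T_1\}\oplus\cdots\oplus k_n\cdot\{T_n\}$.
   Context: Calculus: fix a commutative semiring $\mathbb K$, a countable set $\mathcal N$ of names, polarities $+,-$ ($\neg$ exchanges them). Actions $u^\varepsilon(x)$ (subject $u$, bound name $x$); $u(x):=u^+(x)$, $\bar u(x):=u^-(x)$; an action written without object has a fresh bound object. Terms $P::=k\mid\alpha.P\mid\diamond P\mid P|Q\mid P\parallel Q\mid\nu xP$ ($k\in\mathbb K$), up to injective renaming of bound names and commutation of restrictions. Positions: finite integer sequences, prefix order, independent = incomparable. Labels: visible $u^\varepsilon(x):\iota$, internal $(\iota,\kappa)$. Transitions: $\alpha.P\xrightarrow{\alpha:\epsilon}\diamond P$; if $P\xrightarrow{a}P'$ then $\diamond P\xrightarrow{1.a}\diamond P'$, $P|Q\xrightarrow{1.a}P'|Q$, $Q|P\xrightarrow{2.a}Q|P'$, likewise for $\parallel$, $\nu xP\xrightarrow{a}\nu xP'$ if $x\notin a$; if $P\xrightarrow{u^\varepsilon(x):\iota}P'$, $Q\xrightarrow{u^{\neg\varepsilon}(y):\kappa}Q'$ then $P|Q\xrightarrow{(1.\iota,2.\kappa)}\nu x(P'|Q'[x/y])$. Homotopy: smallest congruence on label sequences with $ab\sim ba$ when all positions of $a,b$ are pairwise independent. Run: homotopy class of maximal internal-label transition sequences from $P$, end term $P/\rho$. State $s(k)=k$, $s(\alpha.P)=1$,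 $s(\diamond P)=s(\nu xP)=s(P)$, $s(P|Q)=s(P\parallel Q)=s(P)s(Q)$; outcome $\langle P\rangle=\sum_{\rho\in\mathrm{Runs}(P)}s(P/\rho)$; $P\simeq Q$ iff $\langle P|R\rangle=\langle Q|R\rangle$ for all $R$. $P\oplus Q:=\nu u((u.P|u.Q)|\bar u.1)$ ($u$ fresh), $k\cdot P:=k|P$. Linear action $\underline{\alpha}.P:=\nu w(\alpha.(P|w.1)|(w.0|\bar w.1))$ ($w$ fresh); a prefix without continuation has continuation $1$. Trace $T=(|T|,p,s,\le,N)$: finite set $|T|$ of events, $p:|T|\to\{+,-\}$, $s:|T|\to\mathcal N\uplus|T|$, partial order $\le$ on $|T|$ with $s(b)=a\Rightarrow a<b$, finite $N\subseteq\{+,-\}\times(\mathcal N\uplus|T|)$. Implementation $\{T\}$: with fresh names $x_{ab},y_{ab},z_a$ ($a,b\in|T|$), $\mathrm{act}(a)=s(a)^{p(a)}(z_a)$ if $s(a)\in\mathcal N$, else $z_{s(a)}^{p(a)}(z_a)$; $A_a^T:=\{\underline{x}_{ba}\}_{b<a}.\underline{\mathrm{act}(a)}.(\prod_{a<c}\underline{\bar y}_{ac}\parallel\prod_{s(c)=a}A_c^T\parallel\prod_{(\varepsilon,a)\in N}z_a^\varepsilon.0)$, where $\{\underline{x}_{ba}\}_{b<a}$ is a sequence of linear prefixes $\underline{x_{ba}}$ for all $b<a$ and $\prod$ is $\parallel$-composition; $\{T\}:=\nu(x_{ab},y_{ab})_{a,b}(\prod_{s(a)\in\mathcal N}A_a^T\,|\,\prod_{a<b}\underline{y}_{ab}.\underline{\bar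 x}_{ab})\parallel\prod_{(\varepsilon,u)\in N,u\in\mathcal N}u^\varepsilon.0$. *)

(* Defs.v *)
From HB Require Import structures.
From mathcomp Require Import all_boot all_algebra.
From mathcomp Require Import boolp.
Set Implicit Arguments. Unset Strict Implicit. Unset Printing Implicit Defensive.
Import GRing.Theory.
Local Open Scope ring_scope.

(* Polarity: true = +, false = -.  Names: nat, used as de Bruijn indices.
   Free names of a top-level term are the indices not bound inside it. *)

Section Terms.
Variable K : Type.

(* Act s e P  is  s^e(x).P  where the object x is bound as index 0 in P;
   Nu P is nu x P with x bound as index 0 in P. *)
Inductive term :=
| Const of K
| Act of nat & bool & term
| Dia of term
| Par of term & term
| PPar of term & term
| Nu of term.

Definition up (f : nat -> nat) (i : nat) : nat :=
  if i is j.+1 then (f j).+1 else 0%N.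

Fixpoint ren (f : nat -> nat) (P : term) : term :=
  match P with
  | Const k => Const k
  | Act s e Q => Act (f s) e (ren (up f) Q)
  | Dia Q => Dia (ren f Q)
  | Par Q R => Par (ren f Q) (ren f R)
  | PPar Q R => PPar (ren f Q) (ren f R)
  | Nu Q => Nu (ren (up f) Q)
  end.

Definition swap01 (i : nat) : nat :=
  match i with 0 => 1 | 1 => 0 | n => n end%N.

Definition pos := seq nat.

(* Visible transitions  P --s^e(x):i--> P'  : (s, e, i, P') where P' has the
   (bound) object x as index 0, and the names of P shifted by one. *)
Fixpoint vis (P : term) : seq (nat * bool * pos * term) :=
  match P with
  | Const _ => [::]
  | Act s e Q => [:: (s, e, [::], Dia Q)]
  | Dia Q => [seq (t.1.1.1, t.1.1.2, 1%N :: t.1.2, Dia t.2) | t <- vis Q]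
  | Par Q R =>
      [seq (t.1.1.1, t.1.1.2, 1%N :: t.1.2, Par t.2 (ren S R)) | t <- vis Q] ++
      [seq (t.1.1.1, t.1.1.2, 2%N :: t.1.2, Par (ren S Q) t.2) | t <- vis R]
  | PPar Q R =>
      [seq (t.1.1.1, t.1.1.2, 1%N :: t.1.2, PPar t.2 (ren S R)) | t <- vis Q] ++
      [seq (t.1.1.1, t.1.1.2, 2%N :: t.1.2, PPar (ren S Q) t.2) | t <- vis R]
  | Nu Q =>
      [seq (t.1.1.1.-1, t.1.1.2, t.1.2, Nu (ren swap01 t.2))
      | t <- vis Q & t.1.1.1 != 0%N]
  end.

Fixpoint int (P : term) : seq (pos * pos * term) :=
  match P with
  | Const _ => [::]
  | Act _ _ _ => [::]
  | Dia Q => [seq (1%N :: t.1.1, 1%N :: t.1.2, Dia t.2) | t <- int Q]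
  | Par Q R =>
      [seq (1%N :: t.1.1, 1%N :: t.1.2, Par t.2 R) | t <- int Q] ++
      [seq (2%N :: t.1.1, 2%N :: t.1.2, Par Q t.2) | t <- int R] ++
      flatten [seq [seq (1%N :: a.1.2, 2%N :: b.1.2, Nu (Par a.2 b.2))
                   | b <- vis R & (a.1.1.1 == b.1.1.1) && (b.1.1.2 == ~~ a.1.1.2)]
              | a <- vis Q]
  | PPar Q R =>
      [seq (1%N :: t.1.1, 1%N :: t.1.2, PPar t.2 R) | t <- int Q] ++
      [seq (2%N :: t.1.1, 2%N :: t.1.2, PPar Q t.2) | t <- int R]
  | Nu Q => [seq (t.1.1, t.1.2, Nu t.2) | t <- int Q]
  end.

Fixpoint nacts (P : term) : nat :=
  match P with
  | Const _ => 0
  | Act _ _ Q => (nacts Q).+1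
  | Dia Q => nacts Q
  | Par Q R => nacts Q + nacts R
  | PPar Q R => nacts Q + nacts R
  | Nu Q => nacts Q
  end%N.

Definition ilabel := (pos * pos)%type.

(* Maximal sequences of internal transitions (label sequence, end term).
   Each internal step consumes two prefixes, so fuel [nacts P] suffices. *)
Fixpoint execs (fuel : nat) (P : term) : seq (seq ilabel * term) :=
  match int P with
  | [::] => [:: ([::], P)]
  | ts => if fuel is f.+1 then
            flatten [seq [seq ((t.1.1, t.1.2) :: e.1, e.2) | e <- execs f t.2] | t <- ts]
          else [::]
  end.

Definition maxexecs (P : term) := execs (nacts P) P.

End Terms.

Definition indep (i j : pos) : bool := ~~ prefix i j && ~~ prefix j i.
Definition lab_indep (a b : ilabel) : bool :=
  [&& indep a.1 b.1, indep a.1 b.2, indep a.2 b.1 & indep a.2 b.2].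

Inductive hstep : seq ilabel -> seq ilabel -> Prop :=
| HSwap l1 l2 a b : lab_indep a b -> hstep (l1 ++ a :: b :: l2) (l1 ++ b :: a :: l2).

Inductive homotopic : seq ilabel -> seq ilabel -> Prop :=
| Hrefl l : homotopic l l
| Hstep l1 l2 : hstep l1 l2 -> homotopic l1 l2
| Hsym l1 l2 : homotopic l1 l2 -> homotopic l2 l1
| Htrans l1 l2 l3 : homotopic l1 l2 -> homotopic l2 l3 -> homotopic l1 l3.

Section Semantics.
Variable K : comPzSemiRingType.

Fixpoint state (P : term K) : K :=
  match P with
  | Const k => k
  | Act _ _ _ => 1
  | Dia Q => state Q
  | Par Q R => state Q * state R
  | PPar Q R => state Q * state R
  | Nu Q => state Q
  end.

(* Outcome: sum over runs (homotopy classes of maximal executions) of the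
   state of the end term; each class is represented by its first member. *)
Definition outcome (P : term K) : K :=
  let L := maxexecs P in
  \sum_(i < size L)
     (if `[< exists2 j : nat, (j < i)%N &
              homotopic (nth ([::], P) L j).1 (nth ([::], P) L i).1 >]
      then 0 else state (nth ([::], P) L i).2).

Definition obs_equiv (P Q : term K) : Prop :=
  forall R : term K, outcome (Par P R) = outcome (Par Q R).

Definition oplus (P Q : term K) : term K :=
  Nu (Par (Par (Act 0 true (ren (fun i => i.+2) P))
               (Act 0 true (ren (fun i => i.+2) Q)))
          (Act 0 false (Const 1))).

Definition kdot (k : K) (P : term K) : term K := Par (Const k) P.

(* Linear action with subject s, polarity e, body P (object = index 0 of P):
   nu w (s^e(x).(P | w.1) | (w.0 | ~w.1)). *)
Definition lin (s : nat) (e : bool) (P : term K) : term K :=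
  Nu (Par (Act s.+1 e (Par (ren (up S) P) (Act 1 true (Const 1))))
          (Par (Act 0 true (Const 0)) (Act 0 false (Const 1)))).

Definition close (x : nat) (P : term K) : term K :=
  ren (fun i => if i == x then 0%N else i.+1) P.
Definition act0 (s : nat) (e : bool) (P : term K) : term K := Act s e (ren S P).
Definition lin0 (s : nat) (e : bool) (P : term K) : term K := lin s e (ren S P).
Definition nu_n (x : nat) (P : term K) : term K := Nu (close x P).

Fixpoint prodP (l : seq (term K)) : term K :=
  match l with
  | [::] => Const 1
  | [:: P] => P
  | P :: l' => PPar P (prodP l')
  end.

End Semantics.

Record trace := Trace {
  tn : nat;                                  (* events are 'I_tn *)
  tpol : 'I_tn -> bool;
  tsrc : 'I_tn -> (nat + 'I_tn)%type;
  tle : rel 'I_tn;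
  tle_refl : reflexive tle;
  tle_anti : antisymmetric tle;
  tle_trans : transitive tle;
  tsrc_lt : forall a b, tsrc b = inr a -> (a != b) && tle a b;
  tN : seq (bool * (nat + 'I_tn)%type);
  tN_uniq : uniq tN
}.

Section Impl.
Variable K : comPzSemiRingType.
Variable T : trace.
Local Notation n := (tn T).
Local Notation ev := ('I_(tn T)).

Definition tlt (a b : ev) : bool := (a != b) && tle a b.

Definition tnames : seq nat :=
  [seq (if tsrc a is inl u then u else 0%N) | a <- enum ev] ++
  [seq (if x.2 is inl u then u else 0%N) | x <- tN T].
Definition fbase : nat := (foldr maxn 0%N tnames).+1.

(* fresh, pairwise distinct names x_ab, y_ab, z_a *)
Definition xn (a b : ev) : nat := (fbase + 3 * (a * n + b))%N.
Definition yn (a b : ev) : nat := (fbase + 3 * (a * n + b) + 1)%N.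
Definition zn (a : ev) : nat := (fbase + 3 * a + 2)%N.

Definition subj (a : ev) : nat :=
  match tsrc a with inl u => u | inr b => zn b end.

Fixpoint implA (fuel : nat) (a : ev) : term K :=
  match fuel with
  | 0%N => Const 1
  | f.+1 =>
    let cont :=
      prodP [:: prodP [seq lin0 (yn a c) false (Const 1) | c <- enum ev & tlt a c];
                prodP [seq implA f c | c <- enum ev & tsrc c == inr a];
                prodP [seq act0 (zn a) x.1 (Const 0) | x <- tN T & x.2 == inr a]] in
    foldr (fun b acc => lin0 (xn b a) true acc)
          (lin (subj a) (tpol a) (close (zn a) cont))
          [seq b <- enum ev | tlt b a]
  end.

Definition isname (x : (nat + ev)%type) : bool := if x is inl _ then true else false.

Definition evpairs : seq (ev * ev) := [seq (a, b) | a <- enum ev, b <- enum ev].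

Definition restricted : seq nat :=
  flatten [seq [:: xn p.1 p.2; yn p.1 p.2] | p <- evpairs].

Definition impl : term K :=
  PPar (foldr (@nu_n K) 
          (Par (prodP [seq implA n.+1 a | a <- enum ev & isname (tsrc a)])
               (prodP [seq lin0 (yn p.1 p.2) true (lin0 (xn p.1 p.2) false (Const 1))
                     | p <- evpairs & tlt p.1 p.2]))
          restricted)
       (prodP [seq act0 (if x.2 is inl u then u else 0%N) x.1 (Const 0)
              | x <- tN T & isname x.2]).

End Impl.

(* Main.v *)
(** A sequence of transitions of P, visible or internal, is determined by its
    word of position labels, and whether a word is executable, the value of its
    end term and the actions left active can be read off P itself.  Homotopy is
    then permutation, so the outcome of P is a sum over sets of labels.

    A maximal word U of P | R projects to a word S of P (a prerun).  The runs of
    P | R above S depend on S only through the order in which its visible steps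
    may be performed, their names, and the visible actions left active: these
    data form a trace T, and U contributes value(S) times a term that depends on
    T and R only.  Hence every P is equivalent to the linear combination of the
    traces of its preruns.

    Conversely {T} has exactly one prerun of nonzero value, and its trace is T:
    the 0 in a linear action kills each prerun that leaves it unfired, so every
    action fires, and hiding forces each x_ab and y_ab to synchronise with the
    relay y_ab.~x_ab, which imposes a < b.  Finally the outcome is additive for
    (+) and homogeneous for k., because the preruns of an operand embed in those
    of the compound term. *)

(* Reduction renames bound names and rewrites the term, so runs are hard to compare along the
   transitions themselves. Positions do not move, because a fired prefix leaves [Dia] behind. Words
   of positions can therefore be judged on the unreduced term, and a word of [P | R] is its two
   projections, an interleaving of them and a side condition on names.

   The hard direction is the converse of projecting: a prerun of [P], a prerun of [R] and a matching
   of their visible steps have to be merged into one run, which needs an order of the events that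
   both sides accept. On the side of [P] the acceptable orders are exactly the linear extensions of
   the precedence forced by the prerun, because steps that do not guard each other commute. This is
   why a partial order on the visible events retains all that a context can detect.

   No deadlock of [{T}] needs to be analysed: a decomposition has to account only for the preruns of
   nonzero value. The relays exist because nesting each event under its source orders events only
   along a forest, whereas the order of a trace is arbitrary. *)
From HB Require Import structures.
From mathcomp Require Import all_boot all_algebra.
From mathcomp Require Import boolp zify.
(* Last, so that [int] is the internal transitions and not the integers. *)
Require Import Defs.

Set Implicit Arguments. Unset Strict Implicit. Unset Printing Implicit Defensive.
Import GRing.Theory.

(** * Words of position labels *)

(* [inl n] is a free name; [inr k] is the object bound by the action at position k. *)
Definition nam := (nat + pos)%type.
(* Labels are reduced to positions: the subject and polarity of a visible step
   are recovered from the term by [info]. *)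
Definition lab := (pos + pos * pos)%type.
Notation V i := (inl i : lab).
Notation I i j := (inr (i, j) : lab).
Notation X i j := (inr (1 :: i, 2 :: j) : lab).

Definition lab_e1 (l : lab) : lab :=
  match l with inl i => V (1 :: i) | inr (i, j) => I (1 :: i) (1 :: j) end.
Definition lab_e2 (l : lab) : lab :=
  match l with inl i => V (2 :: i) | inr (i, j) => I (2 :: i) (2 :: j) end.

(* Seen from one side of P | Q, a cross label is a visible step. *)
Definition s1 (l : lab) : option lab :=
  match l with
  | inl (1 :: i) => Some (V i)
  | inr (1 :: i, 1 :: j) => Some (I i j)
  | inr (1 :: i, 2 :: j) => Some (V i)
  | _ => None
  end.
Definition s2 (l : lab) : option lab :=
  match l with
  | inl (2 :: i) => Some (V i)
  | inr (2 :: i, 2 :: j) => Some (I i j)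
  | inr (1 :: i, 2 :: j) => Some (V j)
  | _ => None
  end.

Definition in1 (l : lab) : bool :=
  match l with inl (1 :: _) => true | inr (1 :: _, 1 :: _) => true | _ => false end.
Definition in2 (l : lab) : bool :=
  match l with inl (2 :: _) => true | inr (2 :: _, 2 :: _) => true | _ => false end.
Definition isX (l : lab) : bool :=
  match l with inr (1 :: _, 2 :: _) => true | _ => false end.
Definition in12 (l : lab) : bool := in1 l || in2 l.
(** A cross label always lists the left position first, so [I (2 :: i) (1 :: j)] is not a label of a
    parallel composition. *)
Definition inP (l : lab) : bool := [|| in1 l, in2 l | isX l].

Variant inP_spec : lab -> Prop :=
| InP1 l : inP_spec (lab_e1 l)
| InP2 l : inP_spec (lab_e2 l)
| InPX i j : inP_spec (X i j).

Lemma in1P l : in1 l -> exists l', l = lab_e1 l'.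
Proof.
case: l => [[|[|[|[|?]]] i]|[[|[|[|[|?]]] i] [|[|[|[|?]]] j]]] //= _.
- by exists (V i).
- by exists (I i j).
Qed.

Lemma in2P l : in2 l -> exists l', l = lab_e2 l'.
Proof.
case: l => [[|[|[|[|?]]] i]|[[|[|[|[|?]]] i] [|[|[|[|?]]] j]]] //= _.
- by exists (V i).
- by exists (I i j).
Qed.

Lemma inPP l : inP l -> inP_spec l.
Proof.
case/or3P => [/in1P[l' ->]|/in2P[l' ->]|]; [exact: InP1|exact: InP2|].
by case: l => [[|[|[|[|?]]] i]|[[|[|[|[|?]]] i] [|[|[|[|?]]] j]]] //= _; constructor.
Qed.

Lemma inPV i : inP (V i) -> (exists i', i = 1 :: i') \/ (exists i', i = 2 :: i').
Proof. by case: i => [|[|[|[|?]]] i] //= _; [left|right]; exists i. Qed.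

Lemma s1_e1 l : s1 (lab_e1 l) = Some l. Proof. by case: l => // -[]. Qed.
Lemma s1_e2 l : s1 (lab_e2 l) = None. Proof. by case: l => // -[]. Qed.
Lemma s2_e1 l : s2 (lab_e1 l) = None. Proof. by case: l => // -[]. Qed.
Lemma s2_e2 l : s2 (lab_e2 l) = Some l. Proof. by case: l => // -[]. Qed.
Lemma in1_e1 l : in1 (lab_e1 l). Proof. by case: l => // -[]. Qed.
Lemma in1_e2 l : in1 (lab_e2 l) = false. Proof. by case: l => // -[]. Qed.
Lemma in2_e2 l : in2 (lab_e2 l). Proof. by case: l => // -[]. Qed.
Lemma in2_e1 l : in2 (lab_e1 l) = false. Proof. by case: l => // -[]. Qed.
Lemma isX_e1 l : isX (lab_e1 l) = false. Proof. by case: l => // -[]. Qed.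
Lemma isX_e2 l : isX (lab_e2 l) = false. Proof. by case: l => // -[]. Qed.
Definition labE := (s1_e1, s1_e2, s2_e1, s2_e2, in1_e1, in1_e2, in2_e1, in2_e2, isX_e1, isX_e2).

Lemma lab_e1_inj : injective lab_e1.
Proof. by move=> a b /(congr1 s1); rewrite !labE => -[]. Qed.
Lemma lab_e2_inj : injective lab_e2.
Proof. by move=> a b /(congr1 s2); rewrite !labE => -[]. Qed.

Lemma in12P l : in12 l -> inP l.
Proof. by rewrite /inP /in12 orbA => ->. Qed.

Definition ps (l : lab) : seq pos := match l with inl i => [:: i] | inr (i, j) => [:: i; j] end.

Lemma ps1 l i : inP l -> 1 :: i \in ps l -> exists2 l', s1 l = Some l' & i \in ps l'.
Proof.
case/inPP => [[j|[j k]]|[j|[j k]]|j k] /=; rewrite !inE ?eqseq_cons //= ?orbF => h.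
- by exists (V j) => //; rewrite inE.
- by exists (I j k) => //; rewrite !inE.
- by exists (V j) => //; rewrite inE.
Qed.

Lemma ps2 l i : inP l -> 2 :: i \in ps l -> exists2 l', s2 l = Some l' & i \in ps l'.
Proof.
case/inPP => [[j|[j k]]|[j|[j k]]|j k] /=; rewrite !inE ?eqseq_cons //= ?orbF => h.
- by exists (V j) => //; rewrite inE.
- by exists (I j k) => //; rewrite !inE.
- by exists (V k) => //; rewrite inE.
Qed.

Lemma ps12 l p : inP l -> p \in ps l ->
  (exists2 i, p = 1 :: i & exists2 l', s1 l = Some l' & i \in ps l') \/
  (exists2 i, p = 2 :: i & exists2 l', s2 l = Some l' & i \in ps l').
Proof.
move=> lP pl; suff : (exists i, p = 1 :: i) \/ (exists i, p = 2 :: i).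
  by case=> -[i E]; move: pl; rewrite E => pl; [left|right]; exists i => //; [apply: ps1|apply: ps2].
case/inPP: lP pl => [[j|[j k]]|[j|[j k]]|j k]; rewrite !inE ?inE;
  [move=> /eqP->|case/orP => /eqP->|move=> /eqP->|case/orP => /eqP->|case/orP => /eqP->];
  by [left; eexists|right; eexists].
Qed.

Lemma in1_inP w : all in1 w -> all inP w.
Proof. by apply: sub_all => l; rewrite /inP => ->. Qed.
Lemma in12_inP w : all in12 w -> all inP w.
Proof. exact/sub_all/in12P. Qed.

Definition p1 (w : seq lab) := pmap s1 w.
Definition p2 (w : seq lab) := pmap s2 w.

Arguments p1 : simpl never.
Arguments p2 : simpl never.

Lemma p1_cons l w : p1 (l :: w) = if s1 l is Some l' then l' :: p1 w else p1 w.
Proof. by rewrite /p1 /=; case: (s1 l). Qed.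
Lemma p2_cons l w : p2 (l :: w) = if s2 l is Some l' then l' :: p2 w else p2 w.
Proof. by rewrite /p2 /=; case: (s2 l). Qed.

Lemma mem_p1V w i :
  all inP w -> (V i \in p1 w) =
    (V (1 :: i) \in w) || has (fun l => if l is inr (i', 2 :: _) then i' == 1 :: i else false) w.
Proof.
rewrite mem_pmap; elim: w => //= l w IH /andP[/inPP lP /IH{}IH].
rewrite in_cons (in_cons l) IH.
case: lP => [[i'|[i' j']]|[i'|[i' j']]|i' j] /=.
- by rewrite -orbA.
- by [].
- by [].
- by [].
- by rewrite orbCA /eq_op /= eq_sym.
Qed.

Lemma mem_p2V w i :
  all inP w -> (V i \in p2 w) =
    (V (2 :: i) \in w) || has (fun l => if l is inr (1 :: _, i') then i' == 2 :: i else false) w.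
Proof.
rewrite mem_pmap; elim: w => //= l w IH /andP[/inPP lP /IH{}IH].
rewrite in_cons (in_cons l) IH.
case: lP => [[i'|[i' j']]|[i'|[i' j']]|i' j] /=.
- by [].
- by [].
- by rewrite -orbA.
- by [].
- by rewrite orbCA /eq_op /= eq_sym.
Qed.

Lemma mem_p1 w l : lab_e1 l \in w -> l \in p1 w.
Proof. by move=> lw; rewrite mem_pmap -s1_e1 map_f. Qed.
Lemma mem_p2 w l : lab_e2 l \in w -> l \in p2 w.
Proof. by move=> lw; rewrite mem_pmap -s2_e2 map_f. Qed.
Lemma mem_p1X w i j : X i j \in w -> V i \in p1 w.
Proof. by move=> lw; rewrite mem_pmap; apply/mapP; exists (X i j). Qed.
Lemma mem_p2X w i j : X i j \in w -> V j \in p2 w.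
Proof. by move=> lw; rewrite mem_pmap; apply/mapP; exists (X i j). Qed.

Lemma in1_memV w i : all in1 w -> V i \in p1 w -> V (1 :: i) \in w.
Proof.
move=> win1; rewrite mem_p1V => [/orP[//|/hasP[l /(allP win1)/in1P[[?|[? ?]] -> //]]]|].
by apply: sub_all win1 => l; rewrite /inP => ->.
Qed.

Lemma ps1_p1 w l i : all inP w -> l \in w -> 1 :: i \in ps l -> exists2 l', l' \in p1 w & i \in ps l'.
Proof. by move=> /allP wP lw /(ps1 (wP _ lw))[l' E il]; exists l'; rewrite // mem_pmap -E map_f. Qed.
Lemma ps2_p2 w l i : all inP w -> l \in w -> 2 :: i \in ps l -> exists2 l', l' \in p2 w & i \in ps l'.
Proof. by move=> /allP wP lw /(ps2 (wP _ lw))[l' E il]; exists l'; rewrite // mem_pmap -E map_f. Qed.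

Lemma mem_p1I w i j : all inP w -> (I i j \in p1 w) = (I (1 :: i) (1 :: j) \in w).
Proof.
move=> /allP wP; rewrite mem_pmap; apply/mapP/idP => [[l lw]|h]; last by exists (I (1 :: i) (1 :: j)).
by case/inPP: (wP _ lw) (lw) => [[i'|[i' j']]|[i'|[i' j']]|i' j'] //= lw' [-> ->].
Qed.
Lemma mem_p2I w i j : all inP w -> (I i j \in p2 w) = (I (2 :: i) (2 :: j) \in w).
Proof.
move=> /allP wP; rewrite mem_pmap; apply/mapP/idP => [[l lw]|h]; last by exists (I (2 :: i) (2 :: j)).
by case/inPP: (wP _ lw) (lw) => [[i'|[i' j']]|[i'|[i' j']]|i' j'] //= lw' [-> ->].
Qed.

Lemma p1_e1 w : p1 (map lab_e1 w) = w. Proof. by elim: w => //= l w IH; rewrite p1_cons s1_e1 IH. Qed.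
Lemma p1_e2 w : p1 (map lab_e2 w) = [::]. Proof. by elim: w => //= l w IH; rewrite p1_cons s1_e2. Qed.
Lemma p2_e1 w : p2 (map lab_e1 w) = [::]. Proof. by elim: w => //= l w IH; rewrite p2_cons s2_e1. Qed.
Lemma p2_e2 w : p2 (map lab_e2 w) = w. Proof. by elim: w => //= l w IH; rewrite p2_cons s2_e2 IH. Qed.
Lemma in1_map w : all in1 (map lab_e1 w). Proof. by rewrite all_map; apply/allP => l _ /=; rewrite in1_e1. Qed.
Lemma in2_map w : all in2 (map lab_e2 w). Proof. by rewrite all_map; apply/allP => l _ /=; rewrite in2_e2. Qed.
Lemma in12_map1 w : all in12 (map lab_e1 w).
Proof. by apply: sub_all (in1_map w) => l; rewrite /in12 => ->. Qed.
Lemma in12_map2 w : all in12 (map lab_e2 w).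
Proof. by apply: sub_all (in2_map w) => l; rewrite /in12 orbC => ->. Qed.

Lemma mapV_e1 w i : (V (1 :: i) \in map lab_e1 w) = (V i \in w).
Proof. exact: (mem_map lab_e1_inj w (V i)). Qed.
Lemma in1_map_p1 w : all in1 w -> w = map lab_e1 (p1 w).
Proof. by elim: w => //= l w IH /andP[/in1P[l' ->] /IH E]; rewrite p1_cons s1_e1 /= -E. Qed.

Lemma p2_nil w : all inP w -> p2 w = [::] -> w = map lab_e1 (p1 w).
Proof.
elim: w => //= l w IH /andP[lP wP]; rewrite p1_cons p2_cons.
by case/inPP: lP => [l'|l'|i j]; rewrite ?labE //= => /(IH wP) <-.
Qed.
Lemma p1_nil w : all inP w -> p1 w = [::] -> w = map lab_e2 (p2 w).
Proof.
elim: w => //= l w IH /andP[lP wP]; rewrite p1_cons p2_cons.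
by case/inPP: lP => [l'|l'|i j]; rewrite ?labE //= => /(IH wP) <-.
Qed.
Definition pE := (p1_e1, p1_e2, p2_e1, p2_e2).

(** * Names of subjects and their fate under constructors and steps *)

Definition mapn (f : nam -> option nam) (o : option (nam * bool)) : option (nam * bool) :=
  if o is Some (n, e) then if f n is Some n' then Some (n', e) else None else None.

(** What becomes of a name when one leaves a constructor ([nAct], [nLift], [nNu]), renames ([nRen])
    or performs a step: the visible step at [i] frees its object as index 0 ([nVis]), and an
    internal step restricts the common object of [i] and [j] ([nInt]). The value [None] means
    restricted. *)
Definition nAct (n : nam) : option nam :=
  match n with inl 0 => Some (inr [::]) | inl n.+1 => Some (inl n) | inr k => Some (inr (1 :: k)) end.
Definition nLift (c : nat) (n : nam) : option nam :=
  Some (match n with inl n => inl n | inr k => inr (c :: k) end).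
Definition nNu (n : nam) : option nam :=
  match n with inl 0 => None | inl n.+1 => Some (inl n) | inr k => Some (inr k) end.
Definition nRen (f : nat -> nat) (n : nam) : option nam :=
  Some (match n with inl n => inl (f n) | inr k => inr k end).
Definition nVis (i : pos) (n : nam) : option nam :=
  Some (match n with inl n => inl n.+1 | inr k => if k == i then inl 0 else inr k end).
Definition nInt (i j : pos) (n : nam) : option nam :=
  match n with inl n => Some (inl n) | inr k => if (k == i) || (k == j) then None else Some (inr k) end.

Lemma mapn_comp f g o : mapn f (mapn g o) = mapn (fun n => obind f (g n)) o.
Proof. by case: o => [[n e]|] //=; case: (g n). Qed.

Lemma eq_mapn f g o : f =1 g -> mapn f o = mapn g o.
Proof. by move=> fg; case: o => [[n e]|] //=; rewrite fg. Qed.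

Definition nmatch (w : seq lab) (o o' : option (nam * bool)) : bool :=
  match o, o' with
  | Some (n, e), Some (n', e') =>
    (e' == ~~ e) &&
    match n, n' with
    | inl a, inl b => a == b
    | inr k, inr l => X k l \in w
    | _, _ => false
    end
  | _, _ => false
  end.

Definition visok (f : pos -> bool) (o : option (nam * bool)) : bool :=
  match o with Some (inl _, _) => true | Some (inr k, _) => f k | None => false end.

Lemma eq_visok f g o : f =1 g -> visok f o = visok g o.
Proof. by move=> fg; case: o => [[[n|k] e]|] //=. Qed.

Definition notfree0 (o : option (nam * bool)) : bool :=
  if o is Some (inl 0, _) then false else true.

(** * Executability, residual actions and value, computed on the unreduced term *)

Section Static.
Variable K : comPzSemiRingType.
Implicit Types (P Q R : term K) (w : seq lab).

(* [None] when i is not the position of an action or its subject is restricted. *)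
Fixpoint info P (i : pos) : option (nam * bool) :=
  match P, i with
  | Act s e _, [::] => Some (inl s, e)
  | Act _ _ Q, 1 :: i => mapn nAct (info Q i)
  | Dia Q, 1 :: i => mapn (nLift 1) (info Q i)
  | Par Q _, 1 :: i | PPar Q _, 1 :: i => mapn (nLift 1) (info Q i)
  | Par _ R, 2 :: i | PPar _ R, 2 :: i => mapn (nLift 2) (info R i)
  | Nu Q, _ => mapn nNu (info Q i)
  | _, _ => None
  end.

(** Binders are looked up in the whole word [w], not in the part before [l]. An action lies below
    its binder, so the executability of the projections already puts the binder first, and the check
    itself does not depend on the order. *)
Definition ncheck Q R w (l : lab) : bool :=
  match l with
  | inl (1 :: i) => visok (fun k => V (1 :: k) \in w) (info Q i)
  | inl (2 :: i) => visok (fun k => V (2 :: k) \in w) (info R i)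
  | inr (1 :: i, 2 :: j) => nmatch w (info Q i) (info R j)
  | _ => true
  end.

(* Executability of w from P, decided on P without reducing it.  The side
   condition [ncheck] of Par says that matched actions have dual subjects (two
   bound subjects agree when their binders were matched in w), and that a
   visible action has a subject known outside. *)
Fixpoint ex P w : bool :=
  match P with
  | Const _ => w == [::]
  | Act _ _ Q =>
    if w is l :: w' then [&& l == V [::], all in1 w' & ex Q (p1 w')] else true
  | Dia Q => all in1 w && ex Q (p1 w)
  | PPar Q R => [&& all in12 w, ex Q (p1 w) & ex R (p2 w)]
  | Par Q R => [&& all inP w, ex Q (p1 w), ex R (p2 w) & all (ncheck Q R w) w]
  | Nu Q => ex Q w && all (fun l => if l is inl i then notfree0 (info Q i) else true) w
  end.

Fixpoint actv P w : seq pos :=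
  match P with
  | Const _ => [::]
  | Act _ _ Q => if V [::] \in w then map (cons 1) (actv Q (p1 w)) else [:: [::]]
  | Dia Q => map (cons 1) (actv Q (p1 w))
  | Par Q R | PPar Q R => map (cons 1) (actv Q (p1 w)) ++ map (cons 2) (actv R (p2 w))
  | Nu Q => actv Q w
  end.

Fixpoint value P w : K :=
  match P with
  | Const k => k
  | Act _ _ Q => if V [::] \in w then value Q (p1 w) else 1%R
  | Dia Q => value Q (p1 w)
  | Par Q R | PPar Q R => (value Q (p1 w) * value R (p2 w))%R
  | Nu Q => value Q w
  end.

Definition nocomm Q R w (aQ aR : seq pos) : bool :=
  all (fun i => all (fun j => ~~ nmatch w (info Q i) (info R j)) aR) aQ.

Fixpoint imax P w : bool :=
  match P with
  | Const _ => true
  | Act _ _ Q => if V [::] \in w then imax Q (p1 w) else true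
  | Dia Q => imax Q (p1 w)
  | PPar Q R => imax Q (p1 w) && imax R (p2 w)
  | Par Q R => [&& imax Q (p1 w), imax R (p2 w) &
                 nocomm Q R w (actv Q (p1 w)) (actv R (p2 w))]
  | Nu Q => imax Q w
  end.

Lemma up_inj f : injective f -> injective (up f).
Proof. by move=> f_inj [|i] [|j] //= [] /f_inj ->. Qed.

Lemma info_ren f P i : info (ren f P) i = mapn (nRen f) (info P i).
Proof.
elim: P f i => [k|s e Q IH|Q IH|Q IHQ R IHR|Q IHQ R IHR|Q IH] f i //=.
- case: i => [|[|[|c]] i] //=; rewrite IH !mapn_comp; apply: eq_mapn => -[[|n]|l] //.
- case: i => [|[|[|c]] i] //=; rewrite IH !mapn_comp; apply: eq_mapn => -[[|n]|l] //.
- by case: i => [|[|[|[|c]]] i] //=; rewrite ?IHQ ?IHR !mapn_comp; apply: eq_mapn => -[[|n]|l].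
- by case: i => [|[|[|[|c]]] i] //=; rewrite ?IHQ ?IHR !mapn_comp; apply: eq_mapn => -[[|n]|l].
- by rewrite IH !mapn_comp; apply: eq_mapn => -[[|n]|l].
Qed.

Lemma visok_ren f g o : visok g (mapn (nRen f) o) = visok g o.
Proof. by case: o => [[[n|k] e]|]. Qed.

Lemma nmatch_ren f w o o' : injective f ->
  nmatch w (mapn (nRen f) o) (mapn (nRen f) o') = nmatch w o o'.
Proof.
move=> f_inj; case: o => [[[n|k] e]|]; case: o' => [[[n'|k'] e']|] //=.
by rewrite (inj_eq f_inj).
Qed.

Lemma notfree0_ren f o : notfree0 (mapn (nRen (up f)) o) = notfree0 o.
Proof. by case: o => [[[[|n]|k] e]|]. Qed.

Lemma ncheck_ren f P Q w l : injective f ->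
  ncheck (ren f P) (ren f Q) w l = ncheck P Q w l.
Proof.
move=> f_inj; case: l => [[|[|[|[|c]]] i]|[[|[|[|c]] i] [|[|[|[|d]]] j]]] //=;
by rewrite !info_ren ?visok_ren ?nmatch_ren.
Qed.

Lemma ex_ren f P w : injective f -> ex (ren f P) w = ex P w.
Proof.
elim: P f w => [k|s e Q IH|Q IH|Q IHQ R IHR|Q IHQ R IHR|Q IH] f w f_inj //=.
- by case: w => // l w; rewrite IH //; exact: up_inj.
- by rewrite IH.
- by rewrite IHQ // IHR //; do ! congr (_ && _); apply: eq_all => l; rewrite ncheck_ren.
- by rewrite IHQ // IHR.
- rewrite IH; last exact: up_inj.
  by congr (_ && _); apply: eq_all => -[i|//]; rewrite info_ren notfree0_ren.
Qed.

Lemma actv_ren f P w : actv (ren f P) w = actv P w.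
Proof.
elim: P f w => [k|s e Q IH|Q IH|Q IHQ R IHR|Q IHQ R IHR|Q IH] f w //=;
  by rewrite ?IH ?IHQ ?IHR.
Qed.

Lemma val_ren f P w : value (ren f P) w = value P w.
Proof.
elim: P f w => [k|s e Q IH|Q IH|Q IHQ R IHR|Q IHQ R IHR|Q IH] f w //=;
  by rewrite ?IH ?IHQ ?IHR.
Qed.

Lemma imax_ren f P w : injective f -> imax (ren f P) w = imax P w.
Proof.
elim: P f w => [k|s e Q IH|Q IH|Q IHQ R IHR|Q IHQ R IHR|Q IH] f w f_inj //=.
- by rewrite IH //; exact: up_inj.
- by rewrite IH.
- rewrite IHQ // IHR // !actv_ren /nocomm; do 2! congr (_ && _).
  by apply: eq_all => i; apply: eq_all => j; rewrite !info_ren nmatch_ren.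
- by rewrite IHQ // IHR.
- by rewrite IH //; exact: up_inj.
Qed.

Lemma nacts_ren f P : nacts (ren f P) = nacts P.
Proof.
elim: P f => [k|s e Q IH|Q IH|Q IHQ R IHR|Q IHQ R IHR|Q IH] f //=;
  by rewrite ?IH ?IHQ ?IHR.
Qed.

(** For [Par] this is the side condition [ncheck]. In [PPar] there are no cross labels, so a visible
    step of an operand is visible outside as well. *)
Lemma ex_visok P w i : ex P w -> V i \in w ->
  visok (fun k => V k \in w) (info P i).
Proof.
elim: P w i => [k|s e Q IH|Q IH|Q IHQ R IHR|Q IHQ R IHR|Q IH] w i /=.
- by move/eqP->.
- case: w => // l w /and3P[/eqP -> win1 exQ]; rewrite in_cons => /orP[/eqP[->]//|iw].
  case/in1P: (allP win1 _ iw) => -[i'|[//]] [ii']; subst i => /=.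
  have := IH _ i' exQ (@mem_p1 _ (V i') iw).
  case: (info Q i') => [[[[|n]|k] e']|] //=.
  by move/(in1_memV win1) => ?; rewrite in_cons; apply/orP; right.
- case/andP => win1 exQ iw.
  case/in1P: (allP win1 _ iw) => -[i'|[//]] [ii']; subst i => /=.
  have := IH _ i' exQ (@mem_p1 _ (V i') iw).
  case: (info Q i') => [[[[|n]|k] e']|] //=.
  exact: in1_memV.
- case/and4P => winP exQ exR /allP nc iw; move: (nc _ iw).
  case: (inPV (allP winP _ iw)) => -[i' ?]; subst i => /=.
    by case: (info Q i') => [[[n|k] e']|].
  by case: (info R i') => [[[n|k] e']|].
- case/and3P => win12 exQ exR iw.
  have winP : all inP w by apply: sub_all win12; exact: in12P.
  have nX l : l \in w -> isX l = false.
    by move/(allP win12); case/orP => [/in1P[? ->]|/in2P[? ->]]; rewrite labE.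
  case: (inPV (allP winP _ iw)) => -[i' ?]; subst i => /=.
    have := IHQ _ i' exQ (@mem_p1 _ (V i') iw); case: (info Q i') => [[[n|k] e']|] //=.
    rewrite mem_p1V //; case/orP => //; case/hasP => -[//|[j [|[|[|[|?]]] ?]]] // lw /eqP E.
    by move: (nX _ lw); rewrite E.
  have := IHR _ i' exR (@mem_p2 _ (V i') iw); case: (info R i') => [[[n|k] e']|] //=.
  rewrite mem_p2V //; case/orP => //; case/hasP => -[//|[[|[|[|[|?]]] ?] j]] // lw /eqP E.
  by move: (nX _ lw); rewrite E.
- case/andP => exQ /allP nf iw; have := IH _ _ exQ iw; have := nf _ iw.
  by case: (info Q i) => [[[[|n]|k] e']|].
Qed.

End Static.

(** * Transitions and words *)

HB.instance Definition _ (K : Type) := gen_eqMixin (term K).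

Section Steps.
Variable K : comPzSemiRingType.
Implicit Types (P Q R : term K) (w : seq lab).

(** This and [intP_ind] give the list-valued functions [vis] and [int] the induction principles of
    transition relations, one clause for each rule. *)
Lemma visP_ind (G : term K -> nat -> bool -> pos -> term K -> Prop) :
  (forall s e Q, G (Act s e Q) s e [::] (Dia Q)) ->
  (forall Q s e i Q', (s, e, i, Q') \in vis Q -> G Q s e i Q' -> G (Dia Q) s e (1 :: i) (Dia Q')) ->
  (forall Q R s e i Q', (s, e, i, Q') \in vis Q -> G Q s e i Q' -> G (Par Q R) s e (1 :: i) (Par Q' (ren S R))) ->
  (forall Q R s e i R', (s, e, i, R') \in vis R -> G R s e i R' -> G (Par Q R) s e (2 :: i) (Par (ren S Q) R')) ->
  (forall Q R s e i Q', (s, e, i, Q') \in vis Q -> G Q s e i Q' -> G (PPar Q R) s e (1 :: i) (PPar Q' (ren S R))) ->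
  (forall Q R s e i R', (s, e, i, R') \in vis R -> G R s e i R' -> G (PPar Q R) s e (2 :: i) (PPar (ren S Q) R')) ->
  (forall Q s e i Q', (s.+1, e, i, Q') \in vis Q -> G Q s.+1 e i Q' -> G (Nu Q) s e i (Nu (ren swap01 Q'))) ->
  forall P s e i P', (s, e, i, P') \in vis P -> G P s e i P'.
Proof.
move=> GA GD GP1 GP2 GQ1 GQ2 GN.
elim=> [k|s e Q IH|Q IH|Q IHQ R IHR|Q IHQ R IHR|Q IH] s' e' i P' //=.
- by rewrite inE => /eqP[-> -> -> ->].
- by case/mapP => -[[[s e] j] Q'] tQ /= [-> -> -> ->]; apply: GD => //; exact: IH.
- rewrite mem_cat => /orP[]/mapP[[[[s e] j] Q'] tQ /= [-> -> -> ->]].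
    by apply: GP1 => //; exact: IHQ.
  by apply: GP2 => //; exact: IHR.
- rewrite mem_cat => /orP[]/mapP[[[[s e] j] Q'] tQ /= [-> -> -> ->]].
    by apply: GQ1 => //; exact: IHQ.
  by apply: GQ2 => //; exact: IHR.
- case/mapP => -[[[[|s] e] j] Q']; rewrite mem_filter //= => tQ [-> -> -> ->].
  by apply: GN => //; exact: IH.
Qed.

Lemma intP_ind (G : term K -> pos -> pos -> term K -> Prop) :
  (forall Q i j Q', (i, j, Q') \in int Q -> G Q i j Q' -> G (Dia Q) (1 :: i) (1 :: j) (Dia Q')) ->
  (forall Q R i j Q', (i, j, Q') \in int Q -> G Q i j Q' -> G (Par Q R) (1 :: i) (1 :: j) (Par Q' R)) ->
  (forall Q R i j R', (i, j, R') \in int R -> G R i j R' -> G (Par Q R) (2 :: i) (2 :: j) (Par Q R')) ->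
  (forall Q R s e i j Q' R', (s, e, i, Q') \in vis Q -> (s, ~~ e, j, R') \in vis R ->
     G (Par Q R) (1 :: i) (2 :: j) (Nu (Par Q' R'))) ->
  (forall Q R i j Q', (i, j, Q') \in int Q -> G Q i j Q' -> G (PPar Q R) (1 :: i) (1 :: j) (PPar Q' R)) ->
  (forall Q R i j R', (i, j, R') \in int R -> G R i j R' -> G (PPar Q R) (2 :: i) (2 :: j) (PPar Q R')) ->
  (forall Q i j Q', (i, j, Q') \in int Q -> G Q i j Q' -> G (Nu Q) i j (Nu Q')) ->
  forall P i j P', (i, j, P') \in int P -> G P i j P'.
Proof.
move=> GD GP1 GP2 GPX GQ1 GQ2 GN.
elim=> [k|s e Q IH|Q IH|Q IHQ R IHR|Q IHQ R IHR|Q IH] i' j' P' //=.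
- by case/mapP => -[[i j] Q'] tQ /= [-> -> ->]; apply: GD => //; exact: IH.
- rewrite !mem_cat => /or3P[/mapP[[[i j] Q'] tQ /= [-> -> ->]]|/mapP[[[i j] Q'] tQ /= [-> -> ->]]|].
  + by apply: GP1 => //; exact: IHQ.
  + by apply: GP2 => //; exact: IHR.
  + case/flatten_mapP => -[[[s e] i] Q'] tQ /mapP[[[[s' e'] j] R']].
    rewrite mem_filter /= => /andP[/andP[/eqP <- /eqP ->]] tR [-> -> ->].
    exact: GPX tQ tR.
- rewrite !mem_cat => /orP[/mapP[[[i j] Q'] tQ /= [-> -> ->]]|/mapP[[[i j] Q'] tQ /= [-> -> ->]]].
  + by apply: GQ1 => //; exact: IHQ.
  + by apply: GQ2 => //; exact: IHR.
- by case/mapP => -[[i j] Q'] tQ /= [-> -> ->]; apply: GN => //; exact: IH.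
Qed.

Lemma vis_info P s e i P' : (s, e, i, P') \in vis P -> info P i = Some (inl s, e).
Proof.
move: P s e i P'; apply: visP_ind => //= *.
  all: by match goal with H : info _ _ = _ |- _ => rewrite H end.
Qed.

Lemma nVis_lift c i n : obind (nLift c) (nVis i n) = obind (nVis (c :: i)) (nLift c n).
Proof. by case: n => //= k; rewrite /nVis eqseq_cons eqxx /=; case: eqP. Qed.

(** Since [Dia] takes the place of the fired prefix, all other positions keep their meaning. Only
    [i] is lost, and its object becomes the free index 0. *)
Lemma vis_info' P s e i P' : (s, e, i, P') \in vis P ->
  forall j, info P' j = if j == i then None else mapn (nVis i) (info P j).
Proof.
move: P s e i P'; apply: visP_ind => /=.
- by move=> s e Q [|[|[|c]] j] //=; rewrite mapn_comp; apply: eq_mapn => -[[|n]|k].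
- move=> Q s e i Q' _ IH [|[|[|c]] j] //=; rewrite IH eqseq_cons /=.
  case: ifP => // ji; rewrite !mapn_comp; exact/eq_mapn/nVis_lift.
- move=> Q R s e i Q' _ IH [|[|[|[|c]]] j] //=; rewrite ?IH ?info_ren ?eqseq_cons /= ?mapn_comp //.
    by case: ifP => // ji; rewrite !mapn_comp; exact/eq_mapn/nVis_lift.
  by apply: eq_mapn => -[n|k].
- move=> Q R s e i Q' _ IH [|[|[|[|c]]] j] //=; rewrite ?IH ?info_ren ?eqseq_cons /= ?mapn_comp //.
    by apply: eq_mapn => -[n|k].
  by case: ifP => // ji; rewrite !mapn_comp; exact/eq_mapn/nVis_lift.
- move=> Q R s e i Q' _ IH [|[|[|[|c]]] j] //=; rewrite ?IH ?info_ren ?eqseq_cons /= ?mapn_comp //.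
    by case: ifP => // ji; rewrite !mapn_comp; exact/eq_mapn/nVis_lift.
  by apply: eq_mapn => -[n|k].
- move=> Q R s e i Q' _ IH [|[|[|[|c]]] j] //=; rewrite ?IH ?info_ren ?eqseq_cons /= ?mapn_comp //.
    by apply: eq_mapn => -[n|k].
  by case: ifP => // ji; rewrite !mapn_comp; exact/eq_mapn/nVis_lift.
- move=> Q s e i Q' _ IH j; rewrite info_ren IH; case: ifP => // ji.
  by rewrite !mapn_comp; apply: eq_mapn => -[[|n]|k] //=; rewrite /nVis; case: eqP.
Qed.

Lemma vis_actv P s e i P' : (s, e, i, P') \in vis P -> forall w, actv P (V i :: w) = actv P' w.
Proof.
move: P s e i P'; apply: visP_ind => /=.
- by [].
- by move=> Q s e i Q' _ IH w; rewrite ?p1_cons ?p2_cons /= ?IH.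
- by move=> Q R s e i Q' _ IH w; rewrite ?p1_cons ?p2_cons /= ?IH actv_ren.
- by move=> Q R s e i Q' _ IH w; rewrite ?p1_cons ?p2_cons /= ?IH actv_ren.
- by move=> Q R s e i Q' _ IH w; rewrite ?p1_cons ?p2_cons /= ?IH actv_ren.
- by move=> Q R s e i Q' _ IH w; rewrite ?p1_cons ?p2_cons /= ?IH actv_ren.
- by move=> Q s e i Q' _ IH w; rewrite actv_ren.
Qed.

Lemma vis_val P s e i P' : (s, e, i, P') \in vis P -> forall w, value P (V i :: w) = value P' w.
Proof.
move: P s e i P'; apply: visP_ind => /=.
- by [].
- by move=> Q s e i Q' _ IH w; rewrite ?p1_cons ?p2_cons /= ?IH.
- by move=> Q R s e i Q' _ IH w; rewrite ?p1_cons ?p2_cons /= ?IH val_ren.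
- by move=> Q R s e i Q' _ IH w; rewrite ?p1_cons ?p2_cons /= ?IH val_ren.
- by move=> Q R s e i Q' _ IH w; rewrite ?p1_cons ?p2_cons /= ?IH val_ren.
- by move=> Q R s e i Q' _ IH w; rewrite ?p1_cons ?p2_cons /= ?IH val_ren.
- by move=> Q s e i Q' _ IH w; rewrite val_ren.
Qed.

Lemma ex_notin P w i : info P i = None -> ex P w -> V i \notin w.
Proof. by move=> Pi exP; apply/negP => /(ex_visok exP); rewrite Pi. Qed.

Lemma vis_none P s e i P' : (s, e, i, P') \in vis P -> info P' i = None.
Proof. by move=> t; rewrite (vis_info' t) eqxx. Qed.

(** Used on reducts, where a consumed position has no [info] and so cannot be fired again. *)
Lemma unfired1 P i w : info P i = None -> ex P (p1 w) ->
  (forall l, X i l \notin w) /\ (V (1 :: i) \in w) = false.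
Proof.
move=> Pi /(ex_notin Pi) nV; split=> [l|]; last apply/negbTE; apply: contra nV; first exact: mem_p1X.
exact: (@mem_p1 _ (V i)).
Qed.
Lemma unfired2 P i w : info P i = None -> ex P (p2 w) ->
  (forall l, X l i \notin w) /\ (V (2 :: i) \in w) = false.
Proof.
move=> Pi /(ex_notin Pi) nV; split=> [l|]; last apply/negbTE; apply: contra nV; first exact: mem_p2X.
exact: (@mem_p2 _ (V i)).
Qed.

(** After a visible step of one operand the names of the other are shifted by [S], so the newly
    freed index 0 meets no equal name there. *)
Lemma nmatch_shift1 i w o o' : (forall l, X i l \notin w) ->
  nmatch w (mapn (nVis i) o) (mapn (nRen S) o') = nmatch w o o'.
Proof.
move=> niw; case: o => [[[n|k] e]|]; case: o' => [[[n'|k'] e']|] //=; case: eqP => //= [] _;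
 case: eqP => //= [->]; apply/esym/negbTE; exact: niw.
Qed.

Lemma nmatch_shift2 i w o o' : (forall l, X l i \notin w) ->
  nmatch w (mapn (nRen S) o) (mapn (nVis i) o') = nmatch w o o'.
Proof.
move=> niw; case: o => [[[n|k] e]|]; case: o' => [[[n'|k'] e']|] //=; case: eqP => //= [] _;
 case: eqP => //= [->]; apply/esym/negbTE; exact: niw.
Qed.

(** Together with [int_ex] this says that [ex] follows the transition rules. The content is that the
    name checks on all later labels give the same answers before and after the step. *)
Lemma vis_ex P s e i P' : (s, e, i, P') \in vis P -> forall w, ex P (V i :: w) = ex P' w.
Proof.
move: P s e i P'; apply: visP_ind => //=.
- by move=> Q s e i Q' tQ IH w; rewrite p1_cons ?p2_cons /= IH.
- move=> Q R s e i Q' tQ IH w; rewrite p1_cons ?p2_cons /= IH ex_ren; last exact: succn_inj.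
  case: (boolP (all inP w)) => //= winP; case: (boolP (ex Q' _)) => //= exQ'.
  congr (_ && _).
  have [nXi nVi] := unfired1 (vis_none tQ) exQ'.
  rewrite (vis_info tQ) /=; apply: eq_in_all => l lw.
  case: l lw => [[|[|[|[|c]]] j]|[[|[|[|c]] j] [|[|[|[|d]]] k]]] //= lw.
  + rewrite (vis_info' tQ); case: eqP => [E|_]; first by move: nVi; rewrite -E lw.
    case: (info Q j) => [[[n|k] e']|] //=; case: eqP => [->|ki] //=; first by rewrite in_cons eqxx.
    by rewrite in_cons; case: eqP => // -[].
  + rewrite info_ren; case: (info R j) => [[[n|k] e']|] //=.
  + rewrite info_ren (vis_info' tQ); case: eqP => [E|_]; first by move: (nXi k); rewrite -E lw.
    rewrite nmatch_shift1 //; case: (info Q j) => [[[n|l] e']|] //; case: (info R k) => [[[n'|l'] e'']|] //=.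
- move=> Q R s e i R' tR IH w; rewrite p1_cons p2_cons /= IH ex_ren; last exact: succn_inj.
  case: (boolP (all inP w)) => //= winP; case: (boolP (ex Q _)) => //= exQ.
  case: (boolP (ex R' _)) => //= exR'.
  have [nXi nVi] := unfired2 (vis_none tR) exR'.
  rewrite (vis_info tR) /=; apply: eq_in_all => l lw.
  case: l lw => [[|[|[|[|c]]] j]|[[|[|[|c]] j] [|[|[|[|d]]] k]]] //= lw.
  + rewrite info_ren; case: (info Q j) => [[[n|k] e']|] //=.
  + rewrite (vis_info' tR); case: eqP => [E|_]; first by move: nVi; rewrite -E lw.
    case: (info R j) => [[[n|k] e']|] //=; case: eqP => [->|ki] //=; first by rewrite in_cons eqxx.
    by rewrite in_cons; case: eqP => // -[].
  + rewrite info_ren (vis_info' tR); case: eqP => [E|_]; first by move: (nXi j); rewrite -E lw.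
    rewrite nmatch_shift2 //; case: (info Q j) => [[[n|l] e']|] //; case: (info R k) => [[[n'|l'] e'']|] //=.
- by move=> Q R s e i Q' tQ IH w; rewrite p1_cons ?p2_cons /= IH ex_ren //; exact: succn_inj.
- by move=> Q R s e i Q' tQ IH w; rewrite p1_cons p2_cons /= IH ex_ren //; exact: succn_inj.
- move=> Q s e i Q' tQ IH w; rewrite IH (vis_info tQ) /= ex_ren; last first.
    by move=> [|[|a]] [|[|b]].
  case: (boolP (ex Q' w)) => //= exQ'; apply: eq_in_all => -[j|//] jw.
  have Qi' := vis_none tQ.
  have nVi := ex_notin Qi' exQ'.
  rewrite info_ren (vis_info' tQ); case: eqP => [E|_]; first by move: nVi; rewrite -E jw.
  by case: (info Q j) => [[[[|n]|k] e']|] //=; case: eqP.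
Qed.

Lemma actv_unfired P w i l : ex P w -> i \in actv P w -> l \in w -> i \notin ps l.
Proof.
have h1 Q w' j : (forall u i l, ex Q u -> i \in actv Q u -> l \in u -> i \notin ps l) ->
    all inP w' -> ex Q (p1 w') -> j \in actv Q (p1 w') -> forall l, l \in w' -> 1 :: j \notin ps l.
  by move=> IH wP exQ ja l' lw; apply/negP => /(ps1_p1 wP lw)[k kw]; apply/negP; exact: IH ja kw.
have h2 Q w' j : (forall u i l, ex Q u -> i \in actv Q u -> l \in u -> i \notin ps l) ->
    all inP w' -> ex Q (p2 w') -> j \in actv Q (p2 w') -> forall l, l \in w' -> 2 :: j \notin ps l.
  by move=> IH wP exQ ja l' lw; apply/negP => /(ps2_p2 wP lw)[k kw]; apply/negP; exact: IH ja kw.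
elim: P w i l => [k|s e Q IH|Q IH|Q IHQ R IHR|Q IHQ R IHR|Q IH] w i l //=.
- case: w => [|l0 w] //= /and3P[/eqP -> /in1_inP win exQ]; rewrite [in V _ \in _]in_cons /= p1_cons /=.
  case/mapP => j ja -> {i}; rewrite in_cons => /orP[/eqP->|lw]; first by rewrite inE.
  exact: h1 ja _ lw.
- by case/andP => /in1_inP win exQ /mapP[j ja ->]; exact: h1 ja l.
- case/and4P => win exQ exR _; rewrite mem_cat => /orP[]/mapP[j ja ->]; [exact: h1 ja l|exact: h2 ja l].
- case/and3P => /in12_inP win exQ exR; rewrite mem_cat => /orP[]/mapP[j ja ->];
    [exact: h1 ja l|exact: h2 ja l].
- by case/andP => exQ _; exact: IH.
Qed.

Lemma all2_eq (T : eqType) (a b : seq T) (f g : T -> T -> bool) :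
  (forall i j, i \in a -> j \in b -> f i j = g i j) ->
  all (fun i => all (f i) b) a = all (fun i => all (g i) b) a.
Proof. by move=> H; apply: eq_in_all => i ia; apply: eq_in_all => j jb; exact: H. Qed.

(** Executability of [w] guarantees that the fired position [i] is no longer active, so that
    [nocomm] never has to compare it. *)
Lemma vis_imax P s e i P' : (s, e, i, P') \in vis P -> forall w, ex P' w -> imax P (V i :: w) = imax P' w.
Proof.
move: P s e i P'; apply: visP_ind => /=.
- by [].
- by move=> Q s e i Q' tQ IH w; rewrite ?p1_cons ?p2_cons /= => /andP[_ /IH ->].
- move=> Q R s e i Q' tQ IH w; rewrite ?p1_cons ?p2_cons /= => /and4P[win exQ' exR nc].
  rewrite IH // imax_ren; last exact: succn_inj.
  congr [&& _, _ & _]; rewrite (vis_actv tQ) actv_ren; apply: all2_eq => k l ka lb.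
  rewrite info_ren (vis_info' tQ).
  have [nXi nVi] := unfired1 (vis_none tQ) exQ'.
  case: eqP => [ki|_]; last first.
    by rewrite nmatch_shift1 //; case: (info Q k) => [[[n|k'] e']|]; case: (info R l) => [[[n'|l'] e'']|].
  have := vis_ex tQ (p1 w); rewrite exQ' => exQ.
  have := actv_unfired exQ (_ : k \in _) (_ : V i \in _).
  by rewrite (vis_actv tQ) ka in_cons eqxx inE ki eqxx => /(_ isT isT).
- move=> Q R s e i R' tR IH w; rewrite ?p1_cons ?p2_cons /= => /and4P[win exQ exR' nc].
  rewrite IH // imax_ren; last exact: succn_inj.
  congr [&& _, _ & _]; rewrite (vis_actv tR) actv_ren; apply: all2_eq => k l ka lb.
  rewrite info_ren (vis_info' tR).
  have [nXi nVi] := unfired2 (vis_none tR) exR'.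
  case: eqP => [li|_]; last first.
    by rewrite nmatch_shift2 //; case: (info Q k) => [[[n|k'] e']|]; case: (info R l) => [[[n'|l'] e'']|].
  have := vis_ex tR (p2 w); rewrite exR' => exR.
  have := actv_unfired exR (_ : l \in _) (_ : V i \in _).
  by rewrite (vis_actv tR) lb in_cons eqxx inE li eqxx => /(_ isT isT).
- move=> Q R s e i Q' tQ IH w; rewrite ?p1_cons ?p2_cons /= => /and3P[_ /IH -> _].
  by rewrite imax_ren //; exact: succn_inj.
- move=> Q R s e i Q' tQ IH w; rewrite ?p1_cons ?p2_cons /= => /and3P[_ _ /IH ->].
  by rewrite imax_ren //; exact: succn_inj.
- have sw : injective swap01 by move=> [|[|a]] [|[|b]].
  by move=> Q s e i Q' tQ IH w /andP[+ _]; rewrite ex_ren // imax_ren // => /IH.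
Qed.

Lemma nInt_lift c i j n : obind (nLift c) (nInt i j n) = obind (nInt (c :: i) (c :: j)) (nLift c n).
Proof. by case: n => //= k; rewrite !eqseq_cons !eqxx /=; case: ifP. Qed.

Lemma nInt_liftC c d i j n : c != d -> nLift c n = obind (nInt (d :: i) (d :: j)) (nLift c n).
Proof. by move=> /negbTE cd; case: n => //= k; rewrite !eqseq_cons cd. Qed.

Lemma mapn_id f o : (forall n, f n = Some n) -> mapn f o = o.
Proof. by move=> fE; case: o => [[n e]|] //=; rewrite fE. Qed.

Lemma int_info P i j P' : (i, j, P') \in int P ->
  forall k, info P' k = if (k == i) || (k == j) then None else mapn (nInt i j) (info P k).
Proof.
move: P i j P'; apply: intP_ind => /=.
- move=> Q i j Q' _ IH [|[|[|c]] k] //=; rewrite IH !eqseq_cons /=.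
  by case: ifP => // ji; rewrite !mapn_comp; exact/eq_mapn/nInt_lift.
- move=> Q R i j Q' _ IH [|[|[|[|c]]] k] //=; rewrite ?IH ?eqseq_cons /= ?mapn_comp //.
    by case: ifP => // ji; rewrite !mapn_comp; exact/eq_mapn/nInt_lift.
  by apply: eq_mapn => n; rewrite -nInt_liftC.
- move=> Q R i j Q' _ IH [|[|[|[|c]]] k] //=; rewrite ?IH ?eqseq_cons /= ?mapn_comp //.
    by apply: eq_mapn => n; rewrite -nInt_liftC.
  by case: ifP => // ji; rewrite !mapn_comp; exact/eq_mapn/nInt_lift.
- move=> Q R s e i j Q' R' tQ tR [|[|[|[|c]]] k] //=;
    rewrite ?(vis_info' tQ) ?(vis_info' tR) ?eqseq_cons /= ?orbF ?mapn_comp //.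
    case: ifP => // ji; rewrite !mapn_comp; apply: eq_mapn => -[n|l] //=.
    by rewrite !eqseq_cons /= orbF; case: eqP.
  case: ifP => // ji; rewrite !mapn_comp; apply: eq_mapn => -[n|l] //=.
  by rewrite !eqseq_cons /=; case: eqP.
- move=> Q R i j Q' _ IH [|[|[|[|c]]] k] //=; rewrite ?IH ?eqseq_cons /= ?mapn_comp //.
    by case: ifP => // ji; rewrite !mapn_comp; exact/eq_mapn/nInt_lift.
  by apply: eq_mapn => n; rewrite -nInt_liftC.
- move=> Q R i j Q' _ IH [|[|[|[|c]]] k] //=; rewrite ?IH ?eqseq_cons /= ?mapn_comp //.
    by apply: eq_mapn => n; rewrite -nInt_liftC.
  by case: ifP => // ji; rewrite !mapn_comp; exact/eq_mapn/nInt_lift.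
- move=> Q i j Q' _ IH k; rewrite IH; case: ifP => // ki.
  by rewrite !mapn_comp; apply: eq_mapn => -[[|n]|l] //=; case: ifP.
Qed.

Lemma int_actv P i j P' : (i, j, P') \in int P -> forall w, actv P (I i j :: w) = actv P' w.
Proof.
move: P i j P'; apply: intP_ind => /= *; rewrite ?p1_cons ?p2_cons /=.
4: by do 2! match goal with H : is_true (_ \in vis _) |- _ => rewrite (vis_actv H); clear H end.
all: by match goal with H : forall w, actv _ _ = _ |- _ => rewrite H end.
Qed.

Lemma int_val P i j P' : (i, j, P') \in int P -> forall w, value P (I i j :: w) = value P' w.
Proof.
move: P i j P'; apply: intP_ind => /= *; rewrite ?p1_cons ?p2_cons /=.
4: by do 2! match goal with H : is_true (_ \in vis _) |- _ => rewrite (vis_val H); clear H end.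
all: by match goal with H : forall w, value _ _ = _ |- _ => rewrite H end.
Qed.

Lemma nmatch_cons l w o o' : ~~ isX l -> nmatch (l :: w) o o' = nmatch w o o'.
Proof.
move=> lX; case: o => [[[n|k] e]|] //; case: o' => [[[n'|k'] e']|] //=.
by rewrite in_cons; case: (_ =P l) => // E; move: lX; rewrite -E.
Qed.

Lemma nmatch_int1 i j w o o' : (forall l, X i l \notin w) -> (forall l, X j l \notin w) ->
  nmatch w (mapn (nInt i j) o) o' = nmatch w o o'.
Proof.
move=> ni nj; case: o => [[[n|k] e]|] //=; case: ifP => //=.
case/orP => /eqP ->; case: o' => [[[n|l] e']|] //; rewrite ?andbF //.
  by rewrite (negbTE (ni _)) andbF.
by rewrite (negbTE (nj _)) andbF.
Qed.

Lemma nmatch_int2 i j w o o' : (forall l, X l i \notin w) -> (forall l, X l j \notin w) ->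
  nmatch w o (mapn (nInt i j) o') = nmatch w o o'.
Proof.
move=> ni nj; case: o' => [[[n|k] e]|] //=; case: ifP => //=.
case/orP => /eqP ->; case: o => [[[n|l] e']|] //=; rewrite ?andbF //.
  by rewrite (negbTE (ni _)) andbF.
by rewrite (negbTE (nj _)) andbF.
Qed.

Lemma visok_int (f : pos -> bool) i j o : f i = false -> f j = false ->
  visok f (mapn (nInt i j) o) = visok f o.
Proof.
move=> fi fj; case: o => [[[n|k] e]|] //=; case: ifP => //= /orP[]/eqP->; by rewrite ?fi ?fj.
Qed.

Lemma int_none P i j P' : (i, j, P') \in int P -> info P' i = None /\ info P' j = None.
Proof. by move=> t; rewrite !(int_info t) !eqxx orbT. Qed.

Lemma int_ex P i j P' : (i, j, P') \in int P -> forall w, ex P (I i j :: w) = ex P' w.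
Proof.
move: P i j P'; apply: intP_ind => /=.
- by move=> Q i j Q' tQ IH w; rewrite p1_cons /= IH.
- move=> Q R i j Q' tQ IH w; rewrite p1_cons p2_cons /= IH.
  case: (boolP (all inP w)) => //= winP; case: (boolP (ex Q' _)) => //= exQ'.
  congr (_ && _).
  have [Qi Qj] := int_none tQ.
  have [nXi nVi'] := unfired1 Qi exQ'; have [nXj nVj'] := unfired1 Qj exQ'.
  apply: eq_in_all => l lw.
  case: l lw => [[|[|[|[|c]]] k]|[[|[|[|c]] k] [|[|[|[|d]]] l]]] //= lw.
  + rewrite (int_info tQ); case: orP => [[]/eqP E|_]; try by subst k; rewrite lw in nVi' nVj'.
    by rewrite visok_int //; apply: eq_visok => k'; rewrite in_cons.
  + rewrite nmatch_cons // (int_info tQ); case: orP => [[]/eqP E|_]; last by rewrite nmatch_int1.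
      by move: (nXi l); rewrite -E lw.
    by move: (nXj l); rewrite -E lw.
- move=> Q R i j R' tR IH w; rewrite p1_cons p2_cons /= IH.
  case: (boolP (all inP w)) => //= winP; case: (boolP (ex Q _)) => //= exQ.
  case: (boolP (ex R' _)) => //= exR'.
  have [Ri Rj] := int_none tR.
  have [nXi nVi'] := unfired2 Ri exR'; have [nXj nVj'] := unfired2 Rj exR'.
  apply: eq_in_all => l lw.
  case: l lw => [[|[|[|[|c]]] k]|[[|[|[|c]] k] [|[|[|[|d]]] l]]] //= lw.
  + rewrite (int_info tR); case: orP => [[]/eqP E|_]; try by subst k; rewrite lw in nVi' nVj'.
    by rewrite visok_int //; apply: eq_visok => k'; rewrite in_cons.
  + rewrite nmatch_cons // (int_info tR); case: orP => [[]/eqP E|_]; last by rewrite nmatch_int2.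
      by move: (nXi k); rewrite -E lw.
    by move: (nXj k); rewrite -E lw.
(* The two objects merge into the index 0 bound by the new [Nu]. Two names that agreed through
   [X i j] before the step are both index 0 after it, and neither can be the subject of a visible
   step. *)
- move=> Q R s e i j Q' R' tQ tR w; rewrite p1_cons p2_cons /= (vis_ex tQ) (vis_ex tR).
  rewrite (vis_info tQ) (vis_info tR) /= !eqxx /= -!andbA.
  case: (boolP (all inP w)) => //= winP; case: (boolP (ex Q' _)) => //= exQ'.
  case: (boolP (ex R' _)) => //= exR'.
  have Qi := vis_none tQ.
  have Rj := vis_none tR.
  have [nXi nVi'] := unfired1 Qi exQ'; have [nXj nVj'] := unfired2 Rj exR'.
  rewrite -all_predI; apply: eq_in_all => l lw.
  case: l lw => [[|[|[|[|c]]] k]|[[|[|[|c]] k] [|[|[|[|d]]] l]]] //= lw.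
  + rewrite (vis_info' tQ); case: eqP => [E|_]; first by subst k; rewrite lw in nVi'.
    case: (info Q k) => [[[n|k'] e']|] //=; rewrite in_cons /=.
    by case: eqP => [->|] //=; rewrite ?andbT ?nVi'.
  + rewrite (vis_info' tR); case: eqP => [E|_]; first by subst k; rewrite lw in nVj'.
    case: (info R k) => [[[n|k'] e']|] //=; rewrite in_cons /=.
    by case: eqP => [->|] //=; rewrite ?andbT ?nVj'.
  + rewrite andbT (vis_info' tQ) (vis_info' tR).
    case: eqP => [E|_]; first by move: (nXi l); rewrite -E lw.
    case: eqP => [E|_]; first by move: (nXj k); rewrite -E lw.
    case: (info Q k) => [[[n|k'] e']|] //=; case: (info R l) => [[[n'|l'] e'']|] //=.
    * by case: (e'' == _) => //=; case: eqP.
    * by case: (e'' == _) => //=; case: eqP.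
    * rewrite in_cons; case: (e'' == _) => //=; rewrite (_ : (_ == X i j) = (k' == i) && (l' == j)) //.
      case: (k' =P i) => [->|ki]; case: (l' =P j) => [->|lj] //=.
      + exact/negbTE/nXi.
      + exact/negbTE/nXj.
- by move=> Q R i j Q' tQ IH w; rewrite p1_cons p2_cons /= IH.
- by move=> Q R i j Q' tQ IH w; rewrite p1_cons p2_cons /= IH.
- move=> Q i j Q' tQ IH w; rewrite IH /=.
  case: (boolP (ex Q' w)) => //= exQ'; apply: eq_in_all => -[k|//] kw.
  rewrite (int_info tQ); have [Qi Qj] := int_none tQ.
  case: orP => [[]/eqP E|_]; subst.
  + by move: (ex_notin Qi exQ'); rewrite kw.
  + by move: (ex_notin Qj exQ'); rewrite kw.
  by case: (info Q k) => [[[[|n]|l] e']|] //=; case: ifP.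
Qed.

End Steps.

(** * Words of internal labels as maximal executions *)

Section Execs.
Variable K : comPzSemiRingType.
Implicit Types (P Q R : term K) (w : seq lab).

Lemma nmatchX i j w o o' : (forall l, X i l \notin w) -> (forall l, X l j \notin w) ->
  nmatch (X i j :: w) o o' = nmatch w (mapn (nVis i) o) (mapn (nVis j) o').
Proof.
move=> nXi nXj; case: o => [[[n|k] e']|] //=; case: o' => [[[n'|l] e'']|] //=.
- by case: (e'' == _) => //=; case: eqP.
- by case: (e'' == _) => //=; case: eqP.
- rewrite in_cons; case: (e'' == _) => //=; rewrite (_ : (_ == X i j) = (k == i) && (l == j)) //.
  case: (k =P i) => [->|ki]; case: (l =P j) => [->|lj] //=.
  + exact/negbTE/nXi.
  + exact/negbTE/nXj.
Qed.

Lemma int_imax P i j P' : (i, j, P') \in int P ->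
  forall w, ex P' w -> imax P (I i j :: w) = imax P' w.
Proof.
move: P i j P'; apply: intP_ind => /=.
- by move=> Q i j Q' tQ IH w; rewrite ?p1_cons /= => /andP[_ /IH ->].
- move=> Q R i j Q' tQ IH w; rewrite ?p1_cons ?p2_cons /= => /and4P[win exQ' exR nc].
  rewrite IH //; congr [&& _, _ & _]; rewrite (int_actv tQ); apply: all2_eq => k l ka lb.
  rewrite nmatch_cons // (int_info tQ).
  have [Qi Qj] := int_none tQ.
  have [nXi _] := unfired1 Qi exQ'; have [nXj _] := unfired1 Qj exQ'.
  case: ifP => [ki|_]; last by rewrite nmatch_int1.
  have := int_ex tQ (p1 w); rewrite exQ' => exQ.
  have := actv_unfired exQ (_ : k \in _) (_ : I i j \in _).
  by rewrite (int_actv tQ) ka in_cons eqxx !inE ki => /(_ isT isT).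
- move=> Q R i j R' tR IH w; rewrite ?p1_cons ?p2_cons /= => /and4P[win exQ exR' nc].
  rewrite IH //; congr [&& _, _ & _]; rewrite (int_actv tR); apply: all2_eq => k l ka lb.
  rewrite nmatch_cons // (int_info tR).
  have [Ri Rj] := int_none tR.
  have [nXi _] := unfired2 Ri exR'; have [nXj _] := unfired2 Rj exR'.
  case: ifP => [li|_]; last by rewrite nmatch_int2.
  have := int_ex tR (p2 w); rewrite exR' => exR.
  have := actv_unfired exR (_ : l \in _) (_ : I i j \in _).
  by rewrite (int_actv tR) lb in_cons eqxx !inE li => /(_ isT isT).
- move=> Q R s e i j Q' R' tQ tR w; rewrite p1_cons p2_cons /= => /andP[/and4P[win exQ' exR' _] _].
  rewrite (vis_imax tQ) // (vis_imax tR) //; congr [&& _, _ & _].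
  rewrite (vis_actv tQ) (vis_actv tR); apply: all2_eq => k l ka lb.
  have Qi := vis_none tQ.
  have Rj := vis_none tR.
  have nVi := ex_notin Qi exQ'; have nVj := ex_notin Rj exR'.
  rewrite nmatchX; last 2 first.
  + by move=> l'; apply: contra nVi; exact: mem_p1X.
  + by move=> l'; apply: contra nVj; exact: mem_p2X.
  rewrite (vis_info' tQ) (vis_info' tR); case: eqP => [ki|_].
    have := vis_ex tQ (p1 w); rewrite exQ' => exQ.
    have := actv_unfired exQ (_ : k \in _) (_ : V i \in _).
    by rewrite (vis_actv tQ) ka in_cons eqxx inE ki eqxx => /(_ isT isT).
  case: eqP => [lj|_] //.
  have := vis_ex tR (p2 w); rewrite exR' => exR.
  have := actv_unfired exR (_ : l \in _) (_ : V j \in _).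
  by rewrite (vis_actv tR) lb in_cons eqxx inE lj eqxx => /(_ isT isT).
- by move=> Q R i j Q' tQ IH w; rewrite p1_cons p2_cons /= => /and3P[_ /IH -> _].
- by move=> Q R i j Q' tQ IH w; rewrite p1_cons p2_cons /= => /and3P[_ _ /IH ->].
- by move=> Q i j Q' tQ IH w /andP[/IH -> _].
Qed.

Lemma actv_vis P i s e : i \in actv P [::] -> info P i = Some (inl s, e) ->
  exists P', (s, e, i, P') \in vis P.
Proof.
elim: P i s e => [k|s' e' Q IH|Q IH|Q IHQ R IHR|Q IHQ R IHR|Q IH] i s e //=.
- by rewrite inE => /eqP-> [-> ->]; exists (Dia Q); rewrite inE.
- case/mapP => j ja -> /=; case E: (info Q j) => [[[n|k] b]|] //= [? ?]; subst.
  by case: (IH _ _ _ ja E) => Q' tQ; exists (Dia Q'); apply/mapP; exists (s, e, j, Q').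
- rewrite mem_cat => /orP[]/mapP[j ja -> /=].
    case E: (info Q j) => [[[n|k] b]|] //= [? ?]; subst.
    case: (IHQ _ _ _ ja E) => Q' tQ; exists (Par Q' (ren S R)).
    by rewrite mem_cat; apply/orP; left; apply/mapP; exists (s, e, j, Q').
  case E: (info R j) => [[[n|k] b]|] //= [? ?]; subst.
  case: (IHR _ _ _ ja E) => R' tR; exists (Par (ren S Q) R').
  by rewrite mem_cat; apply/orP; right; apply/mapP; exists (s, e, j, R').
- rewrite mem_cat => /orP[]/mapP[j ja -> /=].
    case E: (info Q j) => [[[n|k] b]|] //= [? ?]; subst.
    case: (IHQ _ _ _ ja E) => Q' tQ; exists (PPar Q' (ren S R)).
    by rewrite mem_cat; apply/orP; left; apply/mapP; exists (s, e, j, Q').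
  case E: (info R j) => [[[n|k] b]|] //= [? ?]; subst.
  case: (IHR _ _ _ ja E) => R' tR; exists (PPar (ren S Q) R').
  by rewrite mem_cat; apply/orP; right; apply/mapP; exists (s, e, j, R').
- move=> ia; case E: (info Q i) => [[[[|n]|k] b]|] //= [? ?]; subst.
  case: (IH _ _ _ ia E) => Q' tQ; exists (Nu (ren swap01 Q')).
  by apply/mapP; exists (s.+1, e, i, Q') => //; rewrite mem_filter tQ.
Qed.

Lemma vis_actv0 P s e i P' : (s, e, i, P') \in vis P -> i \in actv P [::].
Proof.
move: P s e i P'; apply: visP_ind => //= *; rewrite ?mem_cat ?inE //.
- by apply: map_f.
- by apply/orP; left; apply: map_f.
- by apply/orP; right; apply: map_f.
- by apply/orP; left; apply: map_f.
- by apply/orP; right; apply: map_f.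
Qed.

(** With [ex_I] below, and with [vis_ex] and [int_ex], this replays an executable word as
    transitions, one label at a time. *)
Lemma ex_V P i w : ex P (V i :: w) -> exists s e P', (s, e, i, P') \in vis P.
Proof.
elim: P i w => [k|s' e' Q IH|Q IH|Q IHQ R IHR|Q IHQ R IHR|Q IH] i w //=.
- by case/andP => /eqP[->] _; exists s', e', (Dia Q); rewrite inE.
- case: i => [|[|[|c]] i] //=; rewrite p1_cons /= => /andP[_ /IH[s [e [Q' tQ]]]].
  by exists s, e, (Dia Q'); apply/mapP; exists (s, e, i, Q').
- case: i => [|[|[|[|c]]] i] //=; rewrite p1_cons p2_cons /=.
    case/and4P => _ /IHQ[s [e [Q' tQ]]] _ _; exists s, e, (Par Q' (ren S R)).
    by rewrite mem_cat; apply/orP; left; apply/mapP; exists (s, e, i, Q').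
  case/and4P => _ _ /IHR[s [e [R' tR]]] _; exists s, e, (Par (ren S Q) R').
  by rewrite mem_cat; apply/orP; right; apply/mapP; exists (s, e, i, R').
- case: i => [|[|[|[|c]]] i] //=; rewrite p1_cons p2_cons /=.
    case/and3P => _ /IHQ[s [e [Q' tQ]]] _; exists s, e, (PPar Q' (ren S R)).
    by rewrite mem_cat; apply/orP; left; apply/mapP; exists (s, e, i, Q').
  case/and3P => _ _ /IHR[s [e [R' tR]]]; exists s, e, (PPar (ren S Q) R').
  by rewrite mem_cat; apply/orP; right; apply/mapP; exists (s, e, i, R').
- case/and3P => /IH[s [e [Q' tQ]]]; rewrite (vis_info tQ); case: s tQ => // s tQ _ _.
  by exists s, e, (Nu (ren swap01 Q')); apply/mapP; exists (s.+1, e, i, Q') => //; rewrite mem_filter tQ.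
Qed.

Lemma int_cross Q R s e i j Q' R' :
  (s, e, i, Q') \in vis Q -> (s, ~~ e, j, R') \in vis R ->
  (1 :: i, 2 :: j, Nu (Par Q' R')) \in int (Par Q R).
Proof.
move=> tQ tR; rewrite /= !mem_cat; apply/orP; right; apply/orP; right.
apply/flatten_mapP; exists (s, e, i, Q') => //; apply/mapP; exists (s, ~~ e, j, R') => //.
by rewrite mem_filter tR /= !eqxx.
Qed.

Lemma ex_I P i j w : ex P (I i j :: w) -> exists P', (i, j, P') \in int P.
Proof.
elim: P i j w => [k|s' e' Q IH|Q IH|Q IHQ R IHR|Q IHQ R IHR|Q IH] i j w //=.
- case: i j => [|[|[|c]] i] [|[|[|d]] j] //=; rewrite p1_cons /= => /andP[_ /IH[Q' tQ]].
  by exists (Dia Q'); apply/mapP; exists (i, j, Q').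
- case: i j => [|[|[|[|c]]] i] [|[|[|[|d]]] j] //=; rewrite p1_cons p2_cons /=.
  + case/and4P => _ /IHQ[Q' tQ] _ _; exists (Par Q' R).
    by rewrite !mem_cat; apply/orP; left; apply/mapP; exists (i, j, Q').
  + case/and4P => _ /ex_V[s [e [Q' tQ]]] /ex_V[s2 [e2 [R' tR]]] /andP[].
    rewrite (vis_info tQ) (vis_info tR) /= => /andP[/eqP ? /eqP ?] _; subst.
    by exists (Nu (Par Q' R')); exact: (int_cross tQ tR).
  + case/and4P => _ _ /IHR[R' tR] _; exists (Par Q R').
    by rewrite !mem_cat; apply/orP; right; apply/orP; left; apply/mapP; exists (i, j, R').
- case: i j => [|[|[|[|c]]] i] [|[|[|[|d]]] j] //=; rewrite p1_cons p2_cons /=.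
  + case/and3P => _ /IHQ[Q' tQ] _; exists (PPar Q' R).
    by rewrite !mem_cat; apply/orP; left; apply/mapP; exists (i, j, Q').
  + case/and3P => _ _ /IHR[R' tR]; exists (PPar Q R').
    by rewrite !mem_cat; apply/orP; right; apply/mapP; exists (i, j, R').
- by case/andP => /IH[Q' tQ] _; exists (Nu Q'); apply/mapP; exists (i, j, Q').
Qed.

Lemma seq0P (T : eqType) (s : seq T) : (forall x, x \notin s) -> s = [::].
Proof. by case: s => // x s /(_ x); rewrite in_cons eqxx. Qed.

Lemma imax0_int P : imax P [::] -> int P = [::].
Proof.
elim: P => [k|s' e' Q IH|Q IH|Q IHQ R IHR|Q IHQ R IHR|Q IH] //=.
- by move/IH ->.
- case/and3P => /IHQ-> /IHR-> /allP nc /=; apply: seq0P => t; apply/negP.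
  case/flatten_mapP => -[[[s e] i] Q'] tQ /mapP[[[[s' e'] j] R']].
  rewrite mem_filter /= => /andP[/andP[/eqP ? /eqP ?] tR] _; subst.
  move/allP: (nc _ (vis_actv0 tQ)) => /(_ _ (vis_actv0 tR)).
  by rewrite (vis_info tQ) (vis_info tR) /= !eqxx.
- by case/andP => /IHQ-> /IHR->.
- by move/IH ->.
Qed.

Lemma map_nil (T U : Type) (f : T -> U) s : map f s = [::] -> s = [::].
Proof. by case: s. Qed.

Lemma int0_imax P : int P = [::] -> imax P [::].
Proof.
elim: P => [k|s' e' Q IH|Q IH|Q IHQ R IHR|Q IHQ R IHR|Q IH] //=.
- by move/map_nil/IH.
- move=> E; have iP := fun t => congr1 (fun l => t \in l) E.
  have iQ : int Q = [::] by move: (E); case: (int Q).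
  have iR : int R = [::] by move: (E); rewrite iQ; case: (int R).
  apply/and3P; split; [exact: IHQ|exact: IHR|].
  apply/allP => i ia; apply/allP => j ja; apply/negP.
  case Ei: (info Q i) => [[[n|k] e]|] //=; case Ej: (info R j) => [[[n'|l] e']|] //=.
    case/andP => /eqP ? /eqP ?; subst.
    case: (actv_vis ia Ei) => Q' tQ; case: (actv_vis ja Ej) => R' tR.
    by move: (iP (1 :: i, 2 :: j, Nu (Par Q' R'))); rewrite -/(int (Par Q R)) (int_cross tQ tR).
  by case/andP. by case/andP. by case/andP.
- move=> E; rewrite IHQ ?IHR //; last by move: E; case: (int Q).
  by move: E; case: (int Q) => //=; case: (int R).
- by move/map_nil/IH.
Qed.

Lemma val0 P : value P [::] = state P.
Proof.
elim: P => [k|s' e' Q IH|Q IH|Q IHQ R IHR|Q IHQ R IHR|Q IH] //=.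
- by rewrite -IHQ -IHR.
- by rewrite -IHQ -IHR.
Qed.

Lemma vis_nacts P s e i P' : (s, e, i, P') \in vis P -> nacts P' < nacts P.
Proof.
move: P s e i P'; apply: visP_ind => //= *; rewrite ?nacts_ren //.
- by rewrite ltn_add2r.
- by rewrite ltn_add2l.
- by rewrite ltn_add2r.
- by rewrite ltn_add2l.
Qed.

Lemma int_nacts P i j P' : (i, j, P') \in int P -> nacts P' < nacts P.
Proof.
move: P i j P'; apply: intP_ind => //=.
- by move=> *; rewrite ltn_add2r.
- by move=> *; rewrite ltn_add2l.
- move=> Q R s e i j Q' R' /vis_nacts tQ /vis_nacts tR.
  by rewrite -addnS; apply: leq_add => //; exact: ltnW.
- by move=> *; rewrite ltn_add2r.
- by move=> *; rewrite ltn_add2l.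
Qed.

Lemma execsE f P : execs f P =
  if int P == [::] then [:: ([::], P)] else
  if f is f.+1 then flatten [seq [seq ((t.1.1, t.1.2) :: e.1, e.2) | e <- execs f t.2] | t <- int P]
  else [::].
Proof. by case: f => /=; case: (int P). Qed.

Definition iw (u : seq ilabel) : seq lab := map inr u.

Lemma ex_nil P : ex P [::].
Proof. by elim: P => //= [Q -> R ->|Q -> R ->|Q ->]. Qed.

Lemma execs_sound f P u P' : (u, P') \in execs f P ->
  [/\ ex P (iw u), imax P (iw u) & value P (iw u) = state P'].
Proof.
elim: f P u P' => [|f IH] P u P'; rewrite execsE.
  by case: eqP => // iP; rewrite inE => /eqP[-> ->]; split; rewrite ?val0 ?int0_imax ?ex_nil.
case: eqP => [iP|_].
  by rewrite inE => /eqP[-> ->]; split; rewrite ?val0 ?int0_imax ?ex_nil.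
case/flatten_mapP => -[[i j] Q] tP /mapP[[v Q']] /IH[exQ imQ vQ] [-> ->] /=.
by rewrite (int_ex tP) (int_val tP) (int_imax tP).
Qed.

End Execs.

(** * Dependence and homotopy *)

(** One-sided: [a] guards [b], or shares a position with it. Independence of internal labels in the
    sense of [lab_indep] is the failure of both directions. *)
Definition dep (a b : lab) : bool := has (fun i => has (prefix i) (ps b)) (ps a).

Lemma depP a b : reflect (exists i j, [/\ i \in ps a, j \in ps b & prefix i j]) (dep a b).
Proof.
apply: (iffP hasP) => [[i ia /hasP[j jb ij]]|[i [j [ia jb ij]]]]; first by exists i, j.
by exists i => //; apply/hasP; exists j.
Qed.

Lemma dep_refl a : dep a a.
Proof. by case: a => [i|[i j]]; apply/depP; exists i, i; rewrite !inE eqxx prefix_refl. Qed.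

Lemma s1_ps a a' i : s1 a = Some a' -> i \in ps a' -> 1 :: i \in ps a.
Proof.
case: a => [[|[|[|[|c]]] j]|[[|[|[|c]] j] [|[|[|[|d]]] k]]] //= [<-];
  by rewrite !inE ?eqseq_cons /= ?orbF.
Qed.
Lemma s2_ps a a' i : s2 a = Some a' -> i \in ps a' -> 2 :: i \in ps a.
Proof.
case: a => [[|[|[|[|c]]] j]|[[|[|[|[|c]]] j] [|[|[|[|d]]] k]]] //= [<-];
  by rewrite !inE ?eqseq_cons /= ?orbF.
Qed.

Lemma dep_s1 a b a' b' : s1 a = Some a' -> s1 b = Some b' -> dep a' b' -> dep a b.
Proof.
move=> /s1_ps ha /s1_ps hb /depP[i [j [ia jb ij]]]; apply/depP; exists (1 :: i), (1 :: j).
by rewrite ha // hb // prefix_cons.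
Qed.
Lemma dep_s2 a b a' b' : s2 a = Some a' -> s2 b = Some b' -> dep a' b' -> dep a b.
Proof.
move=> /s2_ps ha /s2_ps hb /depP[i [j [ia jb ij]]]; apply/depP; exists (2 :: i), (2 :: j).
by rewrite ha // hb // prefix_cons.
Qed.

Lemma dep_s12 a b : inP a -> inP b -> dep a b ->
  (exists a' b', [/\ s1 a = Some a', s1 b = Some b' & dep a' b']) \/
  (exists a' b', [/\ s2 a = Some a', s2 b = Some b' & dep a' b']).
Proof.
move=> aP bP /depP[i [j [/(ps12 aP) ia /(ps12 bP) jb]]].
case: ia => -[i' -> [a' Ea ia']]; case: jb => -[j' -> [b' Eb jb']];
  rewrite prefix_cons //= => ij; [left|right]; exists a', b'; split=> //;
  by apply/depP; exists i', j'.
Qed.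

(** No label comes after one that it guards. As [dep] is reflexive, repetitions are excluded as
    well. *)
Definition pw (w : seq lab) : bool := pairwise (fun a b => ~~ dep b a) w.

Arguments pw : simpl never.
Lemma pw_cons a w : pw (a :: w) = all (fun b => ~~ dep b a) w && pw w.
Proof. by []. Qed.

(** By [dep_s12] a dependence between labels of a parallel composition is already present in one of
    the projections. *)
Lemma pw12 w : all inP w -> pw (p1 w) -> pw (p2 w) -> pw w.
Proof.
elim: w => //= a w IH /andP[aP wP]; rewrite p1_cons p2_cons => pw1 pw2.
rewrite pw_cons IH //; last 2 first.
- by case: (s1 a) pw1 => // l; rewrite pw_cons => /andP[].
- by case: (s2 a) pw2 => // l; rewrite pw_cons => /andP[].
rewrite andbT; apply/allP => b bw; apply/negP => /(dep_s12 (allP wP _ bw) aP).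
case=> -[b' [a' [Eb Ea]]].
  move: pw1; rewrite Ea pw_cons => /andP[/allP + _] => /(_ b').
  by rewrite mem_pmap -Eb map_f // => /(_ isT)/negbTE->.
move: pw2; rewrite Ea pw_cons => /andP[/allP + _] => /(_ b').
by rewrite mem_pmap -Eb map_f // => /(_ isT)/negbTE->.
Qed.

Lemma p2_in1 w : all in1 w -> p2 w = [::].
Proof. by elim: w => //= l w IH /andP[/in1P[l' ->] /IH]; rewrite p2_cons labE. Qed.

Lemma p1_cat u v : p1 (u ++ v) = p1 u ++ p1 v. Proof. exact: pmap_cat. Qed.
Lemma p2_cat u v : p2 (u ++ v) = p2 u ++ p2 v. Proof. exact: pmap_cat. Qed.

Section Words.
Variable K : comPzSemiRingType.
Implicit Types (P Q R : term K) (w : seq lab).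

Lemma execs_complete f P u : nacts P <= f -> ex P (iw u) -> imax P (iw u) ->
  exists P', (u, P') \in execs f P.
Proof.
elim: u f P => [|[i j] u IH] f P Pf /=.
  by move=> _ /imax0_int iP; exists P; rewrite execsE iP eqxx inE.
move=> exP imP; have [P' tP] := ex_I exP.
move: exP imP; rewrite (int_ex tP) => exP'; rewrite (int_imax tP) // => imP'.
have := int_nacts tP; case: f Pf => [|f] Pf lt; first by move: lt; rewrite ltnNge (leq_trans Pf).
have [|P'' Pu] := IH f P' _ exP' imP'; first by rewrite -ltnS; apply: leq_trans Pf.
exists P''; rewrite execsE; case: eqP => [E|_]; first by rewrite E in tP.
by apply/flatten_mapP; exists (i, j, P') => //; apply/mapP; exists (u, P'').
Qed.

Lemma ex_pw P w : ex P w -> pw w.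
Proof.
elim: P w => [k|s e Q IH|Q IH|Q IHQ R IHR|Q IHQ R IHR|Q IH] w /=.
- by move/eqP->.
- case: w => // l w /and3P[/eqP-> win1 /IH pwQ]; rewrite pw_cons.
  rewrite pw12 ?in1_inP ?p2_in1 // andbT; apply/allP => b /(allP win1)/in1P[b' ->].
  apply/negP => /depP[i [j [ib jl ij]]]; move: jl ij ib; rewrite /= inE => /eqP->.
  by rewrite prefixs0 => /eqP->; case: b' => [k|[k k']]; rewrite !inE .
- by case/andP => win1 /IH pwQ; rewrite pw12 ?in1_inP ?p2_in1.
- by case/and4P => win /IHQ ? /IHR ? _; exact: pw12.
- by case/and3P => /in12_inP win /IHQ ? /IHR ?; exact: pw12.
- by case/andP => /IH.
Qed.

Lemma pw_uniq w : pw w -> uniq w.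
Proof. by apply: pairwise_uniq => a; rewrite dep_refl. Qed.

Lemma ex_uniq P w : ex P w -> uniq w. Proof. by move/ex_pw/pw_uniq. Qed.

(** Labels that share a position guard each other, which [pw] forbids in either order. *)
Lemma pw_ps w a b i : pw w -> a \in w -> b \in w -> i \in ps a -> i \in ps b -> a = b.
Proof.
move=> + + + ia ib; have dab : dep a b by apply/depP; exists i, i; rewrite ia ib prefix_refl.
have dba : dep b a by apply/depP; exists i, i; rewrite ia ib prefix_refl.
elim: w => // c w IH; rewrite !in_cons pw_cons => /andP[/allP h pww].
case/orP => [/eqP E|aw] /orP[/eqP F|bw]; subst => //.
- by move: (h _ bw); rewrite dba.
- by move: (h _ aw); rewrite dab.
- exact: IH.
Qed.

Lemma homotopic_cons (a : ilabel) u v : homotopic u v -> homotopic (a :: u) (a :: v).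
Proof.
elim=> [l|l1 l2 [m1 m2 b c bc]|l1 l2 _ IH|l1 l2 l3 _ IH1 _ IH2].
- exact: Hrefl.
- by apply: Hstep; exact: (HSwap (a :: m1)).
- exact: Hsym.
- exact: Htrans IH2.
Qed.

Lemma homotopic_perm u v : homotopic u v -> perm_eq u v.
Proof.
elim=> [l|l1 l2 [m1 m2 b c bc]|l1 l2 _ IH|l1 l2 l3 _ IH1 _ IH2] //.
- by rewrite perm_cat2l -[b :: c :: m2]/([:: b] ++ [:: c] ++ m2) perm_catCA.
- by rewrite perm_sym.
- exact: perm_trans IH2.
Qed.

Lemma homotopic_front (a : ilabel) u v :
  all (fun b => lab_indep b a) u -> homotopic (u ++ a :: v) (a :: u ++ v).
Proof.
elim: u => [|b u IH] /=; first by move=> _; exact: Hrefl.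
case/andP => ba /IH h; apply: Htrans (homotopic_cons b h) _.
by apply: Hstep; exact: (@HSwap [::]).
Qed.

Lemma lab_indepE (a b : ilabel) : ~~ dep (inr a) (inr b) -> ~~ dep (inr b) (inr a) -> lab_indep a b.
Proof.
case: a b => i j [k l]; rewrite /dep /lab_indep /indep /= !orbF !negb_or -!andbA.
by case/and4P => -> -> -> -> /and4P[-> -> -> ->].
Qed.

(** The first letter [a] of [u] can be moved to the front of [v]. The letters that precede it in [v]
    follow it in [u], so [pw] of the two words excludes dependence in both directions. *)
Lemma pw_homotopic u v : pw (iw u) -> pw (iw v) -> perm_eq u v -> homotopic u v.
Proof.
elim: u v => [|a u IH] v; first by move=> _ _; rewrite perm_sym => /perm_nilP->; exact: Hrefl.
move=> pu pv uv; have av : a \in v by rewrite -(perm_mem uv) mem_head.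
case/splitPr: av uv pv => v1 v2 uv pv.
have uv' : perm_eq u (v1 ++ v2).
  rewrite -(perm_cons a); apply: perm_trans uv _.
  by rewrite -[a :: v2]/([:: a] ++ v2) perm_catCA.
move: pu; rewrite /= pw_cons => /andP[/allP h pu].
apply: Htrans (homotopic_cons a (IH (v1 ++ v2) pu _ uv')) _.
  move: pv; rewrite /pw /iw !map_cat !pairwise_cat /= allrel_consr.
  by case/and3P => /andP[_ ->] -> /andP[_ ->].
apply: Hsym; apply: homotopic_front; apply/allP => b bv; apply: lab_indepE.
  by apply: h; apply: map_f; rewrite (perm_mem uv') mem_cat bv.
move: pv; rewrite /pw /iw map_cat pairwise_cat /= allrel_consr.
case/andP => /andP[/allP h2 _] _.
by apply: h2; apply: map_f.
Qed.

Lemma p1_mem w w' : w =i w' -> p1 w =i p1 w'.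
Proof. by move=> ww l; rewrite !mem_pmap; apply: eq_mem_map. Qed.
Lemma p2_mem w w' : w =i w' -> p2 w =i p2 w'.
Proof. by move=> ww l; rewrite !mem_pmap; apply: eq_mem_map. Qed.

(** Only the set of labels matters here, and below for [value] and [imax]; these are therefore
    functions of the prerun. The order of a word is seen by [ex] alone. *)
Lemma actv_mem P w w' : w =i w' -> actv P w = actv P w'.
Proof.
elim: P w w' => [k|s e Q IH|Q IH|Q IHQ R IHR|Q IHQ R IHR|Q IH] w w' ww //=;
  rewrite ?ww ?(IH _ _ (p1_mem ww)) ?(IHQ _ _ (p1_mem ww)) ?(IHR _ _ (p2_mem ww)) //.
exact: IH.
Qed.

Lemma val_mem P w w' : w =i w' -> value P w = value P w'.
Proof.
elim: P w w' => [k|s e Q IH|Q IH|Q IHQ R IHR|Q IHQ R IHR|Q IH] w w' ww //=;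
  rewrite ?ww ?(IH _ _ (p1_mem ww)) ?(IHQ _ _ (p1_mem ww)) ?(IHR _ _ (p2_mem ww)) //.
exact: IH.
Qed.

Lemma nmatch_mem w w' o o' : w =i w' -> nmatch w o o' = nmatch w' o o'.
Proof. by move=> ww; case: o => [[[n|k] e]|] //; case: o' => [[[n'|k'] e']|] //=; rewrite ww. Qed.

Lemma ncheck_mem Q R w w' l : w =i w' -> ncheck Q R w l = ncheck Q R w' l.
Proof.
move=> ww; case: l => [[|[|[|[|c]]] i]|[[|[|[|c]] i] [|[|[|[|d]]] j]]] //=;
  by [apply: eq_visok => k; rewrite ww | exact: nmatch_mem].
Qed.

Lemma ncheck_all Q R w w' : w =i w' -> all (ncheck Q R w) w = all (ncheck Q R w') w'.
Proof. by move=> ww; rewrite -(eq_all_r ww); apply: eq_all => l; exact: ncheck_mem. Qed.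

Lemma imax_mem P w w' : w =i w' -> imax P w = imax P w'.
Proof.
elim: P w w' => [k|s e Q IH|Q IH|Q IHQ R IHR|Q IHQ R IHR|Q IH] w w' ww //=;
  rewrite ?ww ?(IH _ _ (p1_mem ww)) ?(IHQ _ _ (p1_mem ww)) ?(IHR _ _ (p2_mem ww)) //.
  rewrite (actv_mem Q (p1_mem ww)) (actv_mem R (p2_mem ww)); congr [&& _, _ & _].
  by apply: all2_eq => i j _ _; rewrite (nmatch_mem _ _ ww).
exact: IH.
Qed.

Lemma all_swap (T : Type) (p : pred T) u a b v : all p (u ++ a :: b :: v) = all p (u ++ b :: a :: v).
Proof. by rewrite !all_cat /= [p a && (p b && _)]andbCA. Qed.

(* Adjacent steps commute unless the first one enables the second. *)
Lemma ex_swap P u a b v : ~~ dep a b -> ex P (u ++ a :: b :: v) -> ex P (u ++ b :: a :: v).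
Proof.
elim: P u a b v => [k|s e Q IH|Q IH|Q IHQ R IHR|Q IHQ R IHR|Q IH] u a b v nab /=.
- by case: u.
- have key u' : ex Q (p1 (u' ++ a :: b :: v)) -> ex Q (p1 (u' ++ b :: a :: v)).
    rewrite !p1_cat !p1_cons; case Ea: (s1 a) => [a'|]; case Eb: (s1 b) => [b'|] //.
    by apply: IH; apply: contra nab; exact: dep_s1.
  case: u => [|c u] /=; last by rewrite [all _ (_ ++ b :: _)]all_swap => /and3P[-> -> /key->].
  case/and3P => /eqP E; move: nab; rewrite E => /negP[]; apply/depP.
  by case: (b) => [i|[i j]]; exists [::], i; rewrite !inE eqxx prefix0s.
- rewrite all_swap !p1_cat !p1_cons => /andP[->] /=.
  case Ea: (s1 a) => [a'|]; case Eb: (s1 b) => [b'|] //.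
  by apply: IH; apply: contra nab; exact: dep_s1.
- have ww : (u ++ a :: b :: v) =i (u ++ b :: a :: v).
    by move=> l; rewrite !mem_cat !in_cons; congr (_ || _); rewrite orbCA.
  rewrite (ncheck_all Q R ww) (eq_all_r ww).
  case/and4P => -> + + ->; rewrite !p1_cat !p1_cons !p2_cat !p2_cons andbT /= => exQ exR.
  apply/andP; split.
    case Ea: (s1 a) exQ => [a'|]; case Eb: (s1 b) => [b'|] //.
    by apply: IHQ; apply: contra nab; exact: dep_s1.
  case Ea: (s2 a) exR => [a'|]; case Eb: (s2 b) => [b'|] //.
  by apply: IHR; apply: contra nab; exact: dep_s2.
- have ww : (u ++ a :: b :: v) =i (u ++ b :: a :: v).
    by move=> l; rewrite !mem_cat !in_cons; congr (_ || _); rewrite orbCA.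
  rewrite (eq_all_r ww).
  case/and3P => -> + +; rewrite !p1_cat !p1_cons !p2_cat !p2_cons /= => exQ exR.
  apply/andP; split.
    case Ea: (s1 a) exQ => [a'|]; case Eb: (s1 b) => [b'|] //.
    by apply: IHQ; apply: contra nab; exact: dep_s1.
  case Ea: (s2 a) exR => [a'|]; case Eb: (s2 b) => [b'|] //.
  by apply: IHR; apply: contra nab; exact: dep_s2.
- have ww : (u ++ a :: b :: v) =i (u ++ b :: a :: v).
    by move=> l; rewrite !mem_cat !in_cons; congr (_ || _); rewrite orbCA.
  by case/andP => /(IH _ _ _ _ nab)->; rewrite (eq_all_r ww).
Qed.

End Words.

(** * Preruns and the outcome *)

Section Canon.
Variable T : countType.
Implicit Types s t : seq T.

(** The order given by [pickle] has no meaning of its own; it only provides a normal form for lists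
    up to permutation. *)
Definition canon s : seq T := sort (fun a b => pickle a <= pickle b) s.

Lemma canonP s t : reflect (canon s = canon t) (perm_eq s t).
Proof.
apply: perm_sortP => [a b|a b c|a b]; first exact: leq_total.
  exact: leq_trans.
by rewrite -eqn_leq => /eqP/(pcan_inj pickleK).
Qed.

Lemma perm_canon s : perm_eq (canon s) s. Proof. by rewrite perm_sort. Qed.
Lemma canon_id s : canon (canon s) = canon s. Proof. exact/canonP/perm_canon. Qed.
Lemma mem_canon s : canon s =i s. Proof. exact/perm_mem/perm_canon. Qed.
End Canon.

(** Serves to make [pres] and [pairs] finite lists; only the completeness of the enumeration
    matters. *)
Fixpoint words (T : Type) (D : seq T) (n : nat) : seq (seq T) :=
  [::] :: (if n is n'.+1 then flatten [seq [seq l :: w | w <- words D n'] | l <- D] else [::]).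

Lemma mem_words (T : eqType) (D : seq T) n w :
  {subset w <= D} -> size w <= n -> w \in words D n.
Proof.
elim: n w => [|n IH] [|l w] //= wD wn; rewrite in_cons /=.
apply/flatten_mapP; exists l; first by apply: wD; rewrite mem_head.
by apply: map_f; apply: IH => // x xw; apply: wD; rewrite in_cons xw orbT.
Qed.

(** The left side has the shape of [outcome], where a class is counted at its first member. *)
Lemma sum_first_undup (V : nmodType) (A : Type) (B : eqType) (key : A -> B) (g : B -> V) (L : seq A) x0 :
  (\sum_(i < size L) (if key (nth x0 L i) \in map key (take i L) then 0 else g (key (nth x0 L i))))%R
  = (\sum_(b <- undup (map key L)) g b)%R.
Proof.
elim/last_ind: L => [|L a IH]; first by rewrite big_ord0 big_nil.
rewrite size_rcons big_ord_recr /= nth_rcons ltnn eqxx -cats1 take_cat ltnn subnn take0 cats0.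
transitivity ((\sum_(b <- undup (map key L)) g b) + (if key a \in map key L then 0 else g (key a)))%R.
  congr (_ + _)%R; rewrite -IH; apply: eq_bigr => i _.
  by rewrite nth_cat ltn_ord takel_cat // ltnW.
rewrite map_cat /= ; case: ifPn => aL.
  rewrite addr0; apply: perm_big; apply: uniq_perm; rewrite ?undup_uniq // => b.
  by rewrite !mem_undup mem_cat inE; case: eqP => [->|]; rewrite ?aL ?orbF.
rewrite addrC; transitivity (\sum_(b <- key a :: undup (map key L)) g b)%R; first by rewrite big_cons.
apply: perm_big; apply: uniq_perm => [||b]; rewrite ?undup_uniq //=.
  by rewrite mem_undup aL undup_uniq.
by rewrite in_cons !mem_undup mem_cat inE orbC.
Qed.

Definition isI (l : lab) : bool := if l is inr _ then true else false.

Section Pres.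
Variable K : comPzSemiRingType.
Implicit Types (P Q R : term K) (w S : seq lab).

Fixpoint acts P : seq pos :=
  match P with
  | Const _ => [::]
  | Act _ _ Q => [::] :: map (cons 1) (acts Q)
  | Dia Q => map (cons 1) (acts Q)
  | Par Q R | PPar Q R => map (cons 1) (acts Q) ++ map (cons 2) (acts R)
  | Nu Q => acts Q
  end.

Definition labs P : seq lab := [seq V i | i <- acts P] ++ [seq I i j | i <- acts P, j <- acts P].

Lemma ex_acts P w l i : ex P w -> l \in w -> i \in ps l -> i \in acts P.
Proof.
have H1 Q w' j l' : (forall w l i, ex Q w -> l \in w -> i \in ps l -> i \in acts Q) ->
    ex Q (p1 w') -> l' \in w' -> (exists2 l1, s1 l' = Some l1 & j \in ps l1) -> 1 :: j \in map (cons 1) (acts Q).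
  move=> IH exQ lw [l1 E jl]; apply: map_f; apply: IH exQ _ jl.
  by rewrite mem_pmap -E map_f.
have H2 Q w' j l' : (forall w l i, ex Q w -> l \in w -> i \in ps l -> i \in acts Q) ->
    ex Q (p2 w') -> l' \in w' -> (exists2 l1, s2 l' = Some l1 & j \in ps l1) -> 2 :: j \in map (cons 2) (acts Q).
  move=> IH exQ lw [l1 E jl]; apply: map_f; apply: IH exQ _ jl.
  by rewrite mem_pmap -E map_f.
elim: P w l i => [k|s e Q IH|Q IH|Q IHQ R IHR|Q IHQ R IHR|Q IH] w l i /=.
- by move/eqP->.
- case: w => // l0 w /and3P[/eqP-> win1 exQ]; rewrite in_cons => /orP[/eqP->|lw].
    by rewrite inE => /eqP->; rewrite mem_head.
  case/(ps12 (allP (in1_inP win1) _ lw)) => -[j -> h]; rewrite in_cons.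
    by rewrite (H1 _ _ _ _ IH exQ lw h) orbT.
  by case/in1P: (allP win1 _ lw) h => l' -> []; rewrite labE.
- case/andP => win1 exQ lw.
  case/(ps12 (allP (in1_inP win1) _ lw)) => -[j -> h]; first exact: (H1 _ _ _ _ IH exQ lw h).
  by case/in1P: (allP win1 _ lw) h => l' -> []; rewrite labE.
- case/and4P => win exQ exR _ lw /(ps12 (allP win _ lw))[][j -> h]; rewrite mem_cat.
    by rewrite (H1 _ _ _ _ IHQ exQ lw h).
  by rewrite (H2 _ _ _ _ IHR exR lw h) orbT.
- case/and3P => /in12_inP win exQ exR lw /(ps12 (allP win _ lw))[][j -> h]; rewrite mem_cat.
    by rewrite (H1 _ _ _ _ IHQ exQ lw h).
  by rewrite (H2 _ _ _ _ IHR exR lw h) orbT.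
- by case/andP => exQ _; exact: IH.
Qed.

Lemma ex_labs P w : ex P w -> {subset w <= labs P}.
Proof.
move=> exP l lw; have h i := ex_acts exP lw (i := i); rewrite mem_cat.
case: l {lw} h => [i|[i j]] h; apply/orP; [left|right].
  by apply: map_f; apply: h; rewrite inE.
by apply: allpairs_f; apply: h; rewrite !inE eqxx ?orbT.
Qed.

(* Sorting the labels chooses a representative of each homotopy class, so the
   preruns are the homotopy classes of words that admit no further internal step. *)
Definition pres P : seq (seq lab) :=
  undup [seq canon w | w <- words (labs P) (size (labs P)) & ex P w && imax P w].

Lemma presP P S : reflect (exists w, [/\ ex P w, imax P w & S = canon w]) (S \in pres P).
Proof.
rewrite mem_undup; apply: (iffP mapP) => [[w]|[w [exP imP ->]]].
  by rewrite mem_filter => /andP[/andP[exP imP] _] ->; exists w.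
exists w => //; rewrite mem_filter exP imP; apply: mem_words; first exact: ex_labs.
by apply: uniq_leq_size; [exact: ex_uniq exP|exact: ex_labs].
Qed.

Lemma pres_uniq P : uniq (pres P). Proof. exact: undup_uniq. Qed.

Lemma homotopic_execs P u v P1 P2 : (u, P1) \in maxexecs P -> (v, P2) \in maxexecs P ->
  homotopic u v <-> canon (iw u) = canon (iw v).
Proof.
move=> /execs_sound[exu _ _] /execs_sound[exv _ _].
split=> [/homotopic_perm uv|/canonP uv]; first by apply/canonP; exact: perm_map.
apply: pw_homotopic; [exact: ex_pw exu|exact: ex_pw exv|].
by apply: perm_map_inj uv => a b [].
Qed.

(** By [homotopic_execs] the class of a maximal execution is the sorted list of its labels, and the
    preruns without visible labels are exactly the classes obtained in this way. *)
Lemma outcomeE P : outcome P = (\sum_(S <- pres P | all isI S) value P S)%R.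
Proof.
pose L := maxexecs P; pose key (e : seq ilabel * term K) := canon (iw e.1).
transitivity (\sum_(b <- undup (map key L)) value P b)%R; last first.
  rewrite -[RHS]big_filter; apply: perm_big; apply: uniq_perm.
  - exact: undup_uniq.
  - exact/filter_uniq/pres_uniq.
  move=> S; rewrite mem_undup mem_filter; apply/mapP/andP.
    case=> -[u Q] uL ->; have [exu imu _] := execs_sound uL; split.
      by rewrite (eq_all_r (mem_canon _)); apply/allP => l /mapP[? _ ->].
    by apply/presP; exists (iw u).
  case=> SI /presP[w [exw imw E]]; have {}SI : all isI w by rewrite -(eq_all_r (mem_canon _)) -E.
  have [u wu] : exists u, w = iw u.
    by elim: (w) SI => [|[//|a] v IH] /=; [exists [::]|move/IH => [u ->]; exists (a :: u)].
  subst w; have [P' uL] := execs_complete (leqnn _) exw imw.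
  by exists (u, P').
rewrite -(sum_first_undup key (value P) L ([::], P)) /outcome -/L.
apply: eq_bigr => -[i iL] _ /=.
have inL j : j < size L -> nth ([::], P) L j \in L by move=> jL; rewrite mem_nth.
have [_ _ vi] := execs_sound (eq_ind _ (fun e => is_true (e \in L)) (inL i iL) _ (surjective_pairing _)).
congr (if _ then _ else _); last by rewrite -vi; apply: val_mem => l; rewrite mem_canon.
have hom j : j < size L -> homotopic (nth ([::], P) L j).1 (nth ([::], P) L i).1 <->
    key (nth ([::], P) L j) = key (nth ([::], P) L i).
  move=> jL; have := inL i iL; have := inL j jL.
  by case: (nth _ L j) => u P1; case: (nth _ L i) => v P2; exact: homotopic_execs.
apply/asboolP/idP => [[j ji]|].
  have jL := ltn_trans ji iL; move/(hom j jL) => E; apply/mapP.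
  exists (nth ([::], P) L j) => //; rewrite -(nth_take _ ji); apply: mem_nth.
  by rewrite size_take iL.
case/mapP => e /(nthP ([::], P))[j]; rewrite size_take iL => ji <- E.
exists j => //; apply/hom; first exact: ltn_trans iL.
by rewrite E nth_take.
Qed.

End Pres.

(** * Runs above a prerun that realizes a trace *)

Definition visw (w : seq lab) : seq pos := pmap (fun l => if l is inl i then Some i else None) w.
Definition xs (w : seq lab) : seq (pos * pos) :=
  pmap (fun l => match l with inr (1 :: i, 2 :: j) => Some (i, j) | _ => None end) w.
Definition mkX (x : pos * pos) : lab := X x.1 x.2.

Lemma visw_cat u v : visw (u ++ v) = visw u ++ visw v. Proof. exact: pmap_cat. Qed.
Lemma mem_visw w i : (i \in visw w) = (V i \in w).
Proof. by rewrite mem_pmap; elim: w => //= -[j|j] w IH; rewrite !in_cons IH. Qed.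
Lemma visw_perm u v : perm_eq u v -> perm_eq (visw u) (visw v).
Proof. exact: perm_pmap. Qed.
Lemma mem_xs w i j : ((i, j) \in xs w) = (X i j \in w).
Proof.
rewrite mem_pmap; elim: w => //= l w IH; rewrite !in_cons IH; congr (_ || _).
by case: l => [[|[|[|[|c]]] k]|[[|[|[|c]] k] [|[|[|[|d]]] k']]]; apply/eqP/eqP => //= -[] // -> ->.
Qed.
Lemma xs_perm u v : perm_eq u v -> perm_eq (xs u) (xs v).
Proof. exact: perm_pmap. Qed.
Lemma xs_cat u v : xs (u ++ v) = xs u ++ xs v. Proof. exact: pmap_cat. Qed.

Lemma visw_split w : perm_eq w (filter isI w ++ map inl (visw w)).
Proof.
elim: w => //= -[i|i] w IH; rewrite ?perm_cons //=.
by rewrite perm_sym -cat1s perm_catCA perm_cons perm_sym.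
Qed.

Lemma word_split w : all inP w -> all isI w ->
  perm_eq w (map lab_e1 (filter isI (p1 w)) ++ map mkX (xs w) ++ map lab_e2 (filter isI (p2 w))).
Proof.
elim: w => //= l w IH /andP[lP wP] /andP[lI wI]; rewrite p1_cons p2_cons.
case/inPP: lP lI => [[i|[i j]]|[i|[i j]]|i j] //= _.
- by rewrite perm_cons; exact: IH.
- by rewrite perm_sym catA -cat1s perm_catCA perm_cons perm_sym -catA IH.
- by rewrite perm_sym -cat1s perm_catCA perm_cons perm_sym IH.
Qed.

Lemma closed_visw w : all inP w -> all isI w ->
  visw (p1 w) = unzip1 (xs w) /\ visw (p2 w) = unzip2 (xs w).
Proof.
elim: w => //= l w IH /andP[lP wP] /andP[lI wI]; rewrite p1_cons p2_cons.
have [IH1 IH2] := IH wP wI.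
by case/inPP: lP lI => [[i|[i j]]|[i|[i j]]|i j] //= _; rewrite IH1 IH2.
Qed.

(** These labels project to visible steps of an operand; the others are internal to one side and
    constrain nothing on the other. *)
Definition sched (l : lab) : bool := if l is inr _ then isX l else true.

(** The schedule [s] fixes how the visible steps of the two sides are interleaved or matched. Before
    each of its labels, the sides concerned run their internal steps up to their next visible
    one. *)
Lemma merge_words w1 w2 (s : seq lab) : all inP s -> all sched s ->
  visw w1 = visw (p1 s) -> visw w2 = visw (p2 s) ->
  exists w, [/\ all inP w, p1 w = w1, p2 w = w2 & filter sched w = s].
Proof.
have loc1 u w : all isI u -> exists u', [/\ all inP u', p1 (u' ++ w) = u ++ p1 w, p2 (u' ++ w) = p2 w & filter sched u' = [::]].
  elim: u => [|[//|[i j]] u IH] /=; first by exists [::].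
  case/IH => u' [u'P E1 E2 E3]; exists (I (1 :: i) (1 :: j) :: u'); split=> //=.
  by rewrite p1_cons /= E1.
have loc2 u w : all isI u -> exists u', [/\ all inP u', p1 (u' ++ w) = p1 w, p2 (u' ++ w) = u ++ p2 w & filter sched u' = [::]].
  elim: u => [|[//|[i j]] u IH] /=; first by exists [::].
  case/IH => u' [u'P E1 E2 E3]; exists (I (2 :: i) (2 :: j) :: u'); split=> //=.
  by rewrite p2_cons /= E2.
have allI u : visw u = [::] -> all isI u by elim: u => // -[i|i] u IH //= /IH.
have vcons u i v : visw u = i :: v -> exists u1 u2, [/\ u = u1 ++ V i :: u2, all isI u1 & visw u2 = v].
  elim: u => // -[j|j] u IH /=.
    by case=> <- E; exists [::], u.
  by move/IH => [u1 [u2 [-> ? ?]]]; exists (inr j :: u1), u2.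
elim: s w1 w2 => [|l s IH] w1 w2 /=.
  move=> _ _ /allI w1I /allI w2I; have [u2 [u2P E1 E2 E3]] := loc2 _ [::] w2I.
  have [u1 [u1P F1 F2 F3]] := loc1 _ u2 w1I; exists (u1 ++ u2); split.
  - by rewrite all_cat u1P.
  - by rewrite F1 -[u2]cats0 E1 cats0.
  - by rewrite F2 -[u2]cats0 E2 cats0.
  - by rewrite filter_cat E3 F3.
case/andP => lP sP /andP[ls sS]; rewrite p1_cons p2_cons.
case/inPP: lP ls => [[i|[//]]|[i|[//]]|i j] /= _.
- move/vcons => [u1 [u2 [-> u1I E]]] E2; have [w [wP F1 F2 F3]] := IH u2 w2 sP sS E E2.
  have [u1' [u1P G1 G2 G3]] := loc1 u1 (V (1 :: i) :: w) u1I.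
  exists (u1' ++ V (1 :: i) :: w); split.
  + by rewrite all_cat u1P.
  + by rewrite G1 p1_cons /= F1.
  + by rewrite G2 p2_cons.
  + by rewrite filter_cat G3 /= F3.
- move=> E2 /vcons [u1 [u2 [-> u1I E]]]; have [w [wP F1 F2 F3]] := IH w1 u2 sP sS E2 E.
  have [u1' [u1P G1 G2 G3]] := loc2 u1 (V (2 :: i) :: w) u1I.
  exists (u1' ++ V (2 :: i) :: w); split.
  + by rewrite all_cat u1P.
  + by rewrite G1 p1_cons.
  + by rewrite G2 p2_cons /= F2.
  + by rewrite filter_cat G3 /= F3.
- move=> /vcons [u1 [u2 [-> u1I E]]] /vcons [t1 [t2 [-> t1I E2]]].
  have [w [wP F1 F2 F3]] := IH u2 t2 sP sS E E2.
  have [t1' [t1P H1 H2 H3]] := loc2 t1 (X i j :: w) t1I.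
  have [u1' [u1P G1 G2 G3]] := loc1 u1 (t1' ++ X i j :: w) u1I.
  exists (u1' ++ t1' ++ X i j :: w); split.
  + by rewrite !all_cat u1P t1P.
  + by rewrite G1 H1 p1_cons /= F1.
  + by rewrite G2 H2 p2_cons /= F2.
  + by rewrite !filter_cat G3 H3 /= F3.
Qed.

Section Realize.
Variable K : comPzSemiRingType.
Implicit Types (P Q R : term K) (w S : seq lab).
Variables (E : eqType) (sr : E -> nat + E) (pl : E -> bool).

(** The name [n] of a term denotes the abstract name [g]. A bound name has a denotation only if its
    binder is the place of a visible event. *)
Definition rn (rho : nat -> nat + E) (ev : seq E) (h : E -> pos) (n : nam) (g : nat + E) : Prop :=
  match n with
  | inl i => rho i = g
  | inr k => exists2 b, b \in ev & k = h b /\ g = inr b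
  end.

Definition linext (prec : rel E) (v : seq E) : Prop :=
  forall a b, a \in v -> b \in v -> prec a b -> index a v <= index b v.

(* The prerun S of P has visible events ev, placed by h, under the naming rho of
   the free names of P.  Every execution of S respects precS and every linear
   extension of precC is executed; the two orders coincide for a trace, but
   keeping them apart makes this property compositional. *)
Record realizes rho P S (ev : seq E) (N : seq (bool * (nat + E))) (precS precC : rel E) (h : E -> pos) : Prop := {
  rz_uniq : uniq ev;
  rz_inj : {in ev &, injective h};
  rz_vis : perm_eq (visw S) (map h ev);
  rz_info : forall a, a \in ev -> exists2 n, info P (h a) = Some (n, pl a) & rn rho ev h n (sr a);
  rz_sound : forall w, perm_eq w S -> ex P w ->
    exists v, [/\ perm_eq v ev, visw w = map h v & linext precS v];
  rz_compl : forall v, perm_eq v ev -> linext precC v ->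
    exists w, [/\ perm_eq w S, ex P w & visw w = map h v];
  rz_N : forall e g, (e, g) \in N <-> exists i n, [/\ i \in actv P S, info P i = Some (n, e) & rn rho ev h n g]
}.

Lemma realizes_perm rho P S S' ev N precS precC h : perm_eq S S' ->
  realizes rho P S ev N precS precC h -> realizes rho P S' ev N precS precC h.
Proof.
move=> SS' [H1 H2 H3 H4 H5 H6 H7]; split=> //.
- by rewrite -(permPl (visw_perm SS')).
- by move=> w wS; apply: H5; rewrite (permPr SS').
- by move=> v vE vl; have [w [wS exw ww]] := H6 v vE vl; exists w; rewrite -(permPr SS').
- by move=> e g; rewrite -(actv_mem P (perm_mem SS')).
Qed.

End Realize.

Lemma mem_zip_map (A B C : eqType) (h : A -> C) (v : seq A) (t : seq B) a j :
  (a, j) \in zip v t -> (h a, j) \in zip (map h v) t.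
Proof.
elim: v t => [|x v IH] [|y t] //=; rewrite !in_cons => /orP[/eqP[-> ->]|/IH->].
  by rewrite eqxx.
by rewrite orbT.
Qed.

Lemma mem_map_zip (A B C : eqType) (h : A -> C) (v : seq A) (t : seq B) c j :
  (c, j) \in zip (map h v) t -> exists2 a, c = h a & (a, j) \in zip v t.
Proof.
elim: v t => [|x v IH] [|y t] //=; rewrite in_cons => /orP[/eqP[-> ->]|/IH[a -> aj]].
  by exists x => //; rewrite mem_head.
by exists a => //; rewrite in_cons aj orbT.
Qed.

Lemma mem_zip_l (A B : eqType) (v : seq A) (t : seq B) a j : (a, j) \in zip v t -> a \in v.
Proof.
elim: v t => [|x v IH] [|y t] //=; rewrite !in_cons => /orP[/eqP[-> _]|/IH->]; by rewrite ?eqxx ?orbT.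
Qed.

Lemma mem_zip_r (A B : eqType) (v : seq A) (t : seq B) a j : (a, j) \in zip v t -> j \in t.
Proof.
elim: v t => [|x v IH] [|y t] //=; rewrite !in_cons => /orP[/eqP[_ ->]|/IH->]; by rewrite ?eqxx ?orbT.
Qed.

Lemma perm_xs_mkX (A B : seq lab) (z : seq (pos * pos)) :
  xs (map lab_e1 A ++ map mkX z ++ map lab_e2 B) = z.
Proof.
rewrite !xs_cat.
have -> : xs (map lab_e1 A) = [::] by elim: A => // -[i|[i j]] A.
have -> : xs (map lab_e2 B) = [::] by elim: B => // -[i|[i j]] B.
rewrite cats0 /=; elim: z => //= -[i j] z IH.
by rewrite /xs /= in IH *; rewrite IH.
Qed.

(** * Matching the events of a prerun with a context *)

Section Pairing.
Variable K : comPzSemiRingType.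
Implicit Types (P Q R : term K) (w S : seq lab).
Variables (E : countType) (sr : E -> nat + E) (pl : E -> bool).
Variables (ev : seq E) (N : seq (bool * (nat + E))) (prec : rel E).

(** The comparison of names in [nmatch], with events in place of positions of [P], so that [P] is no
    longer mentioned. *)
Definition mok (m : seq (E * pos)) (g : nat + E) (n : nam) : bool :=
  match g, n with
  | inl u, inl u' => u == u'
  | inr b, inr l => (b, l) \in m
  | _, _ => false
  end.

(* The prerun S2 of R can be run against ev, the matching m pairing each event
   with an action of R, and leaves no synchronisation with N possible. *)
Record compat R (S2 : seq lab) (m : seq (E * pos)) (u : seq lab) (v : seq E) : Prop := {
  cp_perm : perm_eq u S2;
  cp_ex : ex R u;
  cp_lin : linext prec v;
  cp_ev : perm_eq v ev;
  cp_size : size v = size (visw u);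
  cp_m : perm_eq m (zip v (visw u));
  cp_name : forall a j, (a, j) \in m -> exists2 n', info R j = Some (n', ~~ pl a) & mok m (sr a) n';
  cp_max : forall e g j n', (e, g) \in N -> j \in actv R S2 -> info R j = Some (n', ~~ e) -> ~~ mok m g n'
}.

Definition compatible R (x : seq lab * seq (E * pos)) : Prop :=
  exists u v, compat R x.1 x.2 u v.

Definition cands R : seq (seq lab * seq (E * pos)) :=
  let D := [seq (a, j) | a <- ev, j <- acts R] in
  [seq (U, m) | U <- pres R, m <- undup [seq canon m | m <- words D (size ev)]].

Definition pairs R := [seq x <- cands R | `[< compatible R x >]].

(* What a prerun of value 1 with trace data (ev, N, prec) contributes to the
   outcome against R. *)
Definition HT R : K := (\sum_(x <- pairs R) value R x.1)%R.

Lemma pairsP R x : x \in pairs R <-> [/\ x.1 \in pres R, canon x.2 = x.2 & compatible R x].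
Proof.
rewrite mem_filter; split.
  case/andP => /asboolP cx /allpairsP[[S m] /= [SR]]; rewrite mem_undup => /mapP[m' _ ->] E'; rewrite E' /=.
  by split=> //; [rewrite canon_id|rewrite -E'].
case: x => S m /= [SR mc cx]; apply/andP; split; first exact/asboolP.
apply/allpairsP; exists (S, m); split => //=; rewrite mem_undup; apply/mapP; exists m => //.
have [u [v [h1 h2 h3 h4 h5 h6 h7 h8]]] := cx; rewrite /= in h1 h2 h6 h7 h8.
apply: mem_words; last by rewrite (perm_size h6) size1_zip ?h5 // -h5 (perm_size h4).
case=> a j; rewrite (perm_mem h6) => aj.
apply: allpairs_f; first by rewrite -(perm_mem h4); exact: mem_zip_l aj.
by have := mem_zip_r aj; rewrite mem_visw => ju; apply: (ex_acts h2 ju); rewrite inE.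
Qed.

Lemma pairs_uniq R : uniq (pairs R).
Proof.
apply: filter_uniq; apply: (allpairs_uniq (f := pair)); rewrite ?undup_uniq //.
by move=> [a b] [c d] /= _ _ [-> ->].
Qed.

Section One.
Variables (P R : term K) (S : seq lab) (h : E -> pos).
Hypothesis PS : realizes sr pl inl P S ev N prec prec h.
Hypothesis SP : S \in pres P.

(** The labels of the closed prerun above [S] that [x] determines, in no executable order: the
    matching supplies the synchronisations, and each side contributes its internal steps. *)
Definition asm (x : seq lab * seq (E * pos)) : seq lab :=
  map lab_e1 (filter isI S) ++ map mkX [seq (h y.1, y.2) | y <- x.2] ++ map lab_e2 (filter isI x.1).

Lemma p1_asm A z B : p1 (map lab_e1 A ++ map mkX z ++ map lab_e2 B) = A ++ map inl (unzip1 z).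
Proof.
by rewrite !p1_cat p1_e1 p1_e2 cats0; congr (_ ++ _); elim: z => //= -[i j] z IH; rewrite p1_cons /= IH.
Qed.

Lemma p2_asm A z B : p2 (map lab_e1 A ++ map mkX z ++ map lab_e2 B) = map inl (unzip2 z) ++ B.
Proof.
by rewrite !p2_cat p2_e1 p2_e2 cat0s; congr (_ ++ _); elim: z => //= -[i j] z IH; rewrite p2_cons /= IH.
Qed.

Lemma compat_p1 S2 m u v : compat R S2 m u v -> perm_eq (p1 (asm (S2, m))) S.
Proof.
case=> _ _ _ vE sz mE _ _; rewrite p1_asm perm_sym (permPl (visw_split S)) perm_cat2l.
apply: perm_map; rewrite (permPl (rz_vis PS)) /unzip1 -map_comp.
have -> : [seq (fst \o (fun y : E * pos => (h y.1, y.2))) i | i <- m] = map h (unzip1 m).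
  by rewrite /unzip1 -map_comp.
apply: perm_map; rewrite perm_sym; apply: perm_trans vE.
by rewrite -(unzip1_zip (_ : size v <= size (visw u))) ?sz //; exact: perm_map.
Qed.

Lemma compat_p2 S2 m u v : compat R S2 m u v -> perm_eq (p2 (asm (S2, m))) S2.
Proof.
case=> uS _ _ vE sz mE _ _; rewrite p2_asm perm_catC perm_sym (permPl (visw_split S2)) perm_cat2l.
apply: perm_map; rewrite -(permPl (visw_perm uS)) /unzip2 -map_comp perm_sym.
have -> : [seq (snd \o (fun y : E * pos => (h y.1, y.2))) i | i <- m] = unzip2 m by [].
by rewrite -(unzip2_zip (_ : size (visw u) <= size v)) ?sz //; exact: perm_map.
Qed.

Lemma nmatchE w m n e g n' e' :
  (forall b l, b \in ev -> (X (h b) l \in w) = ((b, l) \in m)) ->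
  rn inl ev h n g -> nmatch w (Some (n, e)) (Some (n', e')) = (e' == ~~ e) && mok m g n'.
Proof.
move=> Hw; case: n => [i <-|k [b bev [-> ->]]] /=; first by case: n'.
by case: n' => // l; rewrite Hw.
Qed.

(** In a closed word every visible step of a projection is one half of a synchronisation, so the two
    sequences of visible positions are the columns of [xs w]. The matching is the order [v] of the
    events, obtained from [rz_sound], zipped with the right column. *)
Lemma asm_sound U : U \in pres (Par P R) -> all isI U -> canon (p1 U) == S ->
  exists2 x, x \in pairs R & U = canon (asm x).
Proof.
case/presP => w [exw imw ->]; rewrite (eq_all_r (mem_canon _)) => wI /eqP ES.
have {ES} pS : perm_eq (p1 w) S.
  by rewrite -ES perm_sym (permPl (perm_canon _)); apply: perm_pmap; exact: perm_canon.
move: exw imw => /= /and4P[wP exP exR nc] /and3P[imP imR nocm].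
have [v [vE vw vl]] := rz_sound PS pS exP.
have [x1 x2] := closed_visw wP wI.
have xE : xs w = zip (map h v) (visw (p2 w)) by rewrite -vw x1 x2 zip_unzip.
pose m := zip v (visw (p2 w)).
have sz : size v = size (visw (p2 w)) by rewrite x2 -(size_map h) -vw x1 !size_map.
have mX b l : b \in ev -> (X (h b) l \in w) = ((b, l) \in canon m).
  move=> bev; rewrite mem_canon -mem_xs xE; apply/idP/idP => [/mem_map_zip[a E' al]|]; last exact: mem_zip_map.
  have aev : a \in ev by rewrite -(perm_mem vE); exact: mem_zip_l al.
  by rewrite (rz_inj PS bev aev E').
exists (canon (p2 w), canon m).
  apply/pairsP; split; rewrite ?canon_id //; first by apply/presP; exists (p2 w).
  exists (p2 w), v; split=> //=.
  - by rewrite perm_sym; exact: perm_canon.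
  - exact: perm_canon.
  - move=> a j; rewrite mem_canon => aj.
    have aev : a \in ev by rewrite -(perm_mem vE); exact: mem_zip_l aj.
    have := mX a j aev; rewrite mem_canon aj => /(allP nc) /=.
    have [n -> rna] := rz_info PS aev; case: (info R j) => // -[n' e'].
    by rewrite (nmatchE _ _ _ mX rna) => /andP[/eqP-> ok]; exists n'.
  - move=> e g j n' /(rz_N PS)[i [n [ia ni rng]]] ja nj.
    rewrite (actv_mem R (mem_canon _)) in ja.
    rewrite -(actv_mem P (perm_mem pS)) in ia.
    move/allP: nocm => /(_ _ ia)/allP/(_ _ ja).
    by rewrite ni nj (nmatchE _ _ _ mX rng) eqxx.
apply/canonP; rewrite (permPl (word_split wP wI)); apply: perm_cat; last apply: perm_cat.
- by apply: perm_map; exact: perm_filter.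
- apply: perm_map; rewrite xE /=.
  apply: (@perm_trans _ [seq (h y.1, y.2) | y <- m]).
    rewrite /m; elim: (v) (visw _) => [|a v' IH] [|j t] //=; by rewrite perm_cons.
  by apply: perm_map; rewrite perm_sym; exact: perm_canon.
- by apply: perm_map; apply: perm_filter; rewrite perm_sym; exact: perm_canon.
Qed.

(** The order [v] provided by [compat] can be executed by [P] according to [rz_compl], and [u]
    follows it on the side of [R]. Hence [merge_words] can interleave both executions along the
    synchronisations taken in this order. *)
Lemma asm_compl x : x \in pairs R ->
  [/\ canon (asm x) \in pres (Par P R), all isI (canon (asm x)) & canon (p1 (canon (asm x))) == S].
Proof.
case: x => S2 m /pairsP[/= S2R mc [u [v c]]]; rewrite /= in c.
have pS1 := compat_p1 c; have pS2 := compat_p2 c.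
have aI : all isI (asm (S2, m)).
  rewrite !all_cat !all_map; apply/and3P; split.
  - by apply/allP => l; rewrite mem_filter => /andP[]; case: l => // -[].
  - exact/allP.
  - by apply/allP => l; rewrite mem_filter => /andP[]; case: l => // -[].
have SE : canon S = S by case/presP: SP => ? [_ _ ->]; rewrite canon_id.
split; last 2 first.
- by rewrite (eq_all_r (mem_canon _)).
- apply/eqP; rewrite -[RHS]SE; apply/canonP; rewrite -(permPr pS1); apply: perm_pmap; exact: perm_canon.
have [uS exu vl vE sz mE nm mx] := c.
have [w1 [w1S exw1 vw1]] := rz_compl PS vE vl.
pose z := zip (map h v) (visw u).
have zP : all inP (map mkX z) by apply/allP => l /mapP[? _ ->].
have zS : all sched (map mkX z) by apply/allP => l /mapP[? _ ->].
have pz1 : p1 (map mkX z) = map inl (map h v).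
  by have := p1_asm [::] z [::]; rewrite /= cats0 => ->; rewrite /z unzip1_zip // size_map sz.
have pz2 : p2 (map mkX z) = map inl (visw u).
  by have := p2_asm [::] z [::]; rewrite /= !cats0 => ->; rewrite /z unzip2_zip // size_map sz.
have vinl (t : seq pos) : visw (map inl t) = t by elim: t => //= a t IH; rewrite /visw /= in IH *; rewrite IH.
have [||w [wP pw1 pw2 fw]] := @merge_words w1 u _ zP zS.
- by rewrite pz1 vinl.
- by rewrite pz2 vinl.
have wI : all isI w.
  apply/allP => -[i|//] iw; have : V i \in filter sched w by rewrite mem_filter.
  by rewrite fw => /mapP[].
have xw : xs w = z.
  have : xs (filter sched w) = xs w by elim: (w) => // -[i|[[|[|[|[|c']]] k] [|[|[|[|d]]] k']]] w' IH //=; rewrite /xs /= in IH *; rewrite IH.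
  by rewrite fw => <-; have := perm_xs_mkX [::] [::] z; rewrite /= cats0.
have mX b l : b \in ev -> (X (h b) l \in w) = ((b, l) \in m).
  move=> bev; rewrite (perm_mem mE) -mem_xs xw; apply/idP/idP => [/mem_map_zip[a E' al]|]; last exact: mem_zip_map.
  have aev : a \in ev by rewrite -(perm_mem vE); exact: mem_zip_l al.
  by rewrite (rz_inj PS bev aev E').
apply/presP; exists w; split.
- rewrite /= wP pw1 pw2 exw1 exu /=; apply/allP => l lw.
  have lI := allP wI _ lw; case/inPP: (allP wP _ lw) lI (lw) => [[i|[i j]]|[i|[i j]]|i j] //= _ Xw.
  have : (i, j) \in xs w by rewrite mem_xs.
  rewrite xw => /mem_map_zip[a -> aj].
  have aev : a \in ev by rewrite -(perm_mem vE); exact: mem_zip_l aj.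
  have [n -> rna] := rz_info PS aev.
  have [n' -> ok] := nm a j (etrans (perm_mem mE _) aj).
  by rewrite (nmatchE _ _ _ mX rna) eqxx.
- have [w' [exw' imw' ES]] := presP _ _ SP.
  have [w2' [exw2' imw2' ES2]] := presP _ _ S2R.
  rewrite /= pw1 pw2; apply/and3P; split.
  + rewrite -(imax_mem P (w := w')) // => l.
    by rewrite (perm_mem w1S) ES mem_canon.
  + rewrite -(imax_mem R (w := w2')) // => l.
    by rewrite (perm_mem uS) ES2 mem_canon.
  rewrite (actv_mem P (perm_mem w1S)) (actv_mem R (perm_mem uS)).
  apply/allP => i ia; apply/allP => j ja; apply/negP.
  case Ei: (info P i) => [[n e]|] //; case Ej: (info R j) => [[n' e']|] // nme.
  (* A bound name can take part in a match only through a synchronisation, whose left half is an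
     event. So the name denotes something, and the action is recorded in [N]. *)
  have [g rng] : exists g, rn inl ev h n g.
    case: n Ei nme => [k|k] Ei; first by exists (inl k).
    case: n' Ej => [k'|l] Ej /=; first by rewrite andbF.
    case/andP => _; rewrite -mem_xs xw => /mem_map_zip[a -> aj]; exists (inr a), a => //.
    by rewrite -(perm_mem vE); exact: mem_zip_l aj.
  move: nme; rewrite (nmatchE _ _ _ mX rng) => /andP[/eqP ? ok]; subst e'.
  have eN : (e, g) \in N by apply/(rz_N PS); exists i, n.
  by move: (mx _ _ _ _ eN ja Ej); rewrite ok.
apply/canonP; rewrite perm_sym (permPl (word_split wP wI)) pw1 pw2 xw.
apply: perm_cat; last apply: perm_cat.
- by apply: perm_map; exact: perm_filter.
- apply: perm_map => /=; apply: (@perm_trans _ [seq (h y.1, y.2) | y <- zip v (visw u)]).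
    rewrite /z; elim: (v) (visw _) => [|a v' IH] [|j t] //=; by rewrite perm_cons.
  by apply: perm_map; rewrite perm_sym.
- by apply: perm_map; exact: perm_filter.
Qed.

(** The second projection recovers the prerun of [R]. The cross labels recover the matching, because
    [h] is injective on the events. *)
Lemma asm_inj : {in pairs R &, injective (fun x => canon (asm x))}.
Proof.
move=> [S2 m] [S2' m'] /pairsP[/= SR mc [u [v c]]] /pairsP[/= SR' mc' [u' [v' c']]] /canonP aa.
have SE : S2 = S2'.
  have cS T0 : T0 \in pres R -> canon T0 = T0 by case/presP => w2 [_ _ ->]; rewrite canon_id.
  rewrite -(cS _ SR) -(cS _ SR'); apply/canonP.
  by rewrite -(permPl (compat_p2 c)) -(permPr (compat_p2 c')); exact: perm_pmap.
congr (_, _); rewrite // -mc -mc'; apply/canonP.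
have := xs_perm aa; rewrite !perm_xs_mkX => mm.
have key (m0 : seq (E * pos)) u0 v0 S0 : compat R S0 m0 u0 v0 -> exists t : seq E, uniq t /\ t = unzip1 m0 /\ {subset t <= ev}.
  case=> _ _ _ vE sz mE _ _; exists (unzip1 m0).
  have mU : perm_eq (unzip1 m0) v0.
    suff : perm_eq (unzip1 m0) (unzip1 (zip v0 (visw u0))) by rewrite unzip1_zip ?sz.
    exact: perm_map.
  split; last split=> //.
    by rewrite (perm_uniq mU) (perm_uniq vE); exact: (rz_uniq PS).
  by move=> a; rewrite (perm_mem mU) (perm_mem vE).
have [t [_ [tE tev]]] := key _ _ _ _ c; have [t' [_ [tE' tev']]] := key _ _ _ _ c'.
have sub1 y : y \in m -> y.1 \in ev by move=> ym; apply: tev; rewrite tE; exact: map_f.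
have sub2 y : y \in m' -> y.1 \in ev by move=> ym; apply: tev'; rewrite tE'; exact: map_f.
have um (m0 : seq (E * pos)) u0 v0 S0 : compat R S0 m0 u0 v0 -> uniq m0.
  move/key => [t0 [ut [te _]]]; rewrite te in ut; exact: map_uniq ut.
apply: uniq_perm; [exact: um c|exact: um c'|].
have half (m1 m2 : seq (E * pos)) : (forall y, y \in m1 -> y.1 \in ev) -> (forall y, y \in m2 -> y.1 \in ev) ->
  perm_eq [seq (h y.1, y.2) | y <- m1] [seq (h y.1, y.2) | y <- m2] -> {subset m1 <= m2}.
  move=> s1' s2' pm y ym; have : (h y.1, y.2) \in [seq (h y.1, y.2) | y <- m2].
    by rewrite -(perm_mem pm); apply/mapP; exists y.
  case/mapP => y' ym' [E1 E2]; have := rz_inj PS (s1' _ ym) (s2' _ ym') E1.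
  by case: y y' E2 {E1 ym} ym' => a b [a' b'] /= <- ym' ->.
move=> y; apply/idP/idP; first exact: half.
by apply: half => //; rewrite perm_sym.
Qed.

(** [asm] is a bijection from [pairs R] onto the closed preruns above [S]. The right side depends on
    [P] and [S] only through the trace data that they realize. *)
Lemma HTE : (\sum_(U <- pres (Par P R) | all isI U && (canon (p1 U) == S)) value R (p2 U))%R = HT R.
Proof.
rewrite -big_filter /HT.
transitivity (\sum_(U <- map (fun x => canon (asm x)) (pairs R)) value R (p2 U))%R.
  apply: perm_big; apply: uniq_perm.
  - exact/filter_uniq/pres_uniq.
  - rewrite map_inj_in_uniq; [exact: pairs_uniq|exact: asm_inj].
  move=> U; rewrite mem_filter; apply/andP/mapP.
    by case=> /andP[UI US] UP; exact: asm_sound.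
  by case=> x /asm_compl[h1 h2 h3] ->; rewrite h1 h2 h3.
rewrite big_map; apply: eq_big_seq => -[S2 m] /pairsP[_ _ [u [v c]]].
apply: val_mem => l; rewrite -(perm_mem (compat_p2 c)); apply: p2_mem => l'.
exact: mem_canon.
Qed.

End One.
End Pairing.

(** * Outcomes as linear combinations over traces *)

Section Decomp.
Variable K : comPzSemiRingType.
Implicit Types (P Q R : term K) (w S : seq lab).

Definition realizesT P S (T : trace) : Prop :=
  exists h, realizes (@tsrc T) (@tpol T) inl P S (enum 'I_(tn T)) (tN T) (@tle T) (@tle T) h.

Definition HTT (T : trace) R : K :=
  HT (@tsrc T) (@tpol T) (enum 'I_(tn T)) (tN T) (@tle T) R.

Definition decomposes P (D : seq (K * trace)) : Prop :=
  forall R, outcome (Par P R) = (\sum_(x <- D) x.1 * HTT x.2 R)%R.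

Lemma pres_canon P S : S \in pres P -> canon S = S.
Proof. by case/presP => w [_ _ ->]; rewrite canon_id. Qed.

(** Each closed prerun of [P | R] is charged to its projection to [P], above which [HTE] evaluates
    the sum. Preruns of value 0 contribute nothing and need not be covered. The index type [J]
    permits families such as the disjoint union used for sums. *)
Lemma decomposition (J : eqType) P (js : seq J) (Sf : J -> seq lab) (tr : J -> trace) :
  (forall j, j \in js -> canon (Sf j) \in pres P /\ realizesT P (Sf j) (tr j)) ->
  uniq [seq canon (Sf j) | j <- js] ->
  (forall S, S \in pres P -> value P S != 0%R -> S \in [seq canon (Sf j) | j <- js]) ->
  decomposes P [seq (value P (Sf j), tr j) | j <- js].
Proof.
move=> Hreal Huniq Hcov R; rewrite outcomeE big_map.
pose L := [seq canon (Sf j) | j <- js].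
have proj U : U \in pres (Par P R) -> canon (p1 U) \in pres P.
  case/presP => w [/= /and4P[_ exP _ _] /and3P[imP _ _] ->]; apply/presP; exists (p1 w).
  by split=> //; apply/canonP/perm_pmap/perm_canon.
have valc S : value P (canon S) = value P S by apply: val_mem; exact: mem_canon.
transitivity (\sum_(U <- pres (Par P R) | all isI U)
   \sum_(S <- L | canon (p1 U) == S) (value P S * value R (p2 U)))%R.
  rewrite big_seq_cond [RHS]big_seq_cond; apply: eq_bigr => U /andP[UP _] /=.
  case: (boolP (canon (p1 U) \in L)) => UL.
    rewrite (eq_bigl (pred1 (canon (p1 U)))) => [|S]; last by rewrite eq_sym.
    by rewrite -big_filter filter_pred1_uniq // big_seq1 valc.
  have -> : value P (p1 U) = 0%R.
    apply/eqP; rewrite -valc; apply: contraNT UL; exact: Hcov (proj _ UP).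
  rewrite mul0r big_seq_cond big_pred0 // => S; apply/negP => /andP[SL /eqP E].
  by rewrite E SL in UL.
rewrite (exchange_big_dep predT) //= /L big_map.
rewrite big_seq [RHS]big_seq; apply: eq_bigr => j jj; rewrite valc -big_distrr /=; congr (_ * _)%R.
have [SP [h Rh]] := Hreal j jj.
apply: HTE => //; apply: realizes_perm Rh; rewrite perm_sym; exact: perm_canon.
Qed.

End Decomp.

(** * Every term decomposes into traces *)

Section Lin.
Variables (L : eqType) (dp : rel L) (W : seq L -> Prop).
Hypothesis Wswap : forall u a b v, W (u ++ a :: b :: v) -> ~~ dp a b -> W (u ++ b :: a :: v).
Hypothesis Wuniq : forall u, W u -> uniq u.
Hypothesis Wdep : forall u a b, W u -> a \in u -> b \in u -> dp a b -> index a u <= index b u.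
Variable S : seq L.

(** The precedence forced by [S]: taken on visible labels, it becomes the order of the trace of a
    prerun. *)
Definition before (a b : L) : Prop := forall u, W u -> perm_eq u S -> index a u <= index b u.

Lemma before_trans b a c : before a b -> before b c -> before a c.
Proof. by move=> ab bc u Wu uS; apply: leq_trans (ab u Wu uS) (bc u Wu uS). Qed.

Lemma dep_before a b : a \in S -> b \in S -> dp a b -> before a b.
Proof. by move=> aS bS ab u Wu uS; apply: Wdep => //; rewrite (perm_mem uS). Qed.

Lemma bubble p x A q : W (p ++ x :: A ++ q) -> all (fun y => ~~ dp x y) A -> W (p ++ A ++ x :: q).
Proof.
elim: A p => //= y A IH p Wp /andP[xy xA].
by have := IH (rcons p y); rewrite !cat_rcons; apply=> //; apply: Wswap.
Qed.

(* Bubbling to the right of c every letter of s1 that need not precede c. *)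
Lemma front p s1 c s2 : W (p ++ s1 ++ c :: s2) -> perm_eq (p ++ s1 ++ c :: s2) S ->
  exists A B, [/\ W (p ++ A ++ c :: B), perm_eq (A ++ B) (s1 ++ s2) & forall a, a \in A -> before a c].
Proof.
move=> W0 pS.
have [A [B [W1 pm bf]]] : exists A B, [/\ W (p ++ A ++ c :: B ++ s2), perm_eq (A ++ B) s1 & forall a, a \in A -> before a c].
  suff gen : forall t A B, W (p ++ t ++ A ++ c :: B ++ s2) -> perm_eq (p ++ t ++ A ++ c :: B ++ s2) S ->
      (forall a, a \in A -> before a c) ->
      exists A' B', [/\ W (p ++ A' ++ c :: B' ++ s2), perm_eq (A' ++ B') (t ++ A ++ B) & forall a, a \in A' -> before a c].
    have [] := gen s1 [::] [::] => //= A [B [? pm ?]]; exists A, B; split=> //.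
    by rewrite cats0 in pm.
  elim/last_ind => [|t x IH] A B W1 pS1 bf; first by exists A, B.
  rewrite cat_rcons in W1 pS1.
  have inS y : y \in x :: A ++ [:: c] -> y \in S.
    rewrite in_cons mem_cat mem_seq1 -(perm_mem pS1) => h.
    by rewrite !(mem_cat, in_cons); case/or3P: h => ->; rewrite ?orbT.
  have [xc|nxc] := pselect (before x c).
    have [|||A' [B' [? pm ?]]] := IH (x :: A) B => //.
      by move=> a; rewrite in_cons => /orP[/eqP->|/bf].
    exists A', B'; split=> //; by rewrite cat_rcons.
  have [|||A' [B' [? pm ?]]] := IH A (x :: B) => //.
  (* If [x] need not precede [c], then it guards neither [c] nor a letter of [A], since the letters
     of [A] must themselves precede [c]. So it can be moved past all of them. *)
  - rewrite catA -cat_rcons -catA; have := @bubble (p ++ t) x (rcons A c) (B ++ s2).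
    rewrite !cat_rcons -!catA /=; apply=> //; apply/allP => y yA; apply/negP => xy.
    have {}xy : before x y.
      by apply: dep_before => //; apply: inS; rewrite in_cons ?eqxx // cats1 yA orbT.
    move: yA; rewrite mem_rcons in_cons => /orP[/eqP E|/bf yc]; first by apply: nxc; rewrite -E.
    by apply: nxc; apply: before_trans yc.
  - apply: perm_trans pS1; rewrite !perm_cat2l.
    by apply/permP => q; rewrite /= !count_cat /= count_cat; lia.
  exists A', B'; split=> //; apply: perm_trans pm _; rewrite cat_rcons perm_cat2l.
  by rewrite -cat1s perm_catCA.
exists A, (B ++ s2); split=> //; by rewrite catA perm_cat2r.
Qed.

Variable vs : pred L.

(** The visible letters are brought forward one at a time in the order [v]. By [front], what remains
    before the current letter [c] is forced to precede it; a visible letter among these would come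
    after [c] in [v], against the hypothesis on [v]. So only invisible letters are carried along. *)
Lemma lin_word w v : W w -> perm_eq w S -> perm_eq v (filter vs S) ->
  (forall a b, a \in v -> b \in v -> before a b -> index a v <= index b v) ->
  exists w', [/\ W w', perm_eq w' S & filter vs w' = v].
Proof.
move=> Ww wS vS vl.
have uS : uniq S by rewrite -(perm_uniq wS); exact: Wuniq.
have uv : uniq v by rewrite (perm_uniq vS) filter_uniq.
suff gen : forall v2 v1 p s, v = v1 ++ v2 -> filter vs p = v1 -> W (p ++ s) -> perm_eq (p ++ s) S ->
   perm_eq (filter vs s) v2 -> exists w', [/\ W w', perm_eq w' S & filter vs w' = v].
  by apply: (gen v [::] [::] w) => //; rewrite perm_sym; apply: perm_trans vS _; apply: perm_filter; rewrite perm_sym.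
elim=> [|c v2 IH] v1 p s E pv Wps psS sv.
  exists (p ++ s); split=> //; move: sv => /perm_nilP sv.
  by rewrite filter_cat sv cats0 pv E cats0.
have : c \in filter vs s by rewrite (perm_mem sv) mem_head.
rewrite mem_filter => /andP[vc cs]; case/splitPr: cs Wps psS sv => s1 s2 Wps psS sv.
have [A [B [W1 AB bf]]] := front Wps psS.
have nA : filter vs A = [::].
  apply/eqP; rewrite -(negbK (_ == _)) -has_filter; apply/hasPn => a aA; apply/negP => va.
  have av2 : a \in v2.
    have : a \in s1 ++ s2 by rewrite -(perm_mem AB) mem_cat aA.
    rewrite mem_cat => h.
    have : a \in c :: v2.
      by rewrite -(perm_mem sv) mem_filter va mem_cat in_cons; case/orP: h => ->; rewrite ?orbT.
    rewrite in_cons => /orP[/eqP ac|//].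
    move: (Wuniq W1); rewrite -ac !cat_uniq => /and3P[_ _ /andP[_ /andP[/hasPn/(_ a)]]].
    by rewrite mem_head => /(_ isT); rewrite aA.
  have := vl a c; rewrite E !mem_cat !in_cons av2 eqxx !orbT => /(_ isT isT (bf _ aA)).
  move: uv; rewrite E cat_uniq => /and3P[_ /hasPn nv1 /= /andP[cv2 _]].
  have nav1 : a \notin v1 by apply: nv1; rewrite in_cons av2 orbT.
  have ncv1 : c \notin v1 by apply: nv1; rewrite mem_head.
  rewrite !index_cat (negbTE nav1) (negbTE ncv1) leq_add2l /= eqxx.
  case: eqP => [ca|_]; first by move: cv2; rewrite ca av2.
  by rewrite ltn0.
apply: (IH (rcons v1 c) (p ++ rcons A c) B).
- by rewrite cat_rcons.
- by rewrite filter_cat filter_rcons vc nA pv /= cats1.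
- by rewrite -catA cat_rcons.
- apply: perm_trans psS; apply/permP => q; move/permP/(_ q): AB.
  by rewrite -cats1 !count_cat /=; lia.
- rewrite -(perm_cons c); apply: perm_trans sv; apply/permP => q.
  move/permP/(_ q): (perm_filter vs AB); rewrite !filter_cat nA /= vc !count_cat /=; lia.
Qed.

End Lin.

Lemma index_filter_le (T : eqType) (p : pred T) (w : seq T) a b : p a -> p b -> b \in w ->
  (index a (filter p w) <= index b (filter p w)) = (index a w <= index b w).
Proof.
move=> pa pb; elim: w => //= x w IH; rewrite in_cons.
case: (x =P a) => [->|/eqP xa]; first by rewrite pa /= eqxx.
case: (x =P b) => [xb|/eqP xb] /=; first by rewrite -xb in pb *; rewrite pb /= eqxx (negbTE xa).
rewrite eq_sym (negbTE xb) /= => bw; rewrite ltnS -IH //.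
by case: (p x) => //=; rewrite (negbTE xa) (negbTE xb) ltnS.
Qed.

Lemma filter_visw w : filter (predC isI) w = map inl (visw w).
Proof. by elim: w => //= -[i|i] w IH /=; rewrite ?IH. Qed.

(** * The trace of a prerun *)

Section Ex.
Variable K : comPzSemiRingType.
Implicit Types (P Q R : term K) (w S : seq lab).

(** A binder lies strictly above the use of its object; this makes the source of an event strictly
    smaller than the event. *)
Lemma info_prefix P i k e : info P i = Some (inr k, e) -> prefix k i && (k != i).
Proof.
have H1 c o (j : pos) k' e' : (forall k e, o = Some (inr k, e) -> prefix k j && (k != j)) ->
    mapn (nLift c) o = Some (inr k', e') -> prefix k' (c :: j) && (k' != c :: j).
  case: o => [[[n|k0] e0]|] //= IH [<- _].
  by rewrite ?prefix_cons eqseq_cons ?eqxx /=; exact: IH.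
elim: P i k e => [k0|s e0 Q IH|Q IH|Q IHQ R IHR|Q IHQ R IHR|Q IH] i k e //=.
- case: i => [|[|[|c]] i] //=; case E: (info Q i) => [[[[|n]|k'] e']|] //= [<- _] //.
  by rewrite ?prefix_cons eqseq_cons ?eqxx /=; exact: IH E.
- by case: i => [|[|[|c]] i] //=; apply: H1 => *; apply: IH; eauto.
- by case: i => [|[|[|[|c]]] i] //=; apply: H1 => *; [apply: IHQ|apply: IHR]; eauto.
- by case: i => [|[|[|[|c]]] i] //=; apply: H1 => *; [apply: IHQ|apply: IHR]; eauto.
- by case E: (info Q i) => [[[[|n]|k'] e']|] //= [<- _]; exact: IH E.
Qed.

Lemma ex_dep P w a b : ex P w -> a \in w -> b \in w -> dep a b -> index a w <= index b w.
Proof.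
move=> /ex_pw; elim: w => //= x w IH; rewrite pw_cons => /andP[/allP h pww].
rewrite !in_cons; case: (x =P a) => [->|/eqP xa] //=; rewrite eq_sym (negbTE xa) /= => aw.
case: (x =P b) => [xb|/eqP xb]; first by move: (h _ aw); rewrite xb => /negbTE->.
by rewrite eq_sym (negbTE xb) /= => bw ab; rewrite ltnS IH.
Qed.

Section Build.
Variables (P : term K) (S : seq lab).
Hypothesis SP : S \in pres P.

Let C := visw S.
Let n := size C.
Let h (a : 'I_n) : pos := nth [::] C a.
Let ord (k : pos) : option 'I_n := insub (index k C).

Lemma word0 : exists2 w, perm_eq w S & ex P w.
Proof. by case/presP: SP => w [exw _ ->]; exists w => //; rewrite perm_sym perm_canon. Qed.

Lemma S_uniq : uniq S.
Proof. by have [w wS exw] := word0; rewrite -(perm_uniq wS); exact: ex_uniq exw. Qed.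

Lemma C_uniq : uniq C.
Proof.
have : uniq (map (inl : pos -> lab) C) by rewrite -filter_visw filter_uniq // S_uniq.
exact: map_uniq.
Qed.

Lemma h_inj : injective h.
Proof. by move=> a b /eqP; rewrite nth_uniq ?C_uniq // => /eqP/val_inj. Qed.

Lemma h_mem a : h a \in C. Proof. exact: mem_nth. Qed.

Lemma ord_h a : ord (h a) = Some a.
Proof. by rewrite /ord index_uniq ?C_uniq //; exact: valK. Qed.

Lemma ordP k : k \in C -> exists2 a, ord k = Some a & k = h a.
Proof.
move=> kC; have kn : index k C < n by rewrite index_mem.
by exists (Ordinal kn); rewrite ?/ord ?insubT // /h /= nth_index.
Qed.

Lemma ord_some k a : ord k = Some a -> k = h a.
Proof.
rewrite /ord /h; case: insubP => // b kn bE [<-]; rewrite bE nth_index //.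
by rewrite -index_mem.
Qed.

Lemma h_enum : map h (enum 'I_n) = C.
Proof. by rewrite (map_comp (nth [::] C) val) val_enum_ord map_nth_iota0 // take_size. Qed.

(** The values [inl 0] only make the function total: by [bsrcP] the subject of a visible step is
    free or bound by another visible step. *)
Definition bsrc (a : 'I_n) : (nat + 'I_n)%type :=
  match info P (h a) with
  | Some (inl u, _) => inl u
  | Some (inr k, _) => if ord k is Some b then inr b else inl 0
  | None => inl 0
  end.
Definition bpol (a : 'I_n) : bool := if info P (h a) is Some (_, e) then e else true.
Definition ble : rel 'I_n := fun a b => `[< before (ex P) S (V (h a)) (V (h b)) >].

Lemma ble_refl : reflexive ble. Proof. by move=> a; apply/asboolP => u _ _. Qed.
Lemma ble_anti : antisymmetric ble.
Proof.
move=> a b /andP[/asboolP ab /asboolP ba]; have [w wS exw] := word0.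
have E : index (V (h a)) w = index (V (h b)) w by apply/eqP; rewrite eqn_leq ab ?ba.
have aw : V (h a) \in w by rewrite (perm_mem wS) -mem_visw h_mem.
have := nth_index (V [::]) aw; rewrite E nth_index; last first.
  by rewrite (perm_mem wS) -mem_visw h_mem.
by case=> /h_inj.
Qed.
Lemma ble_trans : transitive ble.
Proof. by move=> b a c /asboolP ab /asboolP bc; apply/asboolP; exact: before_trans bc. Qed.

Lemma bsrcP a : exists2 x, info P (h a) = Some (x, bpol a) &
  match x with inl u => bsrc a = inl u | inr k => exists2 b, k = h b & bsrc a = inr b end.
Proof.
have [w wS exw] := word0.
have aw : V (h a) \in w by rewrite (perm_mem wS) -mem_visw h_mem.
have := ex_visok exw aw; rewrite /bpol /bsrc.
case: (info P (h a)) => [[[u|k] e]|] //=; first by exists (inl u).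
rewrite (perm_mem wS) -mem_visw => /ordP[b E1 E2]; exists (inr k) => //; exists b => //.
by rewrite E1.
Qed.

Lemma bsrc_lt a b : bsrc b = inr a -> (a != b) && ble a b.
Proof.
have [[u|k] E] := bsrcP b; first by move=> ->.
case=> c kc -> [ca]; subst c; move: (info_prefix E); rewrite kc => /andP[pab nab].
apply/andP; split; first by apply: contra nab => /eqP->.
apply/asboolP; apply: (dep_before (dp := dep)).
- by move=> u a' b' exu au bu ab'; exact: (ex_dep exu).
- by rewrite -mem_visw h_mem.
- by rewrite -mem_visw h_mem.
- by apply/depP; exists (h a), (h b); rewrite !inE !eqxx.
Qed.

(** A bound subject whose binder is not a visible step of [S] is private, and the action is
    dropped. *)
Definition bname (i : pos) : option (bool * (nat + 'I_n)) :=
  match info P i with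
  | Some (inl u, e) => Some (e, inl u)
  | Some (inr k, e) => if ord k is Some b then Some (e, inr b) else None
  | None => None
  end.
Definition btrace : trace := Trace bpol ble_refl ble_anti ble_trans bsrc_lt (undup_uniq (pmap bname (actv P S))).

(** Soundness is the definition of [before]; completeness is [lin_word] applied to the visible
    labels, with [ex_swap] as commutation. *)
Lemma btrace_realizes : realizesT P S btrace.
Proof.
exists h; split; rewrite /=.
- exact: enum_uniq.
- by move=> a b _ _; exact: h_inj.
- by rewrite h_enum.
- move=> a _; have [x E xE] := bsrcP a; exists x => //.
  by case: x E xE => [u|k] _ //= [b -> ->]; exists b; rewrite ?mem_enum.
- move=> w wS exw; pose v := pmap ord (visw w).
  have wC : perm_eq (visw w) C by exact: visw_perm.
  have vE : map h v = visw w.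
    rewrite /v; have : {subset visw w <= C} by move=> i; rewrite (perm_mem wC).
    elim: (visw w) => //= i t IH sub; have [|a -> ->] := ordP (k := i); first by apply: sub; rewrite mem_head.
    by rewrite /= IH // => j jt; apply: sub; rewrite in_cons jt orbT.
  exists v; split=> //.
    by apply: (perm_map_inj h_inj); rewrite vE h_enum.
  move=> a b av bv /asboolP/(_ w exw wS).
  rewrite -(index_filter_le (p := predC isI)) // ?filter_visw ?inE //; last first.
    by rewrite -mem_visw -vE map_f.
  rewrite -vE -map_comp.
  by rewrite !(index_map (f := (inl : pos -> lab) \o h)) // => x y /= [/h_inj].
- move=> v vE vl.
  have [w wS exw] := word0.
  have [|||||w' [exw' w'S fw]] := @lin_word _ dep (ex P) _ _ _ S (predC isI) w (map (inl \o h) v) exw wS.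
  + by move=> u a b t exu ab; exact: ex_swap.
  + by move=> u /ex_uniq.
  + by move=> u a b exu au bu ab; exact: ex_dep exu au bu ab.
  + rewrite filter_visw map_comp; apply: perm_map; rewrite -/C -h_enum; exact: perm_map.
  + move=> a b /mapP[a' av ->] /mapP[b' bv ->] bf.
    have hi : injective ((inl : pos -> lab) \o h) by move=> x y /= [/h_inj].
    rewrite !(index_map hi).
    by apply: vl => //; exact/asboolP.
  exists w'; split=> //; apply: (inj_map (f := (inl : pos -> lab))); first by move=> x y [].
  by rewrite -filter_visw fw map_comp.
- move=> e g; rewrite mem_undup mem_pmap; split.
    case/mapP => i ia; rewrite /bname; case E: (info P i) => [[[u|k] e']|] //.
      by case=> -> ->; exists i, (inl u).
    case Ek: (ord k) => [b|] // [-> ->]; exists i, (inr k); split=> //=.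
    by exists b; rewrite ?mem_enum //; split=> //; exact: ord_some.
  case=> i [x [ia E rx]]; apply/mapP; exists i => //; rewrite /bname E.
  by case: x E rx => [u|k] E /=; [move=> <-|case=> b _ [-> ->]; rewrite ord_h].
Qed.
End Build.

(** The empty trace, used as the value of [trace_of] outside [pres P] and as the first trace of the
    final combination. *)
Definition trace0 : trace.
Proof.
refine (@Trace 0 (fun=> true) (fun=> inl 0) (fun _ _ => true) _ _ _ _ [::] isT) => //.
by case.
Defined.

Lemma trace_of P : exists tr : seq lab -> trace, forall S, S \in pres P -> realizesT P S (tr S).
Proof.
have h S : exists T, S \in pres P -> realizesT P S T.
  by case: (boolP (S \in pres P)) => [SP|_]; [exists (btrace SP) => _; exact: btrace_realizes|exists trace0].
by have [tr trP] := choice h; exists tr.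
Qed.

Lemma decomposes_pres P tr : (forall U, U \in pres P -> realizesT P U (tr U)) ->
  decomposes P [seq (value P U, tr U) | U <- pres P].
Proof.
move=> trP; apply: (decomposition (Sf := id)).
- by move=> U UP; rewrite (pres_canon UP); split=> //; exact: trP.
- rewrite map_inj_in_uniq ?pres_uniq // => a b /pres_canon -> /pres_canon -> //.
- by move=> U UP _; apply/mapP; exists U => //; rewrite (pres_canon UP).
Qed.

Lemma decomposes_trace P : exists D, decomposes P D.
Proof. by have [tr /decomposes_pres D] := trace_of P; eexists; exact: D. Qed.
End Ex.

(** * Scalar multiples and sums *)

Definition glab (g : pos -> pos) (l : lab) : lab :=
  match l with inl i => V (g i) | inr (i, j) => I (g i) (g j) end.
Definition nMap (g : pos -> pos) (n : nam) : option nam :=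
  Some (match n with inl n => inl n | inr k => inr (g k) end).

Lemma glab_e1 : glab (cons 1) =1 lab_e1. Proof. by case=> // -[]. Qed.
Lemma glab_e2 : glab (cons 2) =1 lab_e2. Proof. by case=> // -[]. Qed.
Lemma mapn_some f n n' e : f n = Some n' -> mapn f (Some (n, e)) = Some (n', e).
Proof. by move=> /= ->. Qed.

Section Embed.
Variable K : comPzSemiRingType.
Implicit Types (P Q R O A B : term K) (w S : seq lab).

Lemma ex_Par1 A B w : ex (Par A B) (map lab_e1 w) = ex A w.
Proof.
rewrite /= p1_e1 p2_e1 ex_nil (in12_inP (in12_map1 w)) /=.
case: (boolP (ex A w)) => //= exA; apply/allP => l /mapP[[i|[i j]] lw -> //] /=.
have := ex_visok exA lw; case: (info A i) => [[[n|k] e]|] //=.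
by rewrite (mem_map lab_e1_inj w (V k)).
Qed.

Lemma ex_Par2 A B w : ex (Par A B) (map lab_e2 w) = ex B w.
Proof.
rewrite /= p1_e2 p2_e2 ex_nil (in12_inP (in12_map2 w)) /=.
case: (boolP (ex B w)) => //= exA; apply/allP => l /mapP[[i|[i j]] lw -> //] /=.
have := ex_visok exA lw; case: (info B i) => [[[n|k] e]|] //=.
by rewrite (mem_map lab_e2_inj w (V k)).
Qed.

Lemma ex_Dia A w : ex (Dia A) (map lab_e1 w) = ex A w.
Proof. by rewrite /= p1_e1 in1_map. Qed.

(* After the internal steps pre, O behaves as P relocated along g, up to a
   factor c and to active actions whose subject is private. *)
Record embeds P O (g : pos -> pos) (pre : seq lab) (c : K) : Prop := {
  em_inj : injective g;
  em_pre : all isI pre;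
  em_ex : forall w, ex P w -> ex O (pre ++ map (glab g) w);
  em_imax : forall w, ex P w -> imax O (pre ++ map (glab g) w) = imax P w;
  em_value : forall w, value O (pre ++ map (glab g) w) = (c * value P w)%R;
  em_info : forall i, info O (g i) = mapn (nMap g) (info P i);
  em_actv1 : forall w i, i \in actv P w -> g i \in actv O (pre ++ map (glab g) w);
  em_actv2 : forall w i, i \in actv O (pre ++ map (glab g) w) ->
     info O i = None \/ exists2 i', i = g i' & i' \in actv P w;
  em_compl : forall w S, ex O w -> perm_eq w (pre ++ map (glab g) S) ->
     exists2 w', w = pre ++ map (glab g) w' & ex P w'
}.

Lemma glab_inj g : injective g -> injective (glab g).
Proof. by move=> gi [i|[i i']] [j|[j j']] //= [] /gi -> => [|/gi ->]. Qed.

Lemma visw_glab g w : visw (map (glab g) w) = map g (visw w).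
Proof. by elim: w => //= -[i|[i j]] w IH /=; rewrite /visw /= in IH *; rewrite IH. Qed.

Lemma visw_I w : all isI w -> visw w = [::].
Proof. by elim: w => // -[i|i] w IH. Qed.

(** The events stay the same and only their places change, from [h] to [g \o h]. The further active
    actions of [O] have no [info], so they add nothing to the residual actions. *)
Lemma embeds_realizes P O g pre c S (T : trace) : embeds P O g pre c ->
  realizesT P S T -> realizesT O (pre ++ map (glab g) S) T.
Proof.
move=> em [h rz]; exists (g \o h); have gi := em_inj em; have pI := visw_I (em_pre em).
have rnE n x : rn inl (enum 'I_(tn T)) h n x ->
   exists2 n', nMap g n = Some n' & rn inl (enum 'I_(tn T)) (g \o h) n' x.
  case: n => [u <-|k [b bE [-> ->]]]; first by exists (inl u).
  by exists (inr (g (h b))) => //; exists b.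
split.
- exact: rz_uniq rz.
- by move=> a b ae be /gi; exact: (rz_inj rz).
- rewrite visw_cat pI visw_glab map_comp; apply: perm_map; exact: rz_vis rz.
- move=> a ae; have [n nE /rnE[n' n'E rn']] := rz_info rz ae; exists n' => //.
  by rewrite /= (em_info em) nE (mapn_some _ n'E).
- move=> w wS exw; have [w' wE exw'] := em_compl em exw wS; subst w.
  have w'S : perm_eq w' S by move: wS; rewrite perm_cat2l => /(perm_map_inj (glab_inj gi)).
  have [v [vE ww vl]] := rz_sound rz w'S exw'; exists v; split=> //.
  by rewrite visw_cat pI visw_glab ww map_comp.
- move=> v vE vl; have [w [wS exw ww]] := rz_compl rz vE vl.
  exists (pre ++ map (glab g) w); split; last by rewrite visw_cat pI visw_glab ww map_comp.
    by rewrite perm_cat2l; exact: perm_map.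
  exact: em_ex em _ exw.
- move=> e x; split=> [/(rz_N rz)[i [n [ia nE /rnE[n' n'E rn']]]]|].
    exists (g i), n'; split=> //; first exact: (em_actv1 em).
    by rewrite (em_info em) nE (mapn_some _ n'E).
  case=> i [n' [/(em_actv2 em)[->//|[i' -> ia]]]]; rewrite (em_info em).
  case E: (info P i') => [[n e']|] //= [nE ? rn']; subst e'.
  apply/(rz_N rz); exists i', n; split=> //.
  case: n E nE => [u|k] E nE; subst n' => //.
  by case: rn' => b be [/gi ? ->]; exists b.
Qed.

Lemma kdot_embeds k P : embeds P (kdot k P) (cons 2) [::] k.
Proof.
rewrite /kdot; split=> //.
- by move=> i j [].
- by move=> w exw; rewrite cat0s (eq_map glab_e2) ex_Par2.
- by move=> w exw; rewrite cat0s (eq_map glab_e2) /= ?p1_e2 p2_e2 /= andbT.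
- by move=> w; rewrite cat0s (eq_map glab_e2) /= p2_e2.
- by move=> w i ia; rewrite cat0s (eq_map glab_e2) /= p2_e2 map_f.
- by move=> w i; rewrite cat0s (eq_map glab_e2) /= p2_e2 => /mapP[j ja ->]; right; exists j.
- move=> w S /= /and4P[wP /eqP w1 exw _] _; exists (p2 w) => //.
  by rewrite (eq_map glab_e2); exact: p1_nil.
Qed.

End Embed.

(** * Internal choice *)

Section Oplus.
Variable K : comPzSemiRingType.
Implicit Types (P Q R O A B M N : term K) (w S : seq lab).

Lemma nocomm0 A B w (a : seq pos) : nocomm A B w a [::] = true.
Proof. by apply/allP. Qed.

Lemma nmatch_inl_r w o s e : nmatch w o (Some (inl s, e)) -> o = Some (inl s, ~~ e).
Proof. by case: o => [[[n|k] e']|] //=; rewrite ?andbF // => /andP[/eqP-> /eqP->]; rewrite negbK. Qed.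
Lemma nmatch_inl_l w o s e : nmatch w (Some (inl s, e)) o -> o = Some (inl s, ~~ e).
Proof. by case: o => [[[n|k] e']|] //=; rewrite ?andbF // => /andP[/eqP-> /eqP->]. Qed.

(** Concerns the summand that was not chosen: nothing in [A] can synchronise with its subject, so it
    could fire only visibly. *)
Lemma dead_r A s e N w : ex (Par A (Act s e N)) w -> V [:: 2] \notin w ->
  (forall i, info A i != Some (inl s, ~~ e)) -> p2 w = [::].
Proof.
move=> /= /and4P[wP _ + /allP nc] nV nA; case E: (p2 w) => [//|l u] /and3P[/eqP El _ _].
have : V [::] \in p2 w by rewrite E El mem_head.
rewrite mem_p2V // (negbTE nV) /= => /hasP[[//|[[|[|[|c]] i] j]]] // lw /eqP ?; subst j.
have Ai : nmatch w (info A i) (Some (inl s, e)) := nc _ lw.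
by case/eqP: (nA i); exact: nmatch_inl_r Ai.
Qed.

Lemma dead_l A s e N w : ex (Par (Act s e N) A) w -> V [:: 1] \notin w ->
  (forall i, info A i != Some (inl s, ~~ e)) -> p1 w = [::].
Proof.
move=> /= /and4P[wP + _ /allP nc] nV nA; case E: (p1 w) => [//|l u] /and3P[/eqP El _ _].
have : V [::] \in p1 w by rewrite E El mem_head.
rewrite mem_p1V // (negbTE nV) /= => /hasP[[//|[i [|[|[|[|c]]] j]]]] // lw /eqP ?; subst i.
have Ai : nmatch w (Some (inl s, e)) (info A j) := nc _ lw.
by case/eqP: (nA j); exact: nmatch_inl_l Ai.
Qed.

Lemma ex_DiaConst k w : ex (Dia (Const k : term K)) w -> w = [::].
Proof. by move=> /= /andP[/in1_map_p1 wE /eqP w1]; rewrite wE w1. Qed.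

(** Path to [P] in [oplus P Q]: left twice, then below the prefix. It is also the path to the body
    of [lin]: left, below the prefix, left. The path to [Q] is [g12]. *)
Definition gL (i : pos) : pos := [:: 1, 1, 1 & i].
Lemma map_gL w : map (glab gL) w = map lab_e1 (map lab_e1 (map lab_e1 w)).
Proof. by rewrite -!map_comp; apply: eq_map => -[i|[i j]]. Qed.
Lemma gL_inj : injective gL. Proof. by move=> i j []. Qed.

Definition g12 (i : pos) : pos := [:: 1, 2, 1 & i].
Lemma map_g12 w : map (glab g12) w = map lab_e1 (map lab_e2 (map lab_e1 w)).
Proof. by rewrite -!map_comp; apply: eq_map => -[i|[i j]]. Qed.

Variables P Q : term K.
Let P2 := ren (fun i => i.+2) P.
Let Q2 := ren (fun i => i.+2) Q.
Let A1 : term K := Act 0 true P2.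
Let A2 : term K := Act 0 true Q2.
Let L1 := Par (Dia P2) (ren S A2).
Let L2 := Par (ren S A1) (Dia Q2).
Let O1 := Nu (Nu (Par L1 (Dia (Const 1%R)))).
Let O2 := Nu (Nu (Par L2 (Dia (Const 1%R)))).

Lemma addn2_inj : injective (fun i => i.+2). Proof. by move=> a b []. Qed.

Lemma int_oplus : int (oplus P Q) = [:: ([:: 1; 1], [:: 2], O1); ([:: 1; 2], [:: 2], O2)].
Proof. by []. Qed.
Lemma int_O1 : ([:: 1; 1], [:: 2], O1) \in int (oplus P Q).
Proof. by rewrite int_oplus mem_head. Qed.
Lemma int_O2 : ([:: 1; 2], [:: 2], O2) \in int (oplus P Q).
Proof. by rewrite int_oplus in_cons mem_head orbT. Qed.

Lemma info_DiaP2 i n e : info (Dia P2) i = Some (inl n, e) -> 1 < n.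
Proof.
by case: i => [|[|[|c]] i] //=; rewrite info_ren; case: (info P i) => [[[m|k] b]|] //= [<-].
Qed.
Lemma info_DiaQ2 i n e : info (Dia Q2) i = Some (inl n, e) -> 1 < n.
Proof.
by case: i => [|[|[|c]] i] //=; rewrite info_ren; case: (info Q i) => [[[m|k] b]|] //= [<-].
Qed.

Lemma O1_ex w : ex P w -> ex O1 (map (glab gL) w).
Proof.
move=> exP; rewrite map_gL /O1; rewrite [ex _ _]/= -/(ex (Par L1 _) _) ex_Par1 /L1 ex_Par1 ex_Dia.
rewrite ex_ren; last exact: addn2_inj.
rewrite exP -!all_predI /=; apply/allP => l /mapP[l1 /mapP[l2 /mapP[[i|[i j]] _ ->] ->] ->] //=.
by rewrite info_ren; case: (info P i) => [[[n|k] e]|].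
Qed.

Lemma O2_ex w : ex Q w -> ex O2 (map (glab g12) w).
Proof.
move=> exP; rewrite map_g12 /O2; rewrite [ex _ _]/= -/(ex (Par L2 _) _) ex_Par1 /L2 ex_Par2 ex_Dia.
rewrite ex_ren; last exact: addn2_inj.
rewrite exP -!all_predI /=; apply/allP => l /mapP[l1 /mapP[l2 /mapP[[i|[i j]] _ ->] ->] ->] //=.
by rewrite info_ren; case: (info Q i) => [[[n|k] e]|].
Qed.

(** The discarded summand has the restricted name of the choice as subject and no partner left, and
    the consumed [Const 1] has no action. All labels thus lie in the copy of [P]. *)
Lemma O1_compl w : ex O1 w -> exists2 w', w = map (glab gL) w' & ex P w'.
Proof.
move=> /andP[/andP[exw _]] /allP nf.
have [wP exL1] : all inP w /\ ex L1 (p1 w) by case/and4P: exw.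
have w2 : p2 w = [::] by case/and4P: exw => _ _ h _; exact: (@ex_DiaConst 1%R _ h).
have wE := p2_nil wP w2.
have w12 : p2 (p1 w) = [::].
  apply: dead_r exL1 _ _.
    apply/negP => h; have := nf (V [:: 1; 2]); rewrite wE mapV_e1 => /(_ h).
    by [].
  by move=> i; apply/eqP => /info_DiaP2.
have w1P : all inP (p1 w) by case/and4P: exL1.
have w1E := p2_nil w1P w12.
have /andP[w11 exP2] : ex (Dia P2) (p1 (p1 w)) by case/and4P: exL1.
exists (p1 (p1 (p1 w))); first by rewrite map_gL -(in1_map_p1 w11) -w1E.
by rewrite -(ex_ren P _ addn2_inj).
Qed.

Lemma O2_compl w : ex O2 w -> exists2 w', w = map (glab g12) w' & ex Q w'.
Proof.
move=> /andP[/andP[exw _]] /allP nf.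
have [wP exL2] : all inP w /\ ex L2 (p1 w) by case/and4P: exw.
have w2 : p2 w = [::] by case/and4P: exw => _ _ h _; exact: (@ex_DiaConst 1%R _ h).
have wE := p2_nil wP w2.
have w11 : p1 (p1 w) = [::].
  apply: dead_l exL2 _ _.
    apply/negP => h; have := nf (V [:: 1; 1]); rewrite wE mapV_e1 => /(_ h).
    by [].
  by move=> i; apply/eqP => /info_DiaQ2.
have w1P : all inP (p1 w) by case/and4P: exL2.
have w1E := p1_nil w1P w11.
have /andP[w12 exQ2] : ex (Dia Q2) (p2 (p1 w)) by case/and4P: exL2.
exists (p1 (p2 (p1 w))); first by rewrite map_g12 -(in1_map_p1 w12) -w1E.
by rewrite -(ex_ren Q _ addn2_inj).
Qed.

Lemma oplus_embeds1 : embeds P (oplus P Q) gL [:: I [:: 1; 1] [:: 2]] 1%R.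
Proof.
split=> //.
- by move=> i j [].
- by move=> w exw; rewrite cat1s (int_ex int_O1) O1_ex.
- move=> w exw; rewrite cat1s (int_imax int_O1) ?O1_ex // map_gL /= ?pE /= ?pE.
  rewrite imax_ren; last exact: addn2_inj.
  rewrite nocomm0 andbT; case: (imax P w) => //=.
  by apply/allP => i _; rewrite /= andbT; apply/negP => /nmatch_inl_r/info_DiaP2.
- move=> w; rewrite cat1s (int_val int_O1) map_gL /= ?pE /= ?pE val_ren.
  by rewrite !GRing.mulr1 GRing.mul1r.
- move=> i /=; rewrite info_ren !mapn_comp; apply: eq_mapn => -[n|k] //.
- move=> w i ia; rewrite cat1s (int_actv int_O1) map_gL /= ?pE /= ?pE actv_ren.
  by rewrite cats0; apply: map_f; rewrite mem_cat; apply/orP; left; do 2! apply: map_f.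
- move=> w i; rewrite cat1s (int_actv int_O1) map_gL /= ?pE /= ?pE actv_ren cats0.
  case/mapP => j; rewrite mem_cat inE => /orP[/mapP[j' /mapP[i' ia ->] ->] ->|/eqP-> ->].
    by right; exists i'.
  by left.
- move=> w U exw /perm_mem wE.
  have : I [:: 1; 1] [:: 2] \in w by rewrite wE mem_head.
  (* The sum can start only with one of its two choices, and the label of the other choice does not
     occur in [w]. *)
  case: w exw wE => // -[i|[i j]] w exw wE.
    by have [s [e [P' ]]] := ex_V exw.
  have [P' ] := ex_I exw; rewrite int_oplus !inE => /orP[]/eqP[? ? ?]; subst; move: exw.
    by rewrite (int_ex int_O1) => /O1_compl[w' -> exw'] _; exists w'.
  by have := wE (I [:: 1; 2] [:: 2]); rewrite mem_head inE /= => /esym/mapP[[//|[a b]] _ [] ].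
Qed.

Lemma oplus_embeds2 : embeds Q (oplus P Q) g12 [:: I [:: 1; 2] [:: 2]] 1%R.
Proof.
split=> //.
- by move=> i j [].
- by move=> w exw; rewrite cat1s (int_ex int_O2) O2_ex.
- move=> w exw; rewrite cat1s (int_imax int_O2) ?O2_ex // map_g12 /= ?pE /= ?pE.
  rewrite imax_ren; last exact: addn2_inj.
  rewrite nocomm0 andbT; case: (imax Q w) => //=.
  rewrite /nocomm [all _ _]/= andbT; apply/allP => i _; apply/negP => h.
  have H : info (Dia Q2) i = Some (inl 1, ~~ true) := @nmatch_inl_l w (info (Dia Q2) i) 1 true h.
  by have := info_DiaQ2 H.
- move=> w; rewrite cat1s (int_val int_O2) map_g12 /= ?pE /= ?pE val_ren.
  by rewrite !GRing.mulr1 GRing.mul1r.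
- move=> i /=; rewrite info_ren !mapn_comp; apply: eq_mapn => -[n|k] //.
- move=> w i ia; rewrite cat1s (int_actv int_O2) map_g12 /= ?pE /= ?pE actv_ren.
  by rewrite cats0; rewrite in_cons; apply/orP; right; do 3! apply: map_f.
- move=> w i; rewrite cat1s (int_actv int_O2) map_g12 /= ?pE /= ?pE actv_ren cats0.
  rewrite in_cons => /orP[/eqP->|/mapP[j /mapP[j' /mapP[i' ia ->] ->] ->]]; first by left.
  by right; exists i'.
- move=> w U exw /perm_mem wE.
  have : I [:: 1; 2] [:: 2] \in w by rewrite wE mem_head.
  case: w exw wE => // -[i|[i j]] w exw wE.
    by have [s [e [P' ]]] := ex_V exw.
  have [P' ] := ex_I exw; rewrite int_oplus !inE => /orP[]/eqP[? ? ?]; subst; move: exw.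
    by have := wE (I [:: 1; 1] [:: 2]); rewrite mem_head inE /= => /esym/mapP[[//|[a b]] _ [] ].
  by rewrite (int_ex int_O2) => /O2_compl[w' -> exw'] _; exists w'.
Qed.

Lemma oplus_cases w : ex (oplus P Q) w -> imax (oplus P Q) w ->
  (exists2 w', w = [:: I [:: 1; 1] [:: 2]] ++ map (glab gL) w' & ex P w') \/
  (exists2 w', w = [:: I [:: 1; 2] [:: 2]] ++ map (glab g12) w' & ex Q w').
Proof.
case: w => [_ /imax0_int//|[i|[i j]] w exw _].
  by have [s [e [P' ]]] := ex_V exw.
have [P' ] := ex_I exw; rewrite int_oplus !inE => /orP[]/eqP[? ? ?]; subst; move: exw.
  by rewrite (int_ex int_O1) => /O1_compl[w' -> exw']; left; exists w'.
by rewrite (int_ex int_O2) => /O2_compl[w' -> exw']; right; exists w'.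
Qed.

End Oplus.

(** * Terms with a unique nonzero prerun *)

Lemma perm_map_ex (A B : eqType) (h : A -> B) s t : perm_eq s (map h t) ->
  exists2 v, s = map h v & perm_eq v t.
Proof.
elim: s t => [|x s IH] t st.
  by exists [::] => //; move: st => /perm_size; rewrite size_map /=; case: t.
have : x \in map h t by rewrite -(perm_mem st) mem_head.
case/mapP => a at' xE; subst x; case/splitPr: at' st => t1 t2 st.
have /IH[v -> vt] : perm_eq s (map h (t1 ++ t2)).
  rewrite -(perm_cons (h a)); apply: perm_trans st _.
  by rewrite !map_cat /= -cat1s perm_catCA.
exists (a :: v) => //; rewrite -cat1s perm_sym -cat1s perm_catCA perm_cat2l perm_sym.
exact: vt.
Qed.

Lemma word_split12 w : all in12 w -> perm_eq w (map lab_e1 (p1 w) ++ map lab_e2 (p2 w)).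
Proof.
elim: w => //= l w IH /andP[]; rewrite p1_cons p2_cons.
case/orP => [/in1P|/in2P] [l' ->] /IH IHw; rewrite ?labE /=; first by rewrite perm_cons.
by rewrite perm_sym -cat1s perm_catCA perm_cons perm_sym.
Qed.

Definition st1 (i : pos) : option pos := if i is 1 :: i then Some i else None.
Definition st2 (i : pos) : option pos := if i is 2 :: i then Some i else None.
Lemma visw_p1 w : all in12 w -> visw (p1 w) = pmap st1 (visw w).
Proof.
elim: w => //= l w IH /andP[]; rewrite p1_cons.
case/orP => [/in1P|/in2P] [[i|[i j]] ->] /IH /= E; rewrite /visw /= in E *; by rewrite E.
Qed.
Lemma visw_p2 w : all in12 w -> visw (p2 w) = pmap st2 (visw w).
Proof.
elim: w => //= l w IH /andP[]; rewrite p2_cons.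
case/orP => [/in1P|/in2P] [[i|[i j]] ->] /IH /= E; rewrite /visw /= in E *; by rewrite E.
Qed.
Lemma visw_V (t : seq pos) : visw (map inl t) = t.
Proof. by elim: t => //= a t IH; rewrite /visw /= in IH *; rewrite IH. Qed.
Lemma visw_sched w : visw (filter sched w) = visw w.
Proof. by elim: w => // -[i|ij] w IH //=; [rewrite /visw /= in IH *; rewrite IH|case: ifP]. Qed.

Section Den.
Variable K : comPzSemiRingType.
Implicit Types (P Q R : term K) (w S : seq lab).
Variables (E : eqType) (sr : E -> nat + E) (pl : E -> bool) (precS precC : rel E).

(* P has exactly one prerun of nonzero value; it has value 1, visible events ev
   and residual visible actions N. *)
Definition den rho P ev N : Prop := exists S h,
  [/\ ex P S, imax P S, value P S = 1%R,
      realizes sr pl rho P S ev N precS precC h &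
      forall w, ex P w -> imax P w -> value P w != 0%R -> perm_eq w S].

Lemma linext_filter (prec : rel E) p v : linext prec v -> linext prec (filter p v).
Proof.
move=> vl a b; rewrite !mem_filter => /andP[pa av] /andP[pb bv] ab.
by rewrite index_filter_le // vl.
Qed.

Lemma den_const1 rho : den rho (Const 1%R) [::] [::].
Proof.
exists [::], (fun=> [::]); split=> //; last by move=> w /eqP->.
split=> //.
- by move=> w _ /eqP->; exists [::].
- by move=> v /perm_nilP-> _; exists [::].
- by move=> e g; split=> // -[i [n []]].
Qed.

(** Firing the action would leave the state 0, so only the empty prerun counts and the action stays
    active. In this way [{T}] displays an element of [N]. *)
Lemma den_act0 rho u e : den rho (act0 u e (Const 0%R)) [::] [:: (e, rho u)].
Proof.
exists [::], (fun=> [::]); split=> //; last first.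
  move=> [|l w] //= /and3P[/eqP-> _ _] _; by rewrite mem_head eqxx.
split=> //.
- by move=> w /perm_nilP-> _; exists [::].
- by move=> v /perm_nilP-> _; exists [::].
- move=> e' g; rewrite inE; split=> [/eqP[-> ->]|]; first by exists [::], (inl u).
  by case=> i [n [/=]]; rewrite inE => /eqP-> [<- <-] /= ->.
Qed.

Lemma eq_den rho rho' P ev N : rho =1 rho' -> den rho P ev N -> den rho' P ev N.
Proof. by move=> /funext ->. Qed.

Lemma den_ren rho f P ev N : injective f -> den (rho \o f) P ev N -> den rho (ren f P) ev N.
Proof.
move=> fi [S [h [exS imS vS [H1 H2 H3 H4 H5 H6 H7] un]]]; exists S, h.
have rnE n g : rn (rho \o f) ev h n g ->
    exists2 n', nRen f n = Some n' & rn rho ev h n' g.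
  by case: n => [i <-|k kE]; [exists (inl (f i))|exists (inr k)].
split; rewrite ?ex_ren ?imax_ren ?val_ren //; last by move=> w; rewrite ex_ren ?imax_ren ?val_ren //; exact: un.
split=> //.
- move=> a ae; have [n nE /rnE[n' n'E rn']] := H4 a ae; exists n' => //.
  by rewrite info_ren nE (mapn_some _ n'E).
- by move=> w wS; rewrite ex_ren //; exact: H5.
- by move=> v vE vl; have [w [? ? ?]] := H6 v vE vl; exists w; rewrite ex_ren.
- move=> e g; rewrite actv_ren; split=> [/H7[i [n [ia nE /rnE[n' n'E rn']]]]|].
    by exists i, n'; split=> //; rewrite info_ren nE (mapn_some _ n'E).
  case=> i [n' [ia]]; rewrite info_ren; case EE: (info P i) => [[n e']|] //= [nE ? rn']; subst e'.
  by apply/H7; exists i, n; split=> //; case: n EE nE => [u|k] _ nE; subst n'.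
Qed.

(** The operands interleave freely, so [precS] must not relate events across them. [precC] may do
    so, because its linear extensions restrict to each side; keeping two relations allows this
    asymmetry. *)
Lemma den_ppar rho P Q ev1 ev2 N1 N2 :
  den rho P ev1 N1 -> den rho Q ev2 N2 ->
  (forall a, a \in ev1 -> a \notin ev2) ->
  (forall a b, precS a b -> (a \in ev1) && (b \in ev2) || (a \in ev2) && (b \in ev1) -> False) ->
  den rho (PPar P Q) (ev1 ++ ev2) (N1 ++ N2).
Proof.
move=> [S1 [h1 [ex1 im1 v1 R1 un1]]] [S2 [h2 [ex2 im2 v2 R2 un2]]] dj nc.
pose S := map lab_e1 S1 ++ map lab_e2 S2.
pose h a := if a \in ev1 then 1 :: h1 a else 2 :: h2 a.
have hE1 a : a \in ev1 -> h a = 1 :: h1 a by rewrite /h => ->.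
have hE2 a : a \in ev2 -> h a = 2 :: h2 a.
  by rewrite /h => a2; case: ifP => // /dj; rewrite a2.
have S12 : all in12 S by rewrite all_cat in12_map1 in12_map2.
have pS1 : p1 S = S1 by rewrite p1_cat p1_e1 p1_e2 cats0.
have pS2 : p2 S = S2 by rewrite p2_cat p2_e1 p2_e2.
have permS w : all in12 w -> perm_eq (p1 w) S1 -> perm_eq (p2 w) S2 -> perm_eq w S.
  move=> w12 e1 e2; apply: perm_trans (word_split12 w12) _.
  by apply: perm_cat; exact: perm_map.
have rn1 n g : rn rho ev1 h1 n g -> exists2 n', nLift 1 n = Some n' & rn rho (ev1 ++ ev2) h n' g.
  case: n => [i <-|k [b be [-> ->]]]; first by exists (inl i).
  by exists (inr (1 :: h1 b)) => //; exists b; rewrite ?mem_cat ?be ?hE1.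
have rn2 n g : rn rho ev2 h2 n g -> exists2 n', nLift 2 n = Some n' & rn rho (ev1 ++ ev2) h n' g.
  case: n => [i <-|k [b be [-> ->]]]; first by exists (inl i).
  by exists (inr (2 :: h2 b)) => //; exists b; rewrite ?mem_cat ?be ?orbT ?hE2.
have st1h v : {subset v <= ev1 ++ ev2} -> pmap st1 (map h v) = map h1 [seq a <- v | a \in ev1].
  elim: v => //= a v IH sub.
  have sv : {subset v <= ev1 ++ ev2} by move=> b bv; apply: sub; rewrite in_cons bv orbT.
  have := sub a (mem_head _ _); rewrite mem_cat; case: (boolP (a \in ev1)) => [a1 _|a1 /= /hE2 ->] /=.
    by rewrite hE1 //= IH.
  exact: IH.
have st2h v : {subset v <= ev1 ++ ev2} -> pmap st2 (map h v) = map h2 [seq a <- v | a \in ev2].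
  elim: v => //= a v IH sub.
  have sv : {subset v <= ev1 ++ ev2} by move=> b bv; apply: sub; rewrite in_cons bv orbT.
  have := sub a (mem_head _ _); rewrite mem_cat orbC.
  case: (boolP (a \in ev2)) => [a2 _|a2 /= /hE1 ->] /=.
    by rewrite hE2 //= IH.
  exact: IH.
have uev : uniq (ev1 ++ ev2).
  rewrite cat_uniq (rz_uniq R1) (rz_uniq R2) andbT /=.
  by apply/hasPn => a a2; apply/negP => /dj; rewrite a2.
have perm1 v : perm_eq v (ev1 ++ ev2) -> perm_eq [seq a <- v | a \in ev1] ev1.
  move=> vE; apply: uniq_perm; rewrite ?filter_uniq ?(rz_uniq R1) //.
    by rewrite (perm_uniq vE).
  by move=> a; rewrite mem_filter (perm_mem vE) mem_cat; case: (a \in ev1).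
have perm2 v : perm_eq v (ev1 ++ ev2) -> perm_eq [seq a <- v | a \in ev2] ev2.
  move=> vE; apply: uniq_perm; rewrite ?filter_uniq ?(rz_uniq R2) //.
    by rewrite (perm_uniq vE).
  by move=> a; rewrite mem_filter (perm_mem vE) mem_cat orbC; case: (a \in ev2).
have visS : perm_eq (visw S) (map h (ev1 ++ ev2)).
  have -> : visw S = map (cons 1) (visw S1) ++ map (cons 2) (visw S2).
    by rewrite visw_cat -(eq_map glab_e1) -(eq_map glab_e2) !visw_glab.
  rewrite map_cat; apply: perm_cat.
    have -> : map h ev1 = map (cons 1) (map h1 ev1).
      by rewrite -map_comp; apply/eq_in_map => a ae; rewrite hE1.
    by apply: perm_map; exact: (rz_vis R1).
  have -> : map h ev2 = map (cons 2) (map h2 ev2).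
    by rewrite -map_comp; apply/eq_in_map => a ae; rewrite hE2.
  by apply: perm_map; exact: (rz_vis R2).
exists S, h; split.
- by rewrite /= S12 pS1 pS2 ex1.
- by rewrite /= pS1 pS2 im1.
- by rewrite /= pS1 pS2 v1 v2 mulr1.
- split.
  + exact: uev.
  + move=> a b; rewrite !mem_cat => /orP[]ae /orP[]be; rewrite ?(hE1 _ ae) ?(hE2 _ ae) ?(hE1 _ be) ?(hE2 _ be) // => -[].
      exact: (rz_inj R1).
    exact: (rz_inj R2).
  + exact: visS.
  + move=> a; rewrite mem_cat => /orP[]ae.
      have [n nE /rn1[n' n'E rn']] := rz_info R1 ae; exists n' => //.
      by rewrite (hE1 _ ae) /= nE (mapn_some _ n'E).
    have [n nE /rn2[n' n'E rn']] := rz_info R2 ae; exists n' => //.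
    by rewrite (hE2 _ ae) /= nE (mapn_some _ n'E).
  + move=> w wS /= /and3P[w12 exw1 exw2].
    have pw1 : perm_eq (p1 w) S1 by rewrite -pS1; exact: perm_pmap.
    have pw2 : perm_eq (p2 w) S2 by rewrite -pS2; exact: perm_pmap.
    have [t1 [t1E wt1 l1]] := rz_sound R1 pw1 exw1.
    have [t2 [t2E wt2 l2]] := rz_sound R2 pw2 exw2.
    have := perm_trans (visw_perm wS) visS.
    case/perm_map_ex => v wv vE; exists v; split=> //.
    have sub : {subset v <= ev1 ++ ev2} by move=> a; rewrite (perm_mem vE).
    have tv1 : [seq a <- v | a \in ev1] = t1.
      have := visw_p1 w12; rewrite wv st1h // wt1 => /esym.
      apply: (inj_in_map (rz_inj R1)); first by apply/allP => a; rewrite mem_filter => /andP[].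
      by apply/allP => a; rewrite (perm_mem t1E).
    have tv2 : [seq a <- v | a \in ev2] = t2.
      have := visw_p2 w12; rewrite wv st2h // wt2 => /esym.
      apply: (inj_in_map (rz_inj R2)); first by apply/allP => a; rewrite mem_filter => /andP[].
      by apply/allP => a; rewrite (perm_mem t2E).
    move=> a b av bv ab; have := nc _ _ ab.
    have := sub _ av; have := sub _ bv; rewrite !mem_cat => /orP[]be /orP[]ae; rewrite ae be ?orbT //=.
    * move=> _; rewrite -(index_filter_le (p := mem ev1)) //= tv1.
      by apply: l1; rewrite // -tv1 mem_filter ?ae ?be.
    * by move/(_ isT).
    * by move/(_ isT).
    * move=> _; rewrite -(index_filter_le (p := mem ev2)) //= tv2.
      by apply: l2; rewrite // -tv2 mem_filter ?ae ?be.
  + move=> v vE vl; have sub : {subset v <= ev1 ++ ev2} by move=> a; rewrite (perm_mem vE).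
    have [w1 [w1S exw1 ww1]] := rz_compl R1 (perm1 _ vE) (linext_filter vl).
    have [w2 [w2S exw2 ww2]] := rz_compl R2 (perm2 _ vE) (linext_filter vl).
    pose s : seq lab := map inl (map h v).
    have s12 : all in12 s.
      rewrite !all_map; apply/allP => a /sub; rewrite mem_cat => /orP[/hE1|/hE2] /= ->; by [].
    have sS : all sched s by rewrite all_map; apply/allP.
    have [||w [wP pw1 pw2 fw]] := @merge_words w1 w2 s (in12_inP s12) sS.
    * by rewrite visw_p1 // /s visw_V st1h.
    * by rewrite visw_p2 // /s visw_V st2h.
    have w12 : all in12 w.
      apply/allP => l lw; have := allP wP _ lw; rewrite /inP /in12.
      case/or3P => [->//|->|lX]; first by rewrite orbT.
      have : l \in filter sched w by rewrite mem_filter lw andbT; case: (l) lX.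
      by rewrite fw => /mapP[i _ E']; rewrite E' in lX.
    exists w; split.
    * by apply: permS => //; rewrite ?pw1 ?pw2.
    * by rewrite /= w12 pw1 pw2 exw1.
    * by rewrite -visw_sched fw visw_V.
  + move=> e g; rewrite mem_cat; split.
      case/orP => [/(rz_N R1)[i [n [ia nE /rn1[n' n'E rn']]]]|/(rz_N R2)[i [n [ia nE /rn2[n' n'E rn']]]]].
        exists (1 :: i), n'; split=> //=; first by rewrite pS1 mem_cat map_f.
        by rewrite nE (mapn_some _ n'E).
      exists (2 :: i), n'; split=> //=; first by rewrite pS2 mem_cat map_f ?orbT.
      by rewrite nE (mapn_some _ n'E).
    case=> i [n' [/=]]; rewrite mem_cat pS1 pS2 => /orP[]/mapP[j ja ->]; last first.
      case EE: (info Q j) => [[n e']|] //= [nE ? rn']; subst e'; apply/orP; right.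
      apply/(rz_N R2); exists j, n; split=> //; case: n EE nE => [u|k] _ nE; subst n' => //.
      case: rn' => b; rewrite mem_cat => /orP[]be; rewrite ?(hE1 _ be) ?(hE2 _ be) => -[] // [->] ->.
      by exists b.
    case EE: (info P j) => [[n e']|] //= [nE ? rn']; subst e'; apply/orP; left.
    apply/(rz_N R1); exists j, n; split=> //; case: n EE nE => [u|k] _ nE; subst n' => //.
    case: rn' => b; rewrite mem_cat => /orP[]be; rewrite ?(hE1 _ be) ?(hE2 _ be) => -[] // [->] ->.
    by exists b.
- move=> w /= /and3P[w12 exw1 exw2] /andP[imw1 imw2] vw; apply: permS => //.
    by apply: un1 => //; apply: contra vw => /eqP->; rewrite mul0r.
  by apply: un2 => //; apply: contra vw => /eqP->; rewrite mulr0.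
Qed.

End Den.

(** * Linear actions *)

Lemma p2_single w j : all inP w -> p2 w = [:: V j] -> V (2 :: j) \notin w ->
  exists i x y, [/\ w = map lab_e1 x ++ X i j :: map lab_e1 y, p1 w = x ++ V i :: y & X i j \in w].
Proof.
elim: w => //= l w IH /andP[lP wP]; rewrite p1_cons p2_cons in_cons negb_or.
case/inPP: lP => [l'|l'|i j']; rewrite ?labE /=.
- move=> w2 /andP[_ nV]; have [i [x [y [E1 E2 E3]]]] := IH wP w2 nV.
  by exists i, (l' :: x), y; rewrite /= -E1 E2 in_cons E3 orbT.
- by case=> -> _ /andP[/eqP].
- case=> -> w2 _; exists i, [::], (p1 w); split=> //=; last by rewrite mem_head.
  by rewrite -(p2_nil wP w2).
Qed.

Lemma p2_singleV w j : all inP w -> p2 w = [:: V j] -> V (2 :: j) \in w ->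
  exists x y, w = map lab_e1 x ++ V (2 :: j) :: map lab_e1 y /\ p1 w = x ++ y.
Proof.
elim: w => //= l w IH /andP[lP wP]; rewrite p1_cons p2_cons in_cons.
case/inPP: lP => [l'|l'|i j']; rewrite ?labE /=.
- move=> w2; case/orP => [/eqP|h]; first by case: l' => [?|[? ?]] [].
  have [x [y [E1 E2]]] := IH wP w2 h.
  by exists (l' :: x), y; rewrite /= -E1 E2.
- by case=> -> w2 _; exists [::], (p1 w); rewrite /= -(p2_nil wP w2).
- case=> -> w2 /=; rewrite (p2_nil wP w2) => /mapP[l' _]; by case: l' => [?|[? ?]].
Qed.

Section Lin.
Variable K : comPzSemiRingType.
Implicit Types (P Q R : term K) (w S : seq lab).

(** The synchronisation of the [w.1] released by the prefix with the [~w.1] beside it. The killing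
    action [w.0] sits at [[:: 2; 1]]. *)
Definition LX : lab := X [:: 1; 2] [:: 2].

Variables (s : nat) (e : bool) (P : term K).
Let P1 := ren swap01 (ren (up S) P).
Let W1 : term K := Act 0 true (Const 1%R).
Let W0 : term K := Act 0 true (Const 0%R).
Let Wb : term K := Act 0 false (Const 1%R).
Let L1 := Nu (Par (Dia (Par P1 W1)) (Par W0 Wb)).
Let L2 := Nu (Nu (Par (Dia (Par (ren S P1) (Dia (Const 1%R)))) (Par (ren S W0) (Dia (Const 1%R))))).

Lemma vis_lin : vis (lin s e P) = [:: (s, e, [:: 1], L1)].
Proof. by []. Qed.

Let L0 := Nu (Par (Act s.+1 e (Par (ren (up S) P) (Act 1 true (Const 1%R))))
   (Nu (Par (Dia (Const 0%R)) (Dia (Const 1%R))))).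

Lemma int_lin : int (lin s e P) = [:: ([:: 2; 1], [:: 2; 2], L0)].
Proof. by []. Qed.

(** The [swap01] comes from the transition rule for [Nu]; composed with [up S] it acts as the plain
    shift. *)
Lemma info_P1 i : info P1 i = mapn (nRen S) (info P i).
Proof. by rewrite !info_ren mapn_comp; apply: eq_mapn => -[[|[|n]]|k]. Qed.

Lemma ex_P1 w : ex P1 w = ex P w.
Proof.
rewrite ex_ren; last by move=> [|[|a]] [|[|b]].
by rewrite ex_ren //; apply: up_inj; exact: succn_inj.
Qed.

Lemma imax_P1 w : imax P1 w = imax P w.
Proof.
rewrite imax_ren; last by move=> [|[|a]] [|[|b]].
by rewrite imax_ren //; apply: up_inj; exact: succn_inj.
Qed.

Lemma val_P1 w : value P1 w = value P w. Proof. by rewrite !val_ren. Qed.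
Lemma actv_P1 w : actv P1 w = actv P w. Proof. by rewrite !actv_ren. Qed.

Lemma ex_ActConst s' e' k w : ex (Act s' e' (Const k : term K)) w -> w = [::] \/ w = [:: V [::]].
Proof.
case: w => [|l w] /=; first by left.
case/and3P => /eqP-> /in1_map_p1 wE /eqP w1; right; by rewrite wE w1.
Qed.

(** The last hypothesis says that [w.0] has not fired. Maximality then forces [~w.1] to fire, since
    otherwise it could meet [w.0]. As its subject is restricted and absent from the body, its
    partner is the released [w.1]. *)
Lemma L1_words w : ex L1 w -> imax L1 w -> p1 (p2 w) = [::] ->
  exists x y, w = map (glab gL) x ++ LX :: map (glab gL) y /\ ex P (x ++ y).
Proof.
move=> exw imw w0.
have /andP[exM /allP nf] := exw.
have /and4P[wP exD exB /allP nc] := exM.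
have /and3P[imD imB nocm] : imax (Par (Dia (Par P1 W1)) (Par W0 Wb)) w := imw.
have /and4P[uP exW0 exWb _] := exB.
have wb : p2 (p2 w) = [:: V [::]].
  case: (@ex_ActConst 0 false 1%R _ exWb) => // E; move: imB => /and3P[_ _]; rewrite w0 E /nocomm /=.
  by [].
have uE : p2 w = [:: V [:: 2]] by rewrite (p1_nil uP w0) wb.
have nV2 : V [:: 2; 2] \notin w by apply/negP => /nf.
have [i [x [y [wE w1 Xw]]]] := p2_single wP uE nV2.
have /andP[w1P exT] := exD.
have /and4P[tP exP1 exW1 _] := exT.
have iE : i = [:: 1; 2].
  have : nmatch w (info (Dia (Par P1 W1)) i) (Some (inl 0, false)) := nc _ Xw.
  move/nmatch_inl_r; case: i {wE w1 Xw} => [|[|[|c]] i] //=.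
  case: i => [|[|[|[|c]]] i] //=.
    by rewrite info_P1; case: (info P i) => [[[n|k] b]|].
  by case: i => [|[|[|c]] i].
subst i.
have tV : V [:: 2] \in p1 (p1 w).
  by apply: (@mem_p1 _ (V [:: 2])); rewrite w1 mem_cat mem_head orbT.
have w2 : p2 (p1 (p1 w)) = [:: V [::]].
  case: (@ex_ActConst 0 true 1%R _ exW1) => // E.
  by have := @mem_p2 _ (V [::]) tV; rewrite E.
have [x' [y' [tE t1]]] := p2_singleV tP w2 tV.
have w1E := in1_map_p1 w1P.
have xyE : x ++ V [:: 1; 2] :: y = map lab_e1 (map lab_e1 x') ++ V [:: 1; 2] :: map lab_e1 (map lab_e1 y').
  by rewrite -w1 {1}w1E tE map_cat.
have uw1 : uniq (x ++ V [:: 1; 2] :: y) by rewrite -w1; exact: (@ex_uniq K (Dia (Par P1 W1))).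
(* The word [p1 w] is cut in two ways at [V [:: 1; 2]], which occurs only once, so the cuts
   agree. *)
have [xE yE] : x = map lab_e1 (map lab_e1 x') /\ y = map lab_e1 (map lab_e1 y').
  have n2 : V [:: 1; 2] \notin map lab_e1 (map lab_e1 x').
    by apply/negP => /mapP[l /mapP[[?|[? ?]] _ ->]].
  have n1 : V [:: 1; 2] \notin x.
    by move: uw1; rewrite cat_uniq => /and3P[_ /hasPn/(_ (V [:: 1; 2]))]; rewrite mem_head => /(_ isT).
  have sz : size x = size (map lab_e1 (map lab_e1 x')).
    have := congr1 (index (V [:: 1; 2])) xyE.
    by rewrite !index_cat (negbTE n1) (negbTE n2) /= ?eqxx !addn0.
  move/eqP: xyE; rewrite eqseq_cat // => /andP[/eqP-> /eqP[->]] //.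
exists x', y'; split.
- by rewrite !map_gL -xE -yE.
- by rewrite -t1 -ex_P1.
Qed.

Lemma int_L1 : ([:: 1; 1; 2], [:: 2; 2], L2) \in int L1.
Proof.
have vD : (0, true, [:: 1; 2], Dia (Par (ren S P1) (Dia (Const 1%R)))) \in vis (Dia (Par P1 W1)).
  apply/mapP; exists (0, true, [:: 2], Par (ren S P1) (Dia (Const 1%R))) => //.
  by rewrite /= mem_cat mem_head orbT.
have vB : (0, ~~ true, [:: 2], Par (ren S W0) (Dia (Const 1%R))) \in vis (Par W0 Wb).
  by rewrite /= !inE eqxx orbT.
have h := int_cross vD vB.
by apply/mapP; eexists; first exact: h.
Qed.

Lemma ex_L2 w : ex P w -> ex L2 (map (glab gL) w).
Proof.
move=> exP; rewrite map_gL /L2 [ex _ _]/= -/(ex (Par (Dia (Par (ren S P1) (Dia (Const 1%R)))) (Par (ren S W0) (Dia (Const 1%R)))) _).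
rewrite ex_Par1 ex_Dia ex_Par1 ex_ren; last exact: succn_inj.
rewrite ex_P1 exP -!all_predI /=; apply/allP => l /mapP[l1 /mapP[l2 /mapP[[i|[i j]] _ ->] ->] ->] //=.
by rewrite info_ren info_P1; case: (info P i) => [[[[|n]|k] b]|].
Qed.

Lemma imax_L2 w : ex P w -> imax L2 (map (glab gL) w) = imax P w.
Proof.
move=> exP; rewrite map_gL /= ?pE /= ?pE.
rewrite imax_ren; last exact: succn_inj.
rewrite imax_P1 !nocomm0 !andbT; case: (imax P w) => //=.
apply/allP => i; rewrite cats0 => /mapP[j /mapP[k ka ->] ->] /=.
rewrite andbT info_ren info_P1.
by case: (info P k) => [[[n|k'] b]|] //=; rewrite andbF.
Qed.

Lemma value_L2 w : value L2 (map (glab gL) w) = value P w.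
Proof. by rewrite map_gL /= ?pE /= ?pE val_ren val_P1 !mulr1. Qed.

Lemma actv_L2 w : actv L2 (map (glab gL) w) = map gL (actv P w) ++ [:: [:: 2; 1]].
Proof.
rewrite map_gL /= ?pE /= ?pE actv_ren actv_P1 cats0; congr (_ ++ _).
by rewrite -!map_comp.
Qed.

(** The object of the prefix, index 0 in the body, is seen from outside as bound at [[:: 1]]. *)
Definition nLin (n : nam) : option nam :=
  Some (match n with inl 0 => inr [:: 1] | inl n.+1 => inl n | inr k => inr (gL k) end).

Lemma info_lin i : info (lin s e P) (gL i) = mapn nLin (info P i).
Proof. by rewrite /= info_ren !mapn_comp; apply: eq_mapn => -[[|n]|k]. Qed.

Definition linS S0 : seq lab := V [:: 1] :: LX :: map (glab gL) S0.

Lemma lin_vis_mem : (s, e, [:: 1], L1) \in vis (lin s e P).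
Proof. by rewrite vis_lin mem_head. Qed.

Lemma ex_linS w : ex P w -> ex (lin s e P) (linS w).
Proof. by move=> exP; rewrite /linS (vis_ex lin_vis_mem) (int_ex int_L1) ex_L2. Qed.
Lemma imax_linS w : ex P w -> imax (lin s e P) (linS w) = imax P w.
Proof.
move=> exP; rewrite /linS (vis_imax lin_vis_mem) ?(int_imax int_L1) ?imax_L2 ?ex_L2 //.
by rewrite (int_ex int_L1) ex_L2.
Qed.
Lemma value_linS w : value (lin s e P) (linS w) = value P w.
Proof. by rewrite /linS (vis_val lin_vis_mem) (int_val int_L1) value_L2. Qed.
Lemma actv_linS w : actv (lin s e P) (linS w) = map gL (actv P w) ++ [:: [:: 2; 1]].
Proof. by rewrite /linS (vis_actv lin_vis_mem) (int_actv int_L1) actv_L2. Qed.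

Lemma linS_unfired S0 w : perm_eq w (linS S0) -> p1 (p2 w) = [::].
Proof.
move=> wS; have := perm_pmap s1 (perm_pmap s2 wS); rewrite -/(p2 _) -/(p1 _) -/(p2 _) -/(p1 _).
by rewrite /linS p2_cons /= p2_cons /= map_gL p2_e1 => /perm_nilP.
Qed.

Lemma lin_words w : ex (lin s e P) w -> imax (lin s e P) w -> p1 (p2 w) = [::] ->
  exists x y, w = V [:: 1] :: map (glab gL) x ++ LX :: map (glab gL) y /\ ex P (x ++ y).
Proof.
case: w => [_ /imax0_int//|[i|[i j]] w] exw.
  have [s' [e' [P']]] := ex_V exw; rewrite vis_lin inE => /eqP[_ _ ? _]; subst i.
  move: exw; rewrite (vis_ex lin_vis_mem) => exw; rewrite (vis_imax lin_vis_mem) // p2_cons /=.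
  by move=> imw w0; have [x [y [-> ?]]] := L1_words exw imw w0; exists x, y.
by have [P'] := ex_I exw; rewrite int_lin inE => /eqP[? ? _]; subst i j => _; rewrite p2_cons.
Qed.

(** Firing [w.0] would put the factor 0 of its continuation into the state. *)
Lemma lin_value_unfired w : ex (lin s e P) w -> value (lin s e P) w != 0%R -> p1 (p2 w) = [::].
Proof.
move=> /andP[/and4P[_ _ /and4P[_ exW0 _ _] _] _] vw.
case: (@ex_ActConst 0 true 0%R _ exW0) => // E; move: vw; rewrite /= E /=.
by rewrite mul0r mulr0 eqxx.
Qed.

Lemma perm_linS x y : perm_eq (V [:: 1] :: map (glab gL) x ++ LX :: map (glab gL) y) (linS (x ++ y)).
Proof. by rewrite perm_cons map_cat -cat1s perm_catCA. Qed.

End Lin.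

Section DenLin.
Variable K : comPzSemiRingType.
Implicit Types (P Q R : term K) (w S : seq lab).
Variables (E : eqType) (sr : E -> nat + E) (pl : E -> bool) (precS precC : rel E).

(** The body starts only after the prefix. So [precC] has to put [a] before the events of the body,
    while [precS] must put none of them before [a]. *)
Lemma den_lin rho rho' s P a ev N :
  den sr pl precS precC rho' P ev N ->
  rho' 0 = inr a -> (forall n, rho' n.+1 = rho n) -> sr a = rho s -> a \notin ev ->
  (forall b, b \in ev -> precC a b) -> (forall b, b \in ev -> ~~ precS b a) ->
  den sr pl precS precC rho (lin s (pl a) P) (a :: ev) N.
Proof.
move=> [S0 [h0 [ex0 im0 v0 R0 un0]]] r0 r1 sra aev pC pS.
pose h b := if b == a then [:: 1] else gL (h0 b).
have ha : h a = [:: 1] by rewrite /h eqxx.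
have hb b : b \in ev -> h b = gL (h0 b).
  by rewrite /h; case: eqP => // -> ; rewrite (negbTE aev).
have mh v : {subset v <= ev} -> map h v = map gL (map h0 v).
  by move=> sub; rewrite -map_comp; apply/eq_in_map => b /sub/hb ->.
have rnE n g : rn rho' ev h0 n g -> exists2 n', nLin n = Some n' & rn rho (a :: ev) h n' g.
  case: n => [[|i] <-|k [b be [-> ->]]].
  - by exists (inr [:: 1]) => //; exists a; rewrite ?mem_head.
  - by exists (inl i).
  - by exists (inr (gL (h0 b))) => //; exists b; rewrite ?in_cons ?be ?orbT ?hb.
have visS U : visw (linS U) = [:: 1] :: map gL (visw U) by rewrite /linS /= -visw_glab.
have ig : injective (glab gL) := glab_inj gL_inj.
have decomp w : perm_eq w (linS S0) -> ex (lin s (pl a) P) w ->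
   exists x y, [/\ w = V [:: 1] :: map (glab gL) x ++ LX :: map (glab gL) y, ex P (x ++ y) & perm_eq (x ++ y) S0].
  move=> wS exw; have imw : imax (lin s (pl a) P) w by rewrite (imax_mem _ (perm_mem wS)) imax_linS.
  have [x [y [wE exxy]]] := lin_words exw imw (linS_unfired wS); exists x, y; split=> //.
  have := perm_linS x y; rewrite -wE perm_sym => h1; have := perm_trans h1 wS.
  by rewrite !perm_cons => /(perm_map_inj ig).
exists (linS S0), h; split.
- exact: ex_linS.
- by rewrite imax_linS.
- by rewrite value_linS.
- split.
  + by rewrite /= aev (rz_uniq R0).
  + move=> b c; rewrite !in_cons => /orP[/eqP->|be] /orP[/eqP->|ce] //; rewrite ?ha ?(hb _ be) ?(hb _ ce) //.
    by move=> /gL_inj; exact: (rz_inj R0).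
  + by rewrite visS /= ha perm_cons mh //; apply: perm_map; exact: (rz_vis R0).
  + move=> b; rewrite in_cons => /orP[/eqP->|be].
      by rewrite ha; exists (inl s).
    have [n nE /rnE[n' n'E rn']] := rz_info R0 be; exists n' => //.
    by rewrite (hb _ be) info_lin nE (mapn_some _ n'E).
  + move=> w wS exw; have [x [y [wE exxy xyS]]] := decomp w wS exw.
    have [v [vE wv vl]] := rz_sound R0 xyS exxy; exists (a :: v); split.
    * by rewrite perm_cons.
    * have sub : {subset v <= ev} by move=> b; rewrite (perm_mem vE).
      by rewrite wE /= visw_cat /= !visw_glab -map_cat -visw_cat wv /= ha mh.
    * move=> b c; rewrite !in_cons => /orP[/eqP->|bv]; first by rewrite /= eqxx.
      case/orP => [/eqP->|cv] bc; first by move: (pS b); rewrite bc -(perm_mem vE) bv => /(_ isT).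
      rewrite /=; case: eqP => [//|_]; case: eqP => [ac|_]; last by rewrite ltnS; exact: vl.
      by move: aev; rewrite ac -(perm_mem vE) cv.
  + move=> v vE vl.
    have uv : uniq v by rewrite (perm_uniq vE) /= aev (rz_uniq R0).
    case: v vE vl uv => [/perm_size//|b v] vE vl /= /andP[bv uv].
    have ba : b = a.
      have av : a \in b :: v by rewrite (perm_mem vE) mem_head.
      case: (b =P a) => // /eqP nba.
      have bev : b \in ev by have := perm_mem vE b; rewrite !in_cons eqxx (negbTE nba).
      have := vl a b av (mem_head _ _) (pC b bev).
      by rewrite /= eqxx (negbTE nba).
    subst b; rewrite perm_cons in vE.
    have vl' : linext precC v.
      move=> b c bv' cv bc; have := vl b c; rewrite !in_cons bv' cv !orbT => /(_ isT isT bc).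
      rewrite /=; case: eqP => [ab|_]; first by rewrite ab bv' in bv.
      by case: eqP => [ac|_]; first by rewrite ac cv in bv.
    have [w [wS exw ww]] := rz_compl R0 vE vl'; exists (linS w); split.
    * by rewrite !perm_cons; exact: perm_map.
    * exact: ex_linS.
    * by rewrite visS ww /= ha mh // => b; rewrite (perm_mem vE).
  + move=> e g; rewrite actv_linS; split=> [/(rz_N R0)[i [n [ia nE /rnE[n' n'E rn']]]]|].
      exists (gL i), n'; split=> //; first by rewrite mem_cat map_f.
      by rewrite info_lin nE (mapn_some _ n'E).
    case=> i [n' []]; rewrite mem_cat => /orP[/mapP[j ja ->]|]; last first.
      by rewrite inE => /eqP->.
    rewrite info_lin; case EE: (info P j) => [[n e']|] // nE rn'.
    have [nE' ?] : nLin n = Some n' /\ e' = e by case: nE => <- <-.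
    subst e'; apply/(rz_N R0); exists j, n; split=> //.
    case: n EE nE nE' => [[|u]|k] _ _ [nE]; subst n' => //=.
    * by case: rn' => b; rewrite in_cons => /orP[/eqP->|be] [] //; [move=> _ ->|rewrite (hb _ be)].
    * by rewrite r1.
    * case: rn' => b; rewrite in_cons => /orP[/eqP->|be] []; first by rewrite ha.
      by rewrite (hb _ be) => /gL_inj -> ->; exists b.
- move=> w exw imw vw; have [x [y [wE exxy]]] := lin_words exw imw (lin_value_unfired exw vw).
  have wS := perm_linS x y; rewrite -wE in wS; apply: (perm_trans wS).
  rewrite !perm_cons; apply: perm_map; apply: un0 => //.
    by move: imw; rewrite (imax_mem _ (perm_mem wS)) imax_linS.
  by move: vw; rewrite (val_mem _ (perm_mem wS)) value_linS.
Qed.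

End DenLin.

(** * Products, linear prefixes and restrictions *)

Section Prod.
Variable K : comPzSemiRingType.
Implicit Types (P Q R : term K) (w S : seq lab).
Variables (E : eqType) (sr : E -> nat + E) (pl : E -> bool) (precS precC : rel E).
Notation den := (den sr pl precS precC).

Lemma den_eqN rho P ev N N' : N =i N' -> den rho P ev N -> den rho P ev N'.
Proof.
move=> NN [S [h [h1 h2 h3 [r1 r2 r3 r4 r5 r6 r7] h5]]]; exists S, h; split=> //; split=> //.
by move=> e g; rewrite -NN.
Qed.

Lemma den_prodP rho (J : eqType) (l : seq J) (t : J -> term K) evs Ns :
  (forall j, j \in l -> den rho (t j) (evs j) (Ns j)) -> uniq l ->
  (forall j j', j \in l -> j' \in l -> j != j' ->
     forall x y, x \in evs j -> y \in evs j' -> x != y /\ ~~ precS x y) ->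
  den rho (prodP [seq t j | j <- l]) (flatten [seq evs j | j <- l]) (flatten [seq Ns j | j <- l]).
Proof.
elim: l => [|j l IH] dl ul dj; first exact: den_const1.
case: l IH dl ul dj => [|j' l] IH dl ul dj.
  by rewrite /= !cats0; apply: dl; rewrite mem_head.
have jl : j \notin j' :: l by case/andP: ul.
have sub k : k \in j' :: l -> k \in [:: j, j' & l] by move=> kl; rewrite in_cons kl orbT.
have jk k : k \in j' :: l -> (j != k) && (k != j).
  by move=> kl; rewrite [k == j]eq_sym andbb; apply: contraNneq jl => ->.
apply: (@den_ppar K E sr pl precS precC rho (t j) (prodP [seq t j | j <- j' :: l]) (evs j)
  (flatten [seq evs j | j <- j' :: l])).
- by apply: dl; rewrite mem_head.
- apply: IH.
  + by move=> k kl; apply: dl; exact: sub.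
  + by case/andP: ul.
  + by move=> k k' kl kl' kk; apply: dj => //; exact: sub.
- move=> x xj; apply/flatten_mapP => -[k kl xk].
  have [jk1 _] := andP (jk k kl).
  by have [/eqP] := dj j k (mem_head _ _) (sub _ kl) jk1 x x xj xk.
- move=> x y xy /orP[/andP[xj /flatten_mapP[k kl yk]]|/andP[/flatten_mapP[k kl xk] yj]];
    have [jk1 jk2] := andP (jk k kl).
    by have [_] := dj j k (mem_head _ _) (sub _ kl) jk1 x y xj yk; rewrite xy.
  by have [_] := dj k j (sub _ kl) (mem_head _ _) jk2 x y xk yj; rewrite xy.
Qed.

Lemma den_lin0 rho s P a ev N :
  den rho P ev N -> sr a = rho s -> a \notin ev ->
  (forall b, b \in ev -> precC a b) -> (forall b, b \in ev -> ~~ precS b a) ->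
  den rho (lin0 s (pl a) P) (a :: ev) N.
Proof.
move=> dP sra aev pC pS; rewrite /lin0.
apply: (@den_lin _ _ _ _ _ _ rho (fun i => if i is i.+1 then rho i else inr a)) => //.
by apply: den_ren; [exact: succn_inj|exact: dP].
Qed.

(** The body refers to the object by a name [x], like the [z_a] of a trace; inside the body this
    name denotes the event [a]. *)
Lemma den_lin_close rho s x P a ev N :
  den (fun i => if i == x then inr a else rho i) P ev N -> sr a = rho s -> a \notin ev ->
  (forall b, b \in ev -> precC a b) -> (forall b, b \in ev -> ~~ precS b a) ->
  den rho (lin s (pl a) (close x P)) (a :: ev) N.
Proof.
move=> dP sra aev pC pS.
apply: (@den_lin _ _ _ _ _ _ rho (fun i => if i is i.+1 then rho i else inr a)) => //.
apply: den_ren.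
  by move=> i j; case: eqP => [->|_]; case: eqP => [->|_] // [].
by apply: eq_den dP => i /=; case: eqP.
Qed.
End Prod.

Section Nus.
Variable K : comPzSemiRingType.
Implicit Types (P Q R M : term K) (w S : seq lab) (L : seq nat).

Definition nHide L (n : nam) : option nam :=
  match n with inl i => if i \in L then None else Some (inl i) | inr k => Some (inr k) end.
Definition nus L M := foldr (@nu_n K) M L.

Lemma close_inj x : injective (fun i => if i == x then 0 else i.+1).
Proof. by move=> i j; case: eqP => [->|_]; case: eqP => [->|_] // []. Qed.

Lemma info_nus L M i : info (nus L M) i = mapn (nHide L) (info M i).
Proof.
elim: L => [|x L IH] /=; first by rewrite mapn_id // => -[].
rewrite /close info_ren IH !mapn_comp; apply: eq_mapn => -[n|k] //=.
by rewrite in_cons; case: ifP => nL; rewrite ?orbT //= orbF; case: eqP.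
Qed.

Lemma imax_nus L M w : imax (nus L M) w = imax M w.
Proof. by elim: L => //= x L IH; rewrite /close imax_ren ?IH //; exact: close_inj. Qed.
Lemma val_nus L M w : value (nus L M) w = value M w.
Proof. by elim: L => //= x L IH; rewrite /close val_ren IH. Qed.
Lemma actv_nus L M w : actv (nus L M) w = actv M w.
Proof. by elim: L => //= x L IH; rewrite /close actv_ren IH. Qed.

Lemma ex_nus L M w : ex (nus L M) w =
  ex M w && all (fun l => if l is inl i then (if info M i is Some (inl n, _) then n \notin L else true) else true) w.
Proof.
elim: L => [|x L IH] /=.
  rewrite (_ : all _ _ = true) ?andbT //; apply/allP => -[i|//] _.
  by case: (info M i) => [[[n|k] e]|].
rewrite /close ex_ren; last exact: close_inj.
rewrite IH -andbA -all_predI; congr (_ && _); apply: eq_all => -[i|//] /=.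
rewrite info_ren -/(nus L M) info_nus mapn_comp; case: (info M i) => [[[n|k] e]|] //=.
rewrite in_cons negb_or; case: (n \in L) => /=; rewrite ?andbF ?andbT //.
by case: eqP.
Qed.
End Nus.

(** * The implementation of a trace *)

Lemma index_map_in (A B : eqType) (f : A -> B) (s : seq A) x :
  {in s &, injective f} -> x \in s -> index (f x) (map f s) = index x s.
Proof.
elim: s => //= y s IH fi; rewrite in_cons.
case: (y =P x) => [->|/eqP yx]; first by rewrite !eqxx.
rewrite eq_sym (negbTE yx) /= => xs.
have /negbTE -> : f y != f x.
  by apply: contra yx => /eqP/fi; rewrite mem_head in_cons xs orbT => ->.
by rewrite IH // => a b as_ bs; apply: fi; rewrite in_cons ?as_ ?bs orbT.
Qed.

(** [find] with these predicates gives the time at which an action fires, whether it does so in a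
    visible step or as one half of a synchronisation. *)
Definition at1 (i : pos) : pred lab := fun l => (1 :: i) \in ps l.
Definition at2 (i : pos) : pred lab := fun l => (2 :: i) \in ps l.
Definition at0 (i : pos) : pred lab := fun l => i \in ps l.

Lemma at1E i l : inP l -> at1 i l = (if s1 l is Some m then i \in ps m else false).
Proof.
by case/inPP => [[j|[j k]]|[j|[j k]]|j k]; rewrite /at1 /= !inE ?eqseq_cons //= ?orbF.
Qed.
Lemma at2E i l : inP l -> at2 i l = (if s2 l is Some m then i \in ps m else false).
Proof.
by case/inPP => [[j|[j k]]|[j|[j k]]|j k]; rewrite /at2 /= !inE ?eqseq_cons //= ?orbF.
Qed.

Lemma find_p1 w i j : all inP w -> find (at0 i) (p1 w) <= find (at0 j) (p1 w) ->
  find (at1 i) w <= find (at1 j) w.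
Proof.
elim: w => //= l w IH /andP[lP wP]; rewrite p1_cons !at1E //.
case: (s1 l) => [m|] /=; last by rewrite !ltnS; exact: IH.
rewrite -!/(at0 _ m); case: (at0 i m); case: (at0 j m) => //; rewrite !ltnS; exact: IH.
Qed.
Lemma find_p2 w i j : all inP w -> find (at0 i) (p2 w) <= find (at0 j) (p2 w) ->
  find (at2 i) w <= find (at2 j) w.
Proof.
elim: w => //= l w IH /andP[lP wP]; rewrite p2_cons !at2E //.
case: (s2 l) => [m|] /=; last by rewrite !ltnS; exact: IH.
rewrite -!/(at0 _ m); case: (at0 i m); case: (at0 j m) => //; rewrite !ltnS; exact: IH.
Qed.

Lemma find_index w i (l : lab) : pw w -> l \in w -> i \in ps l -> find (at0 i) w = index l w.
Proof.
move=> pww lw il; rewrite /index; apply: eq_in_find => l' l'w /=.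
apply/idP/eqP => [il'|->//]; exact: pw_ps pww l'w lw il' il.
Qed.

Lemma inlV_inj : injective (inl : pos -> lab). Proof. by move=> ? ? []. Qed.

Lemma realizes_find (K : comPzSemiRingType) (E : eqType) (sr : E -> nat + E) pl rho (P : term K) S ev N
    (precS precC : rel E) h w x y :
  realizes sr pl rho P S ev N precS precC h -> perm_eq w S -> ex P w ->
  x \in ev -> y \in ev -> precS x y -> find (at0 (h x)) w <= find (at0 (h y)) w.
Proof.
move=> R wS exw xE yE xy; have [t [tE wt tl]] := rz_sound R wS exw.
have [xt yt] : x \in t /\ y \in t by rewrite !(perm_mem tE).
have inj : {in t &, injective h} by move=> a b; rewrite !(perm_mem tE); exact: (rz_inj R).
have fw z : z \in t -> find (at0 (h z)) w = index (V (h z)) w /\ V (h z) \in w.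
  move=> zt; have zw : V (h z) \in w by rewrite -mem_visw wt map_f.
  by rewrite (find_index (ex_pw exw) zw) // inE.
have [-> _] := fw x xt; have [-> yw] := fw y yt.
rewrite -(index_filter_le (p := predC isI)) // filter_visw wt !(index_map inlV_inj) !index_map_in //.
exact: tl.
Qed.

(** * Two terms synchronised on restricted names *)

Section Core.
Variable K : comPzSemiRingType.
Implicit Types (w S : seq lab).
Variables (E : eqType) (sr : E -> nat + E) (pl : E -> bool) (precS precC : rel E).
Variables (A : eqType) (srA : A -> nat + A) (plA : A -> bool) (precA : rel A).
Variables (F G : term K) (L : seq nat).
Variables (evF evG : seq E) (evA : seq A) (NF : seq (bool * (nat + E))) (NA : seq (bool * (nat + A))).
Variables (mn : A -> E) (mu : E -> E).
Hypothesis dF : den sr pl precS precC inl F evF NF.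
Hypothesis dG : den sr pl precS precC inl G evG [::].
Hypothesis evA_uniq : uniq evA.
Hypothesis mn_inj : injective mn.
Hypothesis mnF : forall a, a \in evA -> mn a \in evF.
Hypothesis muF : forall y, y \in evG -> mu y \in evF.
Hypothesis evFP : forall x, x \in evF -> (exists2 a, a \in evA & x = mn a) \/ (exists2 y, y \in evG & x = mu y).
Hypothesis mn_mu : forall a y, a \in evA -> y \in evG -> mn a <> mu y.
Hypothesis mu_inj : {in evG &, injective mu}.
Hypothesis srG : forall y, y \in evG -> exists n, [/\ sr y = inl n, n \in L, sr (mu y) = inl n & pl y = ~~ pl (mu y)].
Hypothesis srFG : forall x y, x \in evF -> y \in evG -> sr x = sr y -> x = mu y.
Hypothesis srM : forall a, a \in evA ->
  match srA a with
  | inl u => sr (mn a) = inl u /\ u \notin L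
  | inr b => sr (mn a) = inr (mn b) /\ b \in evA
  end.
Hypothesis plM : forall a, a \in evA -> pl (mn a) = plA a.
Hypothesis NFP : forall e g, (e, g) \in NF -> exists2 a, a \in evA & g = inr (mn a).
Hypothesis NAP : forall e g, (e, g) \in NA -> exists2 a, a \in evA & g = inr a.
Hypothesis NFA : forall e a, a \in evA -> ((e, inr (mn a)) \in NF) = ((e, inr a) \in NA).
(* Here kappa is the time at which each event occurs; an event of G occurs
   together with its partner mu y. *)
Hypothesis order_sound : forall kappa : E -> nat,
  (forall x y, x \in evF -> y \in evF -> precS x y -> kappa x <= kappa y) ->
  (forall x y, x \in evG -> y \in evG -> precS x y -> kappa (mu x) <= kappa (mu y)) ->
  forall a b, a \in evA -> b \in evA -> precA a b -> kappa (mn a) <= kappa (mn b).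
Hypothesis order_compl : forall v, perm_eq v evA -> linext precA v ->
  exists vF, [/\ perm_eq vF evF, linext precC vF,
    [seq x <- vF | x \notin map mu evG] = map mn v &
    forall x y, x \in evG -> y \in evG -> precC x y -> index (mu x) vF <= index (mu y) vF].
Hypothesis order_ex : exists2 v, perm_eq v evA & linext precA v.

Let M := nus L (Par F G).

Section Witness.
Variables (SF SG : seq lab) (hF hG : E -> pos).
Hypothesis exF : ex F SF.
Hypothesis imF : imax F SF.
Hypothesis vF1 : value F SF = 1%R.
Hypothesis RF : realizes sr pl inl F SF evF NF precS precC hF.
Hypothesis unF : forall w, ex F w -> imax F w -> value F w != 0%R -> perm_eq w SF.
Hypothesis exG : ex G SG.
Hypothesis imG : imax G SG.
Hypothesis vG1 : value G SG = 1%R.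
Hypothesis RG : realizes sr pl inl G SG evG [::] precS precC hG.
Hypothesis unG : forall w, ex G w -> imax G w -> value G w != 0%R -> perm_eq w SG.

(** A maximal word of [M] has a nonzero value only if both projections have one, so each projection
    is then the unique prerun of its operand. *)
Definition good w := [/\ ex M w, perm_eq (p1 w) SF & perm_eq (p2 w) SG].

Lemma infoG y : y \in evG -> exists n, [/\ info G (hG y) = Some (inl n, pl y), n \in L, sr y = inl n & sr (mu y) = inl n].
Proof.
move=> yG; have [n [sy nL smy _]] := srG yG; have [m mE] := rz_info RG yG.
rewrite sy; case: m mE => [k|k] mE /=; last by case=> b _ [].
by case=> kn; subst k; exists n.
Qed.

Lemma infoF x n : x \in evF -> sr x = inl n -> info F (hF x) = Some (inl n, pl x).
Proof.
move=> xF sx; have [m mE] := rz_info RF xF.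
by rewrite sx; case: m mE => [k|k] mE /=; [case=> <-|case=> b _ []].
Qed.

Lemma good_parts w : good w -> [/\ all inP w, ex F (p1 w), ex G (p2 w), pw w &
  (forall l, l \in w -> ncheck F G w l) /\
  (forall i n e, V i \in w -> info (Par F G) i = Some (inl n, e) -> n \notin L)].
Proof.
case=> exM _ _; have pww := ex_pw exM; move: exM.
rewrite /M ex_nus => /andP[exP /allP nf]; have /and4P[wP eF eG /allP nc] := exP.
by split=> //; split=> // i n e iw ie; have := nf _ iw; rewrite ie.
Qed.

Lemma visF w i : perm_eq (p1 w) SF -> V i \in p1 w -> exists2 x, x \in evF & i = hF x.
Proof. by move=> pF; rewrite -mem_visw (perm_mem (visw_perm pF)) (perm_mem (rz_vis RF)) => /mapP. Qed.
Lemma visG w i : perm_eq (p2 w) SG -> V i \in p2 w -> exists2 x, x \in evG & i = hG x.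
Proof. by move=> pF; rewrite -mem_visw (perm_mem (visw_perm pF)) (perm_mem (rz_vis RG)) => /mapP. Qed.
Lemma visF' w x : perm_eq (p1 w) SF -> x \in evF -> V (hF x) \in p1 w.
Proof. by move=> pF xF; rewrite -mem_visw (perm_mem (visw_perm pF)) (perm_mem (rz_vis RF)) map_f. Qed.
Lemma visG' w x : perm_eq (p2 w) SG -> x \in evG -> V (hG x) \in p2 w.
Proof. by move=> pF xF; rewrite -mem_visw (perm_mem (visw_perm pF)) (perm_mem (rz_vis RG)) map_f. Qed.

(** The subject of [y] is restricted, so [y] cannot fire visibly; [srFG] leaves [mu y] as its only
    possible partner. *)
Lemma good_sync w y : good w -> y \in evG -> X (hF (mu y)) (hG y) \in w.
Proof.
move=> gw yG; have [wP eF eG pww [nc nf]] := good_parts gw; have [_ pF pG] := gw.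
have [n [iE nL sy smy]] := infoG yG.
have := visG' pG yG; rewrite mem_p2V // => /orP[h|].
  by have := nf _ n (pl y) h; rewrite /= iE nL => /(_ erefl).
case/hasP => -[//|[[|[|[|[|c]]] i] j]] // lw /eqP jE; subst j.
have [x xF iE'] := visF pF (mem_p1X lw); subst i.
have : nmatch w (info F (hF x)) (info G (hG y)) := nc _ lw.
rewrite iE => /nmatch_inl_r; have [m mE] := rz_info RF xF; rewrite mE => rm [mn' _]; subst m.
by rewrite -(srFG xF yG) // -rm sy.
Qed.

(** If [mn a] were synchronised with some [y] of [G], then [y] would be used twice, as it already
    meets [mu y]. *)
Lemma good_main w a : good w -> a \in evA -> V (1 :: hF (mn a)) \in w.
Proof.
move=> gw aA; have [wP eF eG pww [nc nf]] := good_parts gw; have [_ pF pG] := gw.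
have := visF' pF (mnF aA); rewrite mem_p1V // => /orP[//|].
case/hasP => -[//|[i [|[|[|[|c]]] j]]] // lw /eqP iE; subst i.
have [y yG jE] := visG pG (mem_p2X lw); subst j.
have Xw := good_sync gw yG.
have := pw_ps pww lw Xw (i := 2 :: hG y); rewrite !inE !eqxx !orbT => /(_ isT isT) [E'].
by case: (mn_mu aA yG); apply: (rz_inj RF) => //; [exact: mnF|exact: muF].
Qed.

Lemma good_V w i : good w -> V i \in w -> exists2 a, a \in evA & i = 1 :: hF (mn a).
Proof.
move=> gw iw; have [wP eF eG pww [nc nf]] := good_parts gw; have [_ pF pG] := gw.
case: (inPV (allP wP _ iw)) => -[j ?]; subst i.
  have [x xF jE] := visF pF (@mem_p1 _ (V j) iw); subst j.
  case: (evFP xF) => -[z zA xE]; subst x; first by exists z.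
  have := pw_ps pww iw (good_sync gw zA) (i := 1 :: hF (mu z)).
  by rewrite !inE !eqxx => /(_ isT isT).
have [y yG jE] := visG pG (@mem_p2 _ (V j) iw); subst j.
have := pw_ps pww iw (good_sync gw yG) (i := 2 :: hG y).
by rewrite !inE !eqxx orbT => /(_ isT isT).
Qed.

Lemma good_X w i j : good w -> X i j \in w -> exists2 y, y \in evG & i = hF (mu y) /\ j = hG y.
Proof.
move=> gw lw; have [wP eF eG pww [nc nf]] := good_parts gw; have [_ pF pG] := gw.
have [y yG jE] := visG pG (mem_p2X lw); subst j; exists y => //; split=> //.
have := pw_ps pww lw (good_sync gw yG) (i := 2 :: hG y).
by rewrite !inE !eqxx !orbT => /(_ isT isT) [].
Qed.

(** The visible steps are those of the main events, the synchronisations are forced, and the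
    internal steps are those of two fixed preruns. Hence all good words have the same labels. *)
Lemma good_sub w w' : good w -> good w' -> {subset w <= w'}.
Proof.
move=> gw gw' l lw; have [wP _ _ pww _] := good_parts gw; have [_ pF pG] := gw.
have [wP' _ _ pww' _] := good_parts gw'; have [_ pF' pG'] := gw'.
case/inPP: (allP wP _ lw) (lw) => [[i|[i j]]|[i|[i j]]|i j] lw'.
- by have [a aA [->]] := good_V gw lw'; exact: good_main.
- by rewrite -mem_p1I // (perm_mem pF') -(perm_mem pF) mem_p1I.
- by have [a aA []] := good_V gw lw'.
- by rewrite -mem_p2I // (perm_mem pG') -(perm_mem pG) mem_p2I.
- by have [y yG [-> ->]] := good_X gw lw'; exact: good_sync.
Qed.

Lemma good_perm w w' : good w -> good w' -> perm_eq w w'.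
Proof.
move=> gw gw'; apply: uniq_perm; try (by case: gw => [/ex_uniq]); try (by case: gw' => [/ex_uniq]).
by move=> l; apply/idP/idP; apply: good_sub.
Qed.

Let h a := 1 :: hF (mn a).

Lemma main_inj : {in evA &, injective h}.
Proof. by move=> a b aA bA [/(rz_inj RF) E']; apply: mn_inj; apply: E'; exact: mnF. Qed.

Lemma good_vis w : good w -> perm_eq (visw w) (map h evA).
Proof.
move=> gw; have uw : uniq w by case: gw => /ex_uniq.
apply: uniq_perm.
- have : uniq (map (inl : pos -> lab) (visw w)) by rewrite -filter_visw filter_uniq.
  exact: map_uniq.
- by rewrite map_inj_in_uniq //; exact: main_inj.
move=> i; rewrite mem_visw; apply/idP/mapP => [/(good_V gw)//|[a aA ->]]; exact: good_main.
Qed.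

(** [order_sound] is applied with firing times. An event of [G] and its partner lie in the same
    label, so they have the same time. *)
Lemma good_order w v : good w -> visw w = map h v -> perm_eq v evA -> linext precA v.
Proof.
move=> gw wv vE; have [wP eF eG pww [nc nf]] := good_parts gw; have [_ pF pG] := gw.
pose kappa x := find (at1 (hF x)) w.
have kmu y : y \in evG -> kappa (mu y) = find (at2 (hG y)) w.
  move=> yG; have Xw := good_sync gw yG.
  rewrite /kappa (@find_index w (1 :: hF (mu y)) (X (hF (mu y)) (hG y))) ?inE ?eqxx //.
  by rewrite -(@find_index w (2 :: hG y)) ?inE ?eqxx ?orbT.
have kF : forall x y, x \in evF -> y \in evF -> precS x y -> kappa x <= kappa y.
  by move=> x y xF yF xy; apply: find_p1 => //; exact: realizes_find RF pF eF xF yF xy.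
have kG : forall x y, x \in evG -> y \in evG -> precS x y -> kappa (mu x) <= kappa (mu y).
  by move=> x y xG yG xy; rewrite !kmu //; apply: find_p2 => //; exact: realizes_find RG pG eG xG yG xy.
move=> a b av bv ab.
have aA : a \in evA by rewrite -(perm_mem vE).
have bA : b \in evA by rewrite -(perm_mem vE).
have := order_sound kF kG aA bA ab; rewrite /kappa.
rewrite (@find_index w (1 :: hF (mn a)) (V (h a))) ?inE //; last exact: good_main.
rewrite (@find_index w (1 :: hF (mn b)) (V (h b))) ?inE //; last exact: good_main.
rewrite -(index_filter_le (p := predC isI)) //; last exact: good_main.
rewrite filter_visw wv !(index_map inlV_inj).
have inj : {in v &, injective h} by move=> c d; rewrite !(perm_mem vE); exact: main_inj.
by rewrite !index_map_in.
Qed.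

Lemma good_compl v : perm_eq v evA -> linext precA v ->
  exists w, [/\ good w, imax M w, value M w = 1%R & visw w = map h v].
Proof.
move=> vE vl; have [vF [vFE vFl vFm vFg]] := order_compl vE vl.
(* [nmain] marks the events that have a partner in [G]. On these [nu] inverts [mu]; elsewhere it
   returns [x] itself. *)
pose nmain x := x \in map mu evG.
pose nu x := nth x [seq y <- evG | mu y == x] 0.
have nuP x : nmain x -> nu x \in evG /\ mu (nu x) = x.
  case/mapP => y yG xE; rewrite /nu; case EE: [seq y <- evG | mu y == x] => [|z s].
    have : y \in [seq y <- evG | mu y == x] by rewrite mem_filter yG xE eqxx.
    by rewrite EE.
  have : z \in [seq y <- evG | mu y == x] by rewrite EE mem_head.
  by rewrite mem_filter => /andP[/eqP].
have nmu y : y \in evG -> nmain (mu y) by move=> yG; exact: map_f.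
have numu y : y \in evG -> nu (mu y) = y.
  by move=> yG; have [? ?] := nuP _ (nmu _ yG); exact: mu_inj.
have muvF y : y \in evG -> mu y \in [seq x <- vF | nmain x].
  by move=> yG; rewrite mem_filter nmu // (perm_mem vFE) muF.
have uvF : uniq vF by rewrite (perm_uniq vFE); exact: (rz_uniq RF).
have nu_in : {in [seq x <- vF | nmain x] &, injective nu}.
  move=> x y; rewrite !mem_filter => /andP[/nuP[_ xE] _] /andP[/nuP[_ yE] _] E'.
  by rewrite -xE -yE E'.
pose vG := map nu [seq x <- vF | nmain x].
have vGE : perm_eq vG evG.
  apply: uniq_perm; [by rewrite map_inj_in_uniq // filter_uniq|exact: (rz_uniq RG)|].
  move=> y; apply/mapP/idP => [[x]|yG]; first by rewrite mem_filter => /andP[/nuP[? _] _] ->.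
  by exists (mu y); rewrite ?numu //; exact: muvF.
have vGl : linext precC vG.
  move=> x y; rewrite !(perm_mem vGE) => xG yG xy.
  rewrite -{1}(numu _ xG) -{1}(numu _ yG) !index_map_in ?muvF //.
  rewrite index_filter_le ?nmu ?(perm_mem vFE) ?muF //; exact: vFg.
(* The order [vF] read as a schedule for [F | G]: a paired event becomes a synchronisation and a
   main event a visible step. *)
pose s : seq lab := [seq (if nmain x then X (hF x) (hG (nu x)) else V (1 :: hF x)) | x <- vF].
have sP : all inP s by apply/allP => l /mapP[x _ ->]; case: (nmain x).
have sS : all sched s by apply/allP => l /mapP[x _ ->]; case: (nmain x).
have ps1 : p1 s = map inl (map hF vF).
  by rewrite /s; elim: (vF) => //= x t IH; rewrite p1_cons; case: (nmain x); rewrite /= IH.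
have ps2 : p2 s = map inl (map hG vG).
  by rewrite /s /vG; elim: (vF) => //= x t IH; rewrite p2_cons; case: (nmain x); rewrite /= IH.
have vs : visw s = map h v.
  have -> : map h v = [seq 1 :: hF x | x <- map mn v] by rewrite -map_comp.
  rewrite /s -vFm; elim: (vF) => //= x t IH; rewrite -/(nmain x).
  by case: (nmain x) => /=; rewrite /visw /= in IH *; rewrite IH.
have [wF [wFS exwF wwF]] := rz_compl RF vFE vFl.
have [wG [wGS exwG wwG]] := rz_compl RG vGE vGl.
have [||w [wP pw1 pw2 fw]] := @merge_words wF wG s sP sS.
- by rewrite ps1 visw_V.
- by rewrite ps2 visw_V.
have ws l : sched l -> (l \in w) = (l \in s) by move=> ls; rewrite -fw mem_filter ls.
have sV i : V i \in s -> exists2 a, a \in evA & i = 1 :: hF (mn a).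
  case/mapP => x xv; case: (boolP (nmain x)) => // nx [->].
  have := xv; rewrite (perm_mem vFE) => /evFP[[a aA ->]|[y yG xE]]; first by exists a.
  by move: nx; rewrite xE nmu.
have Vs a : a \in evA -> V (1 :: hF (mn a)) \in s.
  move=> aA; apply/mapP; exists (mn a); first by rewrite (perm_mem vFE) mnF.
  by case: (boolP (nmain _)) => // /mapP[y yG /(mn_mu aA yG)].
have infoM a n e : a \in evA -> info F (hF (mn a)) = Some (n, e) ->
    match n with inl u => is_true (u \notin L) | inr k => exists2 b, b \in evA & k = hF (mn b) end.
  move=> aA; have [m ->] := rz_info RF (mnF aA) => rm [? _]; subst m.
  have := srM aA; case: (srA a) rm => [u|b]; case: n => [k|k] /=.
  - by move=> <- [[->]].
  - by case=> b _ [_ ->] [].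
  - by move=> <- [].
  - by case=> c cF [-> ->] [[->] bA]; exists b.
have exw : ex M w.
  rewrite /M ex_nus; apply/andP; split; last first.
    apply/allP => -[i|//]; rewrite ws // => /sV[a aA ->] /=.
    case EE: (info F _) => [[[n|k] e]|] //=; exact: (infoM _ _ _ aA EE).
  rewrite /= wP pw1 pw2 exwF exwG /=; apply/allP => l lw.
  case/inPP: (allP wP _ lw) (lw) => [[i|[i j]]|[i|[i j]]|i j] //=; rewrite ws //.
  + case/sV => a aA [->]; have [m mE _] := rz_info RF (mnF aA); rewrite mE.
    case: m mE => // k mE /=; have [b bA ->] := infoM _ _ _ aA mE.
    by rewrite ws //; exact: Vs.
  + by case/sV => a aA [].
  + case/mapP => x xv; case: (boolP (nmain x)) => // nx [-> ->].
    have [yG xE] := nuP _ nx; have [n [iE _ _ smy]] := infoG yG.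
    have [m [_ _ _ ple]] := srG yG.
    rewrite -{1}xE iE (infoF (muF yG) smy) /= eqxx andbT; exact/eqP.
have nl2 l : V l \in p2 w -> exists2 y, y \in evG & l = hG y by apply: visG; rewrite pw2.
exists w; split.
- by split; rewrite ?pw1 ?pw2.
- rewrite /M imax_nus /= pw1 pw2 (imax_mem _ (perm_mem wFS)) (imax_mem _ (perm_mem wGS)) imF imG /=.
  apply/allP => i ia; apply/allP => j; rewrite (actv_mem _ (perm_mem wGS)) => ja; apply/negP.
  case Ei: (info F i) => [[n e]|] //; case Ej: (info G j) => [[n' e']|] // nme.
  (* An active action of [G] that had a match would have a denoted name and thus appear among the
     residual actions of [G], which are empty. *)
  have [g rng] : exists g, rn inl evG hG n' g.
    case: n' Ej nme => [k|k] Ej; first by exists (inl k).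
    case: n Ei => [u|u] Ei /=; first by rewrite andbF.
    by case/andP => _ /mem_p2X /nl2[y yG ->]; exists (inr y), y.
  have : (e', g) \in [::] by apply/(rz_N RG); exists j, n'.
  by [].
- by rewrite /M val_nus /= pw1 pw2 (val_mem _ (perm_mem wFS)) (val_mem _ (perm_mem wGS)) vF1 vG1 mulr1.
- by rewrite -visw_sched fw.
Qed.

Lemma core_den : den srA plA precA precA inl M evA NA.
Proof.
have [v0 v0E v0l] := order_ex; have [S [gS imS vS visS]] := good_compl v0E v0l.
have [exS pSF pSG] := gS.
have [wP eF eG pww [nc nf]] := good_parts gS.
have gperm w : perm_eq w S -> ex M w -> good w.
  move=> wS exw; split=> //; [apply: (perm_trans _ pSF)|apply: (perm_trans _ pSG)]; exact: perm_pmap.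
have rnE n a : rn inl evF hF n (sr (mn a)) -> a \in evA -> exists2 n', obind (nHide L) (nLift 1 n) = Some n' & rn inl evA h n' (srA a).
  move=> + aA; have := srM aA; case: (srA a) => [u|b] [-> uL]; case: n => [k|k] /=.
  - by case=> ->; exists (inl u); rewrite // (negbTE uL).
  - by case=> c _ [].
  - by [].
  - by case=> c cF [-> [<-]]; exists (inr (h b)) => //; exists b.
exists S, h; split=> //.
- split=> //.
  + exact: main_inj.
  + exact: good_vis.
  + move=> a aA; have [n nE rnn] := rz_info RF (mnF aA); have [n' n'E rn'] := rnE n a rnn aA.
    exists n' => //; rewrite /M info_nus /= nE mapn_comp -(plM aA); exact: mapn_some.
  + move=> w wS exw; have gw := gperm w wS exw.
    have [v wv vE] := perm_map_ex (good_vis gw); exists v; split=> //; exact: (good_order gw wv vE).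
  + move=> v vE vl; have [w [gw _ _ ww]] := good_compl vE vl; exists w; split=> //.
      exact: good_perm.
    by case: gw.
  + move=> e g; split.
      move=> eN; have [a aA gE] := NAP eN; subst g.
      move: eN; rewrite -NFA // => /(rz_N RF)[i [n [ia nE rnn]]].
      case: n nE rnn => [k|k] nE; first by case.
      case=> b bF [kE [bE]]; subst b k.
      exists (1 :: i), (inr (h a)); split.
      * by rewrite /M actv_nus /= mem_cat (actv_mem _ (perm_mem pSF)) map_f.
      * by rewrite /M info_nus /= nE.
      * by exists a.
    case=> i [n [ia iE rnn]]; move: ia iE; rewrite /M actv_nus info_nus /= mem_cat => /orP[]/mapP[j ja ->].
      rewrite (actv_mem _ (perm_mem pSF)) in ja.
      case EE: (info F j) => [[[k|k] e']|] //=.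
        have : (e', inl k) \in NF by apply/(rz_N RF); exists j, (inl k).
        by case/NFP.
      move=> [nE eE]; subst n e'; case: rnn => a aA [[kE] gE]; subst k g.
      by rewrite -NFA //; apply/(rz_N RF); exists j, (inr (hF (mn a))); split=> //; exists (mn a) => //; exact: mnF.
    rewrite (actv_mem _ (perm_mem pSG)) in ja.
    case EE: (info G j) => [[[k|k] e']|] //=.
      have : (e', inl k) \in ([::] : seq (bool * (nat + E))) by apply/(rz_N RG); exists j, (inl k).
      by [].
    by move=> [nE eE]; subst n e'; case: rnn => a aA [].
- move=> w exw; rewrite /M imax_nus val_nus => /and3P[imw1 imw2 _] vw.
  have exP : ex (Par F G) w by move: exw; rewrite /M ex_nus => /andP[].
  have /and4P[_ eF' eG' _] := exP.
  apply: good_perm => //; split=> //.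
    by apply: unF => //; apply: contra vw => /eqP /= ->; rewrite mul0r.
  by apply: unG => //; apply: contra vw => /eqP /= ->; rewrite mulr0.
Qed.

End Witness.

Lemma den_core : den srA plA precA precA inl M evA NA.
Proof.
case: dF => SF [hF [exF imF vF1 RF unF]]; case: dG => SG [hG [exG imG vG1 RG unG]].
by apply: (core_den imF vF1 RF unF imG vG1 RG unG).
Qed.
End Core.

Lemma sorted_key_index (A : eqType) (key : A -> nat) (s : seq A) x y :
  sorted (relpre key leq) s -> x \in s -> y \in s -> key x < key y -> index x s <= index y s.
Proof.
move=> ss xs ys lt; rewrite leqNgt; apply/negP => yx.
have tr : transitive (relpre key leq) by move=> a b c; exact: leq_trans.
have := sorted_ltn_index tr ss _ _ ys xs yx; by rewrite /= leqNgt lt.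
Qed.

Lemma foldr_maxn_leq (s : seq nat) u : u \in s -> u <= foldr maxn 0 s.
Proof.
elim: s => //= x s IH; rewrite in_cons leq_max => /orP[/eqP->|/IH->]; by rewrite ?leqnn ?orbT.
Qed.

Lemma flatten_nils (A B : Type) (s : seq A) : flatten [seq ([::] : seq B) | _ <- s] = [::].
Proof. by elim: s. Qed.

Section Impl.
Variable K : comPzSemiRingType.
Variable T : trace.
Notation n := (tn T).
Notation ev := 'I_(tn T).

(* The linear prefixes of {T}: [Main a] is the action of the event a; [Xi b a]
   and [Yo a c] are the prefixes x_ba and ~y_ac around it in A_a; [Yi a b] and
   [Xo a b] are the two prefixes of the relay y_ab.~x_ab. *)
Definition eT := (ev + (bool * bool) * (ev * ev))%type.
Definition Main (a : ev) : eT := inl a.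
Definition Xi (b a : ev) : eT := inr ((false, false), (b, a)).
Definition Yo (a c : ev) : eT := inr ((false, true), (a, c)).
Definition Yi (a c : ev) : eT := inr ((true, false), (a, c)).
Definition Xo (a c : ev) : eT := inr ((true, true), (a, c)).

Definition eg (x : (nat + ev)%type) : (nat + eT)%type :=
  match x with inl u => inl u | inr b => inr (Main b) end.
(** In a tag [(g, k)], [g] distinguishes the relays from the processes [A_a], and [k] marks the
    negative polarity. The name is an [x] when the two agree and a [y] otherwise. *)
Definition esr (x : eT) : (nat + eT)%type :=
  match x with
  | inl a => eg (tsrc a)
  | inr ((g, k), (a, b)) => inl (if g == k then xn a b else yn a b)
  end.
Definition epl (x : eT) : bool := match x with inl a => tpol a | inr ((_, k), _) => ~~ k end.
(** Sends a prefix of a relay to its partner in the forest: [Yi] to [Yo] and [Xo] to [Xi]. *)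
Definition mu (x : eT) : eT := match x with inr ((_, k), p) => inr ((false, ~~ k), p) | _ => x end.
(* The least order that makes [tle] visible: x_ba before a before ~y_ac, and
   y_ab before ~x_ab. *)
Definition precS (x y : eT) : bool :=
  match x, y with
  | inr ((false, false), (b, a)), inl a' => a == a'
  | inl a, inr ((false, true), (a', c)) => a == a'
  | inr ((true, false), p), inr ((true, true), q) => p == q
  | _, _ => false
  end.
Definition isF (x : eT) : bool := if x is inr ((true, _), _) then false else true.
(* The event in whose process A_a the prefix lies, and its rank there. *)
Definition ow (x : eT) : ev :=
  match x with inl a => a | inr ((_, false), (b, a)) => a | inr ((_, true), (a, c)) => a end.
Definition rk (x : eT) : nat :=
  match x with inl a => n | inr ((_, false), (b, a)) => b | inr ((_, true), (a, c)) => n.+1 end.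
(** Ranks order the prefixes of one process. Across processes, the prefixes up to the main action
    precede everything that belongs to a larger event; the [Yo], of rank [n.+1], run in parallel
    with the sub-processes and are exempt. Asking for [tlt] where ancestry would do is harmless,
    since [precC] only limits the schedules that must be executable. *)
Definition precC (x y : eT) : bool :=
  if isF x && isF y then ((rk x <= n) && tlt (ow x) (ow y)) || ((ow x == ow y) && (rk x < rk y))
  else match x, y with
       | inr ((true, false), p), inr ((true, true), q) => p == q
       | _, _ => false
       end.
Definition valid (x : eT) : bool := if x is inr (_, (a, b)) then tlt a b else true.

Lemma tlt_le a b : tlt a b -> @tle T a b. Proof. by case/andP. Qed.
Lemma tlt_tle_trans a b c : @tlt T a b -> tle b c -> tlt a c.
Proof.
case/andP => ab le bc; apply/andP; split; last exact: tle_trans le bc.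
by apply: contra ab => /eqP ac; apply/eqP; apply: (@tle_anti T); rewrite le ac bc.
Qed.
Lemma tlt_irr a : @tlt T a a = false. Proof. by rewrite /tlt eqxx. Qed.

Lemma xn_base (a b : ev) : fbase T <= xn a b. Proof. by rewrite /xn leq_addr. Qed.
Lemma yn_base (a b : ev) : fbase T <= yn a b. Proof. by rewrite /yn -addnA leq_addr. Qed.
Lemma zn_base (a : ev) : fbase T <= zn a. Proof. by rewrite /zn -addnA leq_addr. Qed.
Lemma src_base a u : @tsrc T a = inl u -> u < fbase T.
Proof.
move=> E; rewrite ltnS; apply: foldr_maxn_leq; rewrite mem_cat; apply/orP; left.
by apply/mapP; exists a; rewrite ?mem_enum // E.
Qed.
Lemma pair_code (a b c d : ev) : a * n + b = c * n + d -> (a, b) = (c, d).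
Proof.
move=> E; have n0 : 0 < n by apply: leq_ltn_trans (leq0n a) (ltn_ord a).
have := congr1 (divn^~ n) E; rewrite !divnMDl // !divn_small ?ltn_ord // !addn0 => ac.
have := congr1 (modn^~ n) E; rewrite !modnMDl !modn_small ?ltn_ord // => bd.
by congr (_, _); apply: val_inj.
Qed.
Lemma xn_inj (a b c d : ev) : xn a b = xn c d -> (a, b) = (c, d).
Proof. rewrite /xn => E; apply: pair_code; lia. Qed.
Lemma yn_inj (a b c d : ev) : yn a b = yn c d -> (a, b) = (c, d).
Proof. rewrite /yn => E; apply: pair_code; lia. Qed.
Lemma xn_yn (a b c d : ev) : xn a b <> yn c d. Proof. rewrite /xn /yn; lia. Qed.
Lemma xn_zn (a b c : ev) : xn a b <> zn c. Proof. rewrite /xn /zn; lia. Qed.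
Lemma yn_zn (a b c : ev) : yn a b <> zn c. Proof. rewrite /yn /zn; lia. Qed.

Lemma restrictedP u : u \in restricted T <-> exists a b : ev, u = xn a b \/ u = yn a b.
Proof.
split.
  case/flatten_mapP => -[a b] _; rewrite !inE => /orP[]/eqP->; exists a, b; by [left|right].
case=> a [b E]; apply/flatten_mapP; exists (a, b).
  by apply: allpairs_f; rewrite mem_enum.
by rewrite !inE; case: E => ->; rewrite eqxx ?orbT.
Qed.

Lemma base_restricted u : u < fbase T -> u \notin restricted T.
Proof.
move=> uf; apply/negP => /restrictedP[a [b [E|E]]]; move: uf; rewrite E ltnNge.
  by rewrite xn_base.
by rewrite yn_base.
Qed.

Definition par (d : ev) : option ev := if tsrc d is inr b then Some b else None.
Definition anc (k : nat) (d : ev) : option ev := iter k (obind par) (Some d).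

Lemma par_lt d b : par d = Some b -> tlt b d.
Proof. by rewrite /par; case E: (tsrc d) => [u|c] // [<-]; exact: tsrc_lt. Qed.

Lemma anc_le k d a : anc k d = Some a -> tle a d.
Proof.
elim: k a => [|k IH] a /=; first by move=> [->]; exact: tle_refl.
rewrite -/(anc k d); case E: (anc k d) => [c|] //= /par_lt /tlt_le ac.
exact: tle_trans ac (IH c E).
Qed.

Lemma anc_add k m d c : anc k d = Some c -> anc (m + k) d = anc m c.
Proof. by rewrite /anc iterD => ->. Qed.

Lemma anc_parS m c : anc m.+1 c = obind (anc m) (par c).
Proof. by rewrite /anc iterSr /=; case: (par c) => //; elim: m => //= m ->. Qed.

(** If the two differed, one would be a proper ancestor of the other, hence at most their common
    parent, which is strictly smaller than it. So distinct siblings have disjoint subtrees. *)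
Lemma sib_disj k k' d c c' : anc k d = Some c -> anc k' d = Some c' -> par c = par c' -> c = c'.
Proof.
wlog kk : k k' c c' / k <= k'.
  by move=> H h1 h2 pp; case: (leqP k k') => [/H|/ltnW/H]; [apply|move=> h; apply/esym/h].
move=> h1 h2 pp; move: h2; rewrite -(subnK kk) (anc_add _ h1).
case: (k' - k) => [[]//|m]; rewrite anc_parS pp.
case E: (par c') => [b|] //= /anc_le cb.
by have := tlt_tle_trans (par_lt E) cb; rewrite tlt_irr.
Qed.

(** Each generation has strictly fewer strict predecessors than the next. The bound shows that the
    fuel [n.+1] in [impl] reaches every event. *)
Lemma anc_root d : exists k r, [/\ k <= #|[pred b | tlt b d]|, anc k d = Some r & isname (tsrc r)].
Proof.
have [m] := ubnP #|[pred b | tlt b d]|; elim: m d => // m IH d; rewrite ltnS => dm.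
case E: (tsrc d) => [u|b]; first by exists 0, d; rewrite E.
have bd : tlt b d by exact: tsrc_lt.
have lt : #|[pred c | tlt c b]| < #|[pred c | tlt c d]|.
  apply: proper_card; apply/properP; split.
    by apply/subsetP => c; rewrite !inE => cb; apply: tlt_tle_trans cb (tlt_le bd).
  by exists b; rewrite !inE ?tlt_irr.
have [k [r [kb kr rn]]] := IH b (leq_trans lt dm).
exists k.+1, r; split=> //; first exact: leq_ltn_trans lt.
by rewrite anc_parS /par E.
Qed.

(** Written in the shape that [den_lin] and [den_ppar] produce; the final [[::]] is the share of the
    actions from [N], which contain no event. *)
Fixpoint evT (f : nat) (a : ev) : seq eT :=
  if f is f'.+1 then
    [seq Xi b a | b <- [seq b <- enum ev | tlt b a]] ++
    Main a :: (flatten [seq [:: Yo a c] | c <- [seq c <- enum ev | tlt a c]] ++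
               (flatten [seq evT f' c | c <- [seq c <- enum ev | tsrc c == inr a]] ++ [::]))
  else [::].
Fixpoint NT (f : nat) (a : ev) : seq (bool * (nat + eT)) :=
  if f is f'.+1 then
    flatten [seq NT f' c | c <- [seq c <- enum ev | tsrc c == inr a]] ++
    flatten [seq [:: (x.1, inr (Main a))] | x <- [seq x <- tN T | x.2 == inr a]]
  else [::].

Lemma mem_evT f a x : x \in evT f a <-> [/\ isF x, valid x & exists2 k, k < f & anc k (ow x) = Some a].
Proof.
elim: f a x => [|f IH] a x /=; first by split=> // -[_ _ [k]].
split.
  rewrite mem_cat => /orP[/mapP[b]|].
    by rewrite mem_filter => /andP[ba _] ->; split=> //; exists 0.
  rewrite in_cons => /orP[/eqP->|]; first by split=> //; exists 0.
  rewrite cats0 mem_cat => /orP[/flatten_mapP[c]|/flatten_mapP[c]].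
    by rewrite mem_filter => /andP[ac _]; rewrite inE => /eqP->; split=> //; exists 0.
  rewrite mem_filter => /andP[/eqP ca _] /IH[xF xv [k kf kc]]; split=> //.
  by exists k.+1; rewrite // -add1n (anc_add _ kc) /= /par ca.
case=> xF xv [[|k] kf /=].
  case: x xF xv => [a'|[[[] []] [b c]]] //= _ bc [E]; subst.
  - by rewrite mem_cat mem_head orbT.
  - rewrite mem_cat in_cons cats0 mem_cat; apply/orP; right; apply/orP; right; apply/orP; left.
    by apply/flatten_mapP; exists c; [rewrite mem_filter bc mem_enum|rewrite inE].
  - by rewrite mem_cat; apply/orP; left; apply: map_f; rewrite mem_filter bc mem_enum.
rewrite -/(anc k _); case E: (anc k (ow x)) => [c|] //= pc.
rewrite mem_cat in_cons cats0 mem_cat; apply/orP; right; apply/orP; right; apply/orP; right.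
apply/flatten_mapP; exists c; last by apply/IH; split=> //; exists k.
by rewrite mem_filter mem_enum andbT; move: pc; rewrite /par; case: (tsrc c) => // b [->].
Qed.

Lemma mem_NT f a e g : (e, g) \in NT f a <->
  exists d, [/\ g = inr (Main d), (e, inr d) \in tN T & exists2 k, k < f & anc k d = Some a].
Proof.
elim: f a g => [|f IH] a g /=; first by split=> // -[d [_ _ [k]]].
rewrite mem_cat; split.
  case/orP => /flatten_mapP[x]; rewrite mem_filter => /andP[].
    move=> /eqP ca _ /IH[d [-> dN [k kf kc]]]; exists d; split=> //.
    by exists k.+1; rewrite // -add1n (anc_add _ kc) /= /par ca.
  case: x => e' g' /= /eqP -> xN; rewrite inE => /eqP[-> ->]; exists a; split=> //; by exists 0.
case=> d [-> dN [[|k] kf /=]].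
  case=> E; subst; apply/orP; right; apply/flatten_mapP; exists (e, inr a); last by rewrite inE.
  by rewrite mem_filter dN eqxx.
rewrite -/(anc k d); case E: (anc k d) => [c|] //= pc; apply/orP; left.
apply/flatten_mapP; exists c; last by apply/IH; exists d; split=> //; exists k.
by rewrite mem_filter mem_enum andbT; move: pc; rewrite /par; case: (tsrc c) => // b [->].
Qed.

Definition envok (rho : nat -> (nat + eT)%type) (a : ev) : Prop :=
  [/\ forall u, u < fbase T -> rho u = inl u,
      forall b c : ev, rho (xn b c) = inl (xn b c),
      forall b c : ev, rho (yn b c) = inl (yn b c) &
      forall b, tsrc a = inr b -> rho (zn b) = inr (Main b)].

Notation eden := (@den K eT esr epl precS precC).

(** The prefixes [x_ba] are nested by increasing [b], in agreement with the rank [b] of [Xi b a]. *)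
Lemma pairwise_enum (p : pred ev) : pairwise (fun b c : ev => b < c) [seq b <- enum ev | p b].
Proof.
apply: pairwise_filter; rewrite -(pairwise_map (val : ev -> nat) ltn) val_enum_ord.
by rewrite -sorted_pairwise ?iota_ltn_sorted //; exact: ltn_trans.
Qed.

Lemma den_implA f a rho : envok rho a -> eden rho (implA K f a) (evT f a) (NT f a).
Proof.
elim: f a rho => [|f IH] a rho [rb rx ry rz]; first exact: den_const1.
rewrite [implA _ _ _]/=.
set cont := (Y in close _ Y).
(* Below the main action the name [z_a] denotes the object of the event [a]. *)
pose rho2 i := if i == zn a then inr (Main a) else rho i.
have ok2 c : tsrc c = inr a -> envok rho2 c.
  move=> ca; split; rewrite /rho2.
  - by move=> u uf; case: eqP => [E|_]; [move: uf; rewrite E ltnNge zn_base|exact: rb].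
  - by move=> b d; case: eqP => [/xn_zn//|_]; exact: rx.
  - by move=> b d; case: eqP => [/yn_zn//|_]; exact: ry.
  - by move=> b; rewrite ca => -[<-]; rewrite eqxx.
pose ev1 := flatten [seq [:: Yo a c] | c <- [seq c <- enum ev | tlt a c]].
pose ev2 := flatten [seq evT f c | c <- [seq c <- enum ev | tsrc c == inr a]].
have ev1P x : x \in ev1 -> exists c, x = Yo a c.
  by case/flatten_mapP => c _; rewrite inE => /eqP->; exists c.
have ev2P x : x \in ev2 -> isF x /\ tlt a (ow x).
  case/flatten_mapP => c; rewrite mem_filter => /andP[/eqP ca _] /mem_evT[xF _ [k _ /anc_le kc]].
  by split=> //; apply: tlt_tle_trans kc; exact: tsrc_lt.
have d1 : eden rho2 (prodP [seq lin0 (yn a c) false (Const 1%R) | c <- [seq c <- enum ev | tlt a c]]) ev1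
    (flatten [seq [::] | c <- [seq c <- enum ev | tlt a c]]).
  apply: (den_prodP (evs := fun c => [:: Yo a c]) (Ns := fun=> [::])).
  - move=> c _; apply: (@den_lin0 K eT esr epl precS precC rho2 (yn a c) _ (Yo a c)) => //.
      exact: den_const1.
    by rewrite /= /rho2; case: eqP => [/yn_zn//|_]; rewrite ry.
  - by rewrite filter_uniq ?enum_uniq.
  - move=> c c' _ _ cc x y; rewrite !inE => /eqP-> /eqP->; split=> //.
    by apply: contra cc => /eqP[->].
have d2 : eden rho2 (prodP [seq implA K f c | c <- [seq c <- enum ev | tsrc c == inr a]]) ev2
    (flatten [seq NT f c | c <- [seq c <- enum ev | tsrc c == inr a]]).
  apply: den_prodP.
  - by move=> c; rewrite mem_filter => /andP[/eqP ca _]; apply: IH; exact: ok2.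
  - by rewrite filter_uniq ?enum_uniq.
  - move=> c c'; rewrite !mem_filter => /andP[/eqP ca _] /andP[/eqP ca' _] cc x y.
    move=> /mem_evT[xF _ [k _ kc]] /mem_evT[yF _ [k' _ kc']].
    (* Siblings have disjoint subtrees, and in the forest [precS] relates only prefixes with the
       same owner. *)
    have no : ow x <> ow y.
      move=> E; move: kc'; rewrite -E => kc'; case/eqP: cc.
      by apply: sib_disj kc kc' _; rewrite /par ca ca'.
    split; first by apply/eqP => E; apply: no; rewrite E.
    apply/negP; case: x y xF yF no {kc kc'} => [b|[[[] []] [b d]]] [b'|[[[] []] [b' d']]] //= _ _ no /eqP //.
have d3 : eden rho2 (prodP [seq act0 (zn a) x.1 (Const 0%R) | x <- [seq x <- tN T | x.2 == inr a]])
    (flatten [seq [::] | x <- [seq x <- tN T | x.2 == inr a]])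
    (flatten [seq [:: (x.1, inr (Main a))] | x <- [seq x <- tN T | x.2 == inr a]]).
  apply: (den_prodP (evs := fun=> [::]) (Ns := fun x => [:: (x.1, inr (Main a))])) => //.
  - move=> x _; have := @den_act0 K eT esr epl precS precC rho2 (zn a) x.1.
    by rewrite {2}/rho2 eqxx.
  - by rewrite filter_uniq ?tN_uniq.
have dcont : eden rho2 cont (ev1 ++ (ev2 ++ [::])) (NT f.+1 a).
  rewrite flatten_nils in d1; rewrite flatten_nils in d3.
  apply: (den_ppar d1).
  - by apply: (den_ppar d2 d3) => // x y _ /orP[]/andP[].
  - by move=> x /ev1P[c ->]; rewrite cats0; apply/negP => /ev2P[_]; rewrite /= tlt_irr.
  - move=> x y xy; rewrite cats0 => /orP[/andP[/ev1P[c E]]|/andP[/ev2P[xF ax] /ev1P[c E]]]; first by rewrite E in xy.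
    by rewrite E in xy; case: x xy ax xF => [b|[[[] []] [b d]]] //= /eqP->; rewrite tlt_irr.
have restP x : x \in ev1 ++ (ev2 ++ [::]) -> isF x /\ ((exists c, x = Yo a c) \/ tlt a (ow x)).
  rewrite cats0 mem_cat => /orP[/ev1P[c ->]|/ev2P[xF ax]]; first by split=> //; left; exists c.
  by split=> //; right.
have dmain : eden rho (lin (subj a) (tpol a) (close (zn a) cont)) (Main a :: (ev1 ++ (ev2 ++ [::]))) (NT f.+1 a).
  apply: (@den_lin_close K eT esr epl precS precC rho (subj a) (zn a) cont (Main a)).
  - exact: dcont.
  - rewrite /= /subj; case E: (tsrc a) => [u|b] /=; first by rewrite rb //; exact: src_base E.
    by rewrite rz.
  - by apply/negP => /restP[_ [[c]//|]]; rewrite /= tlt_irr.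
  - move=> x /restP[xF h]; rewrite /precC xF /= leqnn /=.
    by case: h => [[c ->]|->//]; rewrite /= eqxx ltnSn orbT.
  - move=> x /restP[xF h]; apply/negP; case: x xF h => [b|[[[] []] [b d]]] //= _ h /eqP E; subst d.
    by case: h => [[c] []|]; rewrite ?tlt_irr.
rewrite [evT _ _]/= -/ev1 -/ev2.
have := pairwise_enum (fun b => tlt b a).
elim: [seq b <- enum ev | tlt b a] => [|b bs IHb] /=; first by move=> _; exact: dmain.
case/andP => /allP bbs /IHb dbs.
apply: (@den_lin0 K eT esr epl precS precC rho (xn b a) _ (Xi b a)).
- exact: dbs.
- by rewrite /= rx.
- rewrite mem_cat in_cons negb_or; apply/andP; split.
    by apply/negP => /mapP[b' /bbs lt [E]]; rewrite E ltnn in lt.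
  by apply/negP => /orP[//|/restP[_ [[c]//|]]]; rewrite /= tlt_irr.
- move=> x; rewrite mem_cat in_cons => /orP[/mapP[b' b'b ->]|/orP[/eqP->|/restP[xF h]]].
  + by rewrite /precC /= eqxx (bbs _ b'b) orbT.
  + by rewrite /precC /= eqxx ltn_ord orbT.
  + rewrite /precC xF /= ltnW ?ltn_ord //=.
    by case: h => [[c ->]|->//]; rewrite /= eqxx ltnS ltnW ?ltn_ord ?orbT.
- by move=> x _; case: x => [?|[[[] []] [? ?]]].
Qed.

Definition roots := [seq a <- enum ev | isname (tsrc a)].
Definition forest : term K := prodP [seq implA K n.+1 a | a <- roots].
Definition links : seq (ev * ev) := [seq p <- evpairs T | tlt p.1 p.2].
Definition relay : term K :=
  prodP [seq lin0 (yn p.1 p.2) true (lin0 (xn p.1 p.2) false (Const 1%R)) | p <- links].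
Definition evF := flatten [seq evT n.+1 a | a <- roots].
Definition NF := flatten [seq NT n.+1 a | a <- roots].
Definition evG : seq eT := flatten [seq [:: Yi p.1 p.2; Xo p.1 p.2] | p <- links].

Lemma depth_lt d : #|[pred b | @tlt T b d]| < n.+1.
Proof. by rewrite ltnS -[leqRHS](card_ord n); exact: max_card. Qed.

Lemma mem_evF x : x \in evF <-> isF x /\ valid x.
Proof.
split; first by case/flatten_mapP => a _ /mem_evT[].
case=> xF xv; have [k [r [kb kr rn]]] := anc_root (ow x).
apply/flatten_mapP; exists r; first by rewrite mem_filter rn mem_enum.
by apply/mem_evT; split=> //; exists k => //; exact: leq_ltn_trans kb (depth_lt _).
Qed.

Lemma mem_NF e g : (e, g) \in NF <-> exists2 d, g = inr (Main d) & (e, inr d) \in tN T.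
Proof.
split; first by case/flatten_mapP => a _ /mem_NT[d [-> dN _]]; exists d.
case=> d -> dN; have [k [r [kb kr rn]]] := anc_root d.
apply/flatten_mapP; exists r; first by rewrite mem_filter rn mem_enum.
by apply/mem_NT; exists d; split=> //; exists k => //; exact: leq_ltn_trans kb (depth_lt _).
Qed.

Lemma mem_links a b : ((a, b) \in links) = tlt a b.
Proof.
rewrite mem_filter /= andb_idr // => _; by apply: allpairs_f; rewrite mem_enum.
Qed.

Lemma links_uniq : uniq links.
Proof.
by apply: filter_uniq; apply: allpairs_uniq; rewrite ?enum_uniq // => -[a b] [c d].
Qed.

Lemma evGP x : x \in evG <-> exists a b, tlt a b /\ (x = Yi a b \/ x = Xo a b).
Proof.
split.
  case/flatten_mapP => -[a b]; rewrite mem_links => ab; rewrite !inE => /orP[]/eqP->; exists a, b; split=> //;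
    [by left|by right].
case=> a [b [ab h]]; apply/flatten_mapP; exists (a, b); first by rewrite mem_links.
by rewrite !inE; case: h => ->; rewrite eqxx ?orbT.
Qed.

Lemma den_forest : eden inl forest evF NF.
Proof.
apply: den_prodP.
- move=> a; rewrite mem_filter => /andP[an _]; apply: den_implA; split=> // b E.
  by rewrite E in an.
- by rewrite filter_uniq ?enum_uniq.
- move=> c c'; rewrite !mem_filter => /andP[ca _] /andP[ca' _] cc x y.
  move=> /mem_evT[xF _ [k _ kc]] /mem_evT[yF _ [k' _ kc']].
  have no : ow x <> ow y.
    move=> E; move: kc'; rewrite -E => kc'; case/eqP: cc.
    by apply: sib_disj kc kc' _; rewrite /par; case: (tsrc c) ca => // ? _; case: (tsrc c') ca'.
  split; first by apply/eqP => E; apply: no; rewrite E.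
  apply/negP; case: x y xF yF no {kc kc'} => [b|[[[] []] [b d]]] [b'|[[[] []] [b' d']]] //= _ _ no /eqP //.
Qed.

Lemma den_relay : eden inl relay evG [::].
Proof.
rewrite -[[::]](flatten_nils (bool * (nat + eT)) links).
apply: (den_prodP (evs := fun p => [:: Yi p.1 p.2; Xo p.1 p.2]) (Ns := fun=> [::])).
- case=> a b _ /=.
  apply: (@den_lin0 K eT esr epl precS precC inl (yn a b) _ (Yi a b)) => //.
  + apply: (@den_lin0 K eT esr epl precS precC inl (xn a b) _ (Xo a b)) => //.
    exact: den_const1.
  + by move=> x; rewrite inE => /eqP->; rewrite /precC /= eqxx.
  + by move=> x; rewrite inE => /eqP->.
- exact: links_uniq.
- move=> [a b] [c d] _ _ cc x y; rewrite !inE /= => h1 h2.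
  have {}cc : (a, b) <> (c, d) by move/eqP: cc.
  case/orP: h1 => /eqP->; case/orP: h2 => /eqP->; split=> //; apply/eqP => // -[E1 E2]; apply: cc; by rewrite E1 E2.
Qed.

Definition NA := [seq x <- tN T | ~~ isname x.2].

Lemma mu_links x : x \in evG -> mu x \in evF.
Proof. by case/evGP => a [b [ab [->|->]]]; apply/mem_evF. Qed.

(** Ranks go up to [n.+1], so blocks of length [n.+2] put all prefixes of one event before all
    prefixes of the next. *)
Lemma key_lt (v : seq ev) a b r r' : perm_eq v (enum ev) -> linext (@tle T) v ->
  tlt a b -> r <= n.+1 -> index a v * n.+2 + r < index b v * n.+2 + r'.
Proof.
move=> vE vl /andP[ne le] rn.
have inv c : c \in v by rewrite (perm_mem vE) mem_enum.
have lt : index a v < index b v.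
  rewrite ltn_neqAle vl // andbT; apply: contra ne => /eqP E; apply/eqP.
  by rewrite -(nth_index a (inv a)) E nth_index.
apply: (@leq_trans ((index a v).+1 * n.+2)); last first.
  by apply: leq_trans (leq_addr _ _); rewrite leq_mul2r lt orbT.
by rewrite mulSn addnC ltn_add2r ltnS.
Qed.

Lemma precC_key (v : seq ev) x y : perm_eq v (enum ev) -> linext (@tle T) v ->
  isF x -> isF y -> precC x y -> index (ow x) v * n.+2 + rk x < index (ow y) v * n.+2 + rk y.
Proof.
move=> vE vl xF yF; rewrite /precC xF yF /=.
case/orP => [/andP[rx lt]|/andP[/eqP-> lt]]; last by rewrite ltn_add2l.
by apply: key_lt => //; exact: leq_trans rx (leqnSn _).
Qed.

(** The number of events below an event increases strictly along the order, so sorting by it gives a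
    linear extension. *)
Lemma linext_exists : exists2 v, perm_eq v (enum ev) & linext (@tle T) v.
Proof.
pose r (a : ev) := #|[pred b | @tle T b a]|.
exists (sort (relpre r leq) (enum ev)); first by rewrite perm_sort.
move=> a b av bv ab; case: (a =P b) => [->//|/eqP ne].
apply: (@sorted_key_index _ r) => //; first by apply: sort_sorted => x y; exact: leq_total.
apply: proper_card; apply/properP; split.
  by apply/subsetP => c; rewrite !inE => ca; exact: tle_trans ca ab.
exists b; rewrite !inE ?tle_refl //; apply: contra ne => ba; apply/eqP.
by apply: (@tle_anti T); rewrite ab ba.
Qed.

(** The events are run one after the other in the order [v], each with all its prefixes, by sorting
    on the owner and then on the rank. The relays agree with this: for [a < b] the partner [Yo a b]
    lies in the block of [a] and [Xi a b] in the later block of [b]. *)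
Lemma order_compl v : perm_eq v (enum ev) -> linext (@tle T) v ->
  exists vF, [/\ perm_eq vF evF, linext precC vF,
    [seq x <- vF | x \notin map mu evG] = map Main v &
    forall x y, x \in evG -> y \in evG -> precC x y -> index (mu x) vF <= index (mu y) vF].
Proof.
move=> vE vl; pose key x := index (ow x) v * n.+2 + rk x.
have uv : uniq v by rewrite (perm_uniq vE) enum_uniq.
have inv a : a \in v by rewrite (perm_mem vE) mem_enum.
have tr : transitive (relpre key leq) by move=> a b c; exact: leq_trans.
pose vF := sort (relpre key leq) evF.
have vFs : sorted (relpre key leq) vF by apply: sort_sorted => x y; exact: leq_total.
have vFE : vF =i evF by move=> x; rewrite mem_sort.
have evF_uniq : uniq evF by have [S [h [_ _ _ R _]]] := den_forest; exact: (rz_uniq R).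
exists vF; split.
- by rewrite perm_sort.
- move=> x y xv yv xy; apply: (sorted_key_index vFs) => //.
  by apply: precC_key => //; [move: xv|move: yv]; rewrite vFE => /mem_evF[].
- have : perm_eq [seq x <- vF | x \notin map mu evG] (map Main (enum ev)).
    apply: uniq_perm.
    - by rewrite filter_uniq // sort_uniq.
    - by rewrite map_inj_uniq ?enum_uniq // => a b [].
    move=> x; rewrite mem_filter vFE; apply/andP/mapP.
      case=> nx /mem_evF[xF xv]; case: x nx xF xv => [a|[[[] k] [a b]]] //; first by exists a; rewrite ?mem_enum.
      move=> nx _ ab; case/negP: nx; apply/mapP; exists (inr ((true, ~~ k), (a, b))); last by rewrite /= negbK.
      by apply/evGP; exists a, b; split=> //; case: (k); [left|right].
    case=> a _ ->; split; last by apply/mem_evF.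
    by apply/negP => /mapP[y /evGP[b [c [_ [->|->]]]]].
  case/perm_map_ex => u uE uen; rewrite uE; congr (map Main _).
  (* The main events come out sorted by their index in [v]; a permutation of [v] with this property
     is [v]. *)
  pose le (a b : ev) := index a v <= index b v.
  apply: (@sorted_eq _ le).
  + by move=> a b c; exact: leq_trans.
  + move=> a b; rewrite /le -eqn_leq => /eqP E.
    by rewrite -(nth_index a (inv a)) E nth_index.
  + have := sorted_filter tr (fun x => x \notin map mu evG) vFs; rewrite uE sorted_map.
    by apply: sub_sorted => a b; rewrite /= /key /= leq_add2r leq_mul2r.
  + apply: pairwise_sorted; case vs: v => [//|a0 v'] /=; rewrite -[_ && _]/(pairwise le (a0 :: v')) -vs.
    apply/(pairwiseP a0) => i j iv jv ij; rewrite /le !index_uniq //; exact: ltnW.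
  + by rewrite (perm_trans uen) // perm_sym.
- move=> x y xG yG xy; apply: (sorted_key_index vFs).
  + by rewrite vFE mu_links.
  + by rewrite vFE mu_links.
  case/evGP: xG => a [b [ab xE]]; case/evGP: yG => c [d [cd yE]].
  move: xy; case: xE => ->; case: yE => -> //; rewrite /precC /= => /eqP[? ?]; subst c d.
  exact: key_lt.
Qed.

Lemma mu_evG_inj : {in evG &, injective mu}.
Proof.
by move=> x y /evGP[a [b [_ [->|->]]]] /evGP[c [d [_ [->|->]]]] // [-> ->].
Qed.

Lemma inl_eq (u v : nat) : (inl u : (nat + eT)%type) = inl v -> u = v.
Proof. by case. Qed.

Lemma src_link x y : x \in evF -> y \in evG -> esr x = esr y -> x = mu y.
Proof.
move=> /mem_evF[xF _] /evGP[a [b [_ [->|->]]]]; case: x xF => [c|[[[] []] [c d]]] //= _.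
- case E: (tsrc c) => [u|e] //= /inl_eq ue; have := src_base E; by rewrite ue ltnNge yn_base.
- by move=> /inl_eq/yn_inj[-> ->].
- by move=> /inl_eq/xn_yn.
- case E: (tsrc c) => [u|e] //= /inl_eq ue; have := src_base E; by rewrite ue ltnNge xn_base.
- by move=> /inl_eq/esym/xn_yn.
- by move=> /inl_eq/xn_inj[-> ->].
Qed.

Lemma den_sync : den (@tsrc T) (@tpol T) (@tle T) (@tle T) inl
  (nus (restricted T) (Par forest relay)) (enum ev) NA.
Proof.
apply: (den_core (mn := Main) (mu := mu) den_forest den_relay).
- exact: enum_uniq.
- by move=> a b [].
- by move=> a _; apply/mem_evF.
- exact: mu_links.
- move=> x /mem_evF[xF xv]; case: x xF xv => [a|[[[] k] [a b]]] // _ ab.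
    by left; exists a; rewrite ?mem_enum.
  right; exists (inr ((true, ~~ k), (a, b))); last by rewrite /= negbK.
  by apply/evGP; exists a, b; split=> //; case: (k); [left|right].
- by move=> a y _ /evGP[b [c [_ [->|->]]]].
- exact: mu_evG_inj.
- move=> y /evGP[a [b [ab [->|->]]]].
    by exists (yn a b); split=> //; apply/restrictedP; exists a, b; right.
  by exists (xn a b); split=> //; apply/restrictedP; exists a, b; left.
- exact: src_link.
- move=> a _; case E: (tsrc a) => [u|b]; rewrite /= E; split=> //; last by rewrite mem_enum.
  apply: base_restricted; exact: src_base E.
- by [].
- by move=> e g /mem_NF[d -> _]; exists d; rewrite ?mem_enum.
- move=> e [u|d]; rewrite mem_filter //= => dN; by exists d; rewrite ?mem_enum.
- move=> e a _; rewrite mem_filter /=; apply/idP/idP => [/mem_NF[d [->]]//|aN].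
  by apply/mem_NF; exists a.
- move=> kappa kF kG a b _ _ ab; case: (a =P b) => [->//|/eqP ne].
  have lt : tlt a b by rewrite /tlt ne.
  (* The chain is [a], then [~y_ab] in [A_a], then the relay from [y_ab] to [~x_ab], then [x_ab] in
     [A_b], then [b]. *)
  apply: (@leq_trans (kappa (Yo a b))).
    by apply: kF; rewrite /= ?eqxx //; apply/mem_evF.
  apply: (@leq_trans (kappa (Xi a b))); last by apply: kF; rewrite /= ?eqxx //; apply/mem_evF.
  apply: (kG (Yi a b) (Xo a b)); rewrite /= ?eqxx //; apply/evGP; exists a, b; split=> //; [by left|by right].
- exact: order_compl.
- exact: linext_exists.
Qed.

(** The residual actions on free names stand outside the restriction and are added by one more
    [den_ppar], with no event. *)
Lemma den_impl : den (@tsrc T) (@tpol T) (@tle T) (@tle T) inl (impl K T) (enum ev) (tN T).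
Proof.
pose Nn := [seq x <- tN T | isname x.2].
pose nmof (x : bool * (nat + ev)) := if x.2 is inl u then u else 0.
have dN : den (@tsrc T) (@tpol T) (@tle T) (@tle T) inl
   (prodP [seq act0 (nmof x) x.1 (Const (0 : K)%R) | x <- Nn]) [::]
   (flatten [seq [:: (x.1, inl (nmof x))] | x <- Nn]).
  rewrite -[[::]](flatten_nils ev Nn).
  apply: (den_prodP (evs := fun=> [::]) (Ns := fun x => [:: (x.1, inl (nmof x))])) => //.
    by move=> x _; exact: den_act0.
  by rewrite filter_uniq ?tN_uniq.
have := den_ppar den_sync dN; rewrite cats0 => h.
apply: den_eqN (h _ _).
- move=> [e g]; rewrite mem_cat mem_filter /=.
  case: g => [u|d] /=; last first.
    apply/orP/idP => [[//|/flatten_mapP[x _]]|->]; last by left.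
    by rewrite inE => /eqP.
  apply/flatten_mapP/idP => [[[e' g']]|eN].
    by rewrite mem_filter; case: g' => //= u' h1; rewrite inE => /eqP[-> ->].
  by exists (e, inl u); rewrite ?mem_filter ?eN // inE.
- by [].
- by move=> a b _ /orP[]/andP[].
Qed.

(** An instance of [decomposition] with a single index, possible because preruns of value 0 need not
    be covered. *)
Lemma decomposes_impl : decomposes (impl K T) [:: (1%R, T)].
Proof.
have [S [h [exS imS vS R un]]] := den_impl.
rewrite -vS; apply: (@decomposition K unit _ [:: tt] (fun=> S) (fun=> T)) => //.
- by move=> j _; split; [apply/presP; exists S|exists h].
- move=> U /presP[w [exw imw ->]] vw; rewrite inE; apply/eqP/canonP; apply: un => //.
  by apply: contra vw => /eqP E; rewrite (val_mem _ (mem_canon w)) E.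
Qed.

End Impl.

(** * Linearity of the outcome *)

Section Final.
Variable K : comPzSemiRingType.
Implicit Types (P Q R O : term K) (w S : seq lab).

Lemma embeds_pres P O g pre c U : embeds P O g pre c -> U \in pres P ->
  canon (pre ++ map (glab g) U) \in pres O.
Proof.
move=> em /presP[w [exw imw ->]]; apply/presP; exists (pre ++ map (glab g) w).
rewrite (em_ex em) // (em_imax em) //; split=> //.
by apply/canonP; rewrite perm_cat2l; apply: perm_map; exact: perm_canon.
Qed.

Lemma embeds_canon P O g pre c w : embeds P O g pre c ->
  canon (pre ++ map (glab g) w) = canon (pre ++ map (glab g) (canon w)).
Proof. by move=> em; apply/canonP; rewrite perm_cat2l perm_map // perm_sym perm_canon. Qed.

Lemma embeds_inj P O g pre c : embeds P O g pre c ->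
  {in pres P &, injective (fun U => canon (pre ++ map (glab g) U))}.
Proof.
move=> em a b aP bP /canonP.
rewrite perm_cat2l => /(perm_map_inj (glab_inj (em_inj em)))/canonP.
by rewrite (pres_canon aP) (pres_canon bP).
Qed.

(** The traces of [P] serve for [kdot k P] as well; only the coefficients are multiplied by [k]. *)
Lemma outcome_kdot k P R : outcome (Par (kdot k P) R) = (k * outcome (Par P R))%R.
Proof.
have [tr trP] := trace_of P; have em := kdot_embeds k P.
have dO : decomposes (kdot k P) [seq (value (kdot k P) ([::] ++ map (glab (cons 2)) U), tr U) | U <- pres P].
  apply: decomposition.
  - by move=> U UP; split; [exact: embeds_pres em UP|apply: embeds_realizes em _; exact: trP].
  - by rewrite map_inj_in_uniq ?pres_uniq //; exact: embeds_inj em.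
  - move=> U /presP[w [exw imw ->]] _.
    have /= /and4P[wP /eqP w1 exw2 _] := exw.
    have wE : w = [::] ++ map (glab (cons 2)) (p2 w) by rewrite (eq_map glab_e2); exact: p1_nil.
    apply/mapP; exists (canon (p2 w)); last by rewrite {1}wE (embeds_canon _ em).
    by apply/presP; exists (p2 w); split=> //; rewrite wE in imw; rewrite -(em_imax em).
rewrite dO (decomposes_pres trP) !big_map big_distrr /=; apply: eq_bigr => U _.
by rewrite mulrA; congr (_ * _)%R; exact: (em_value em).
Qed.

(** The preruns of the operands embed disjointly, told apart by the label of the choice. The sum
    type as index keeps both families, even where their traces coincide. *)
Lemma outcome_oplus P Q R :
  outcome (Par (oplus P Q) R) = (outcome (Par P R) + outcome (Par Q R))%R.
Proof.
have [trP hP] := trace_of P; have [trQ hQ] := trace_of Q.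
have em1 := oplus_embeds1 P Q; have em2 := oplus_embeds2 P Q.
pose Sf (j : seq lab + seq lab) := match j with
  | inl U => [:: I [:: 1; 1] [:: 2]] ++ map (glab gL) U
  | inr U => [:: I [:: 1; 2] [:: 2]] ++ map (glab g12) U end.
pose tr j := match j with inl U => trP U | inr U => trQ U end.
pose js := map inl (pres P) ++ map inr (pres Q).
have dO : decomposes (oplus P Q) [seq (value (oplus P Q) (Sf j), tr j) | j <- js].
  apply: decomposition.
  - move=> j; rewrite mem_cat => /orP[]/mapP[U UP ->].
      by split; [exact: embeds_pres em1 UP|apply: embeds_realizes em1 _; exact: hP].
    by split; [exact: embeds_pres em2 UP|apply: embeds_realizes em2 _; exact: hQ].
  - rewrite map_cat -!map_comp cat_uniq; apply/and3P; split.
    + by rewrite map_inj_in_uniq ?pres_uniq //; exact: embeds_inj em1.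
    + apply/hasPn => U /mapP[U2 _ ->]; apply/mapP => -[U1 _ /canonP /perm_mem/(_ (I [:: 1; 2] [:: 2]))].
      by rewrite mem_head inE /= => /esym/mapP[[//|[a b]] _ []].
    + by rewrite map_inj_in_uniq ?pres_uniq //; exact: embeds_inj em2.
  - move=> U /presP[w [exw imw ->]] _; rewrite map_cat -!map_comp mem_cat.
    case: (oplus_cases exw imw) => -[w' wE exw']; apply/orP; [left|right]; apply/mapP; exists (canon w').
    + by apply/presP; exists w'; split=> //; rewrite wE in imw; rewrite -(em_imax em1).
    + by rewrite wE /= -(embeds_canon _ em1).
    + by apply/presP; exists w'; split=> //; rewrite wE in imw; rewrite -(em_imax em2).
    + by rewrite wE /= -(embeds_canon _ em2).
rewrite dO (decomposes_pres hP) (decomposes_pres hQ) big_map big_cat !big_map.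
by congr (_ + _)%R; apply: eq_bigr => U _; congr (_ * _)%R; rewrite -[RHS]mul1r;
  [exact: (em_value em1)|exact: (em_value em2)].
Qed.

End Final.

Theorem theorem5p6 (K : comPzSemiRingType) (P : term K) :
  exists (T0 : trace) (k0 : K) (l : seq (K * trace)),
    obs_equiv P
      (foldl (fun acc kT => oplus acc (kdot kT.1 (impl K kT.2)))
             (kdot k0 (impl K T0)) l).
Proof.
(* The left fold needs a first term; [trace0] with coefficient 0 contributes nothing. *)
have [D PD] := decomposes_trace P; exists trace0, 0%R, D => R; rewrite PD.
have gen acc l : outcome (Par (foldl (fun acc kT => oplus acc (kdot kT.1 (impl K kT.2))) acc l) R) =
   (outcome (Par acc R) + \sum_(x <- l) x.1 * HTT x.2 R)%R.
  elim: l acc => [|[k T] l IH] acc /=; first by rewrite big_nil addr0.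
  by rewrite IH outcome_oplus outcome_kdot decomposes_impl big_cons big_seq1 /= mul1r addrA.
by rewrite gen outcome_kdot mul0r add0r.
Qed.
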